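(* Let $p\in[1,\infty)$ and $r>0$. For all potential matrices $Q,\widetilde Q\in\mathbb{U}_{p,r}^{2\times2}$ the kernels of the corresponding transformation operators satisfy $$K^{\pm}_Q,\ K^{\pm}_{\widetilde Q}\in X^0_{1,p}(\Omega;\mathbb{C}^{2\times2})\cap X^0_{\infty,p}(\Omega;\mathbb{C}^{2\times2}),$$ and there exists a constant $C=C(B,p,r)$, not depending on $Q$ and $\widetilde Q$, such that $$\|K_Q^{\pm}-K_{\widetilde Q}^{\pm}\|_{X_{\infty,p}(\Omega;\mathbb{C}^{2\times2})}+\|K_Q^{\pm}-K_{\widetilde Q}^{\pm}\|_{X_{1,p}(\Omega;\mathbb{C}^{2\times2})}\le C\cdot\|Q-\widetilde Q\|_p .$$
   Context: Fix real numbers $b_1<0<b_2$ and $B=\operatorname{diag}(b_1,b_2)$. A potential matrix is $Q=\begin{pmatrix}0&Q_{12}\\Q_{21}&0\end{pmatrix}$ with entries in $L^1[0,1]$; $\|Q\|_p$ is its norm in $L^p([0,1];\mathbb{C}^{2\times 2})$, and $\mathbb{U}_{p,r}^{2\times2}$ is the set of potential matrices with $\|Q\|_p\le r$. Let $\Omega=\{(x,t):0\le t\le x\le1\}$. For $p\in[1,\infty)$, $X_{1,p}(\Omega)$ and $X_{\infty,p}(\Omega)$ are the Banach spaces of (classes of) measurable functions on $\Omega$ with finite norms $$\|f\|_{X_{1,p}}^p=\operatorname*{ess\,sup}_{t\in[0,1]}\int_t^1|f(x,t)|^p\,dx,\qquad \|f\|_{X_{\infty,p}}^p=\operatorname*{ess\,sup}_{x\in[0,1]}\int_0^x|f(x,t)|^p\,dt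 ,$$ respectively; $X^0_{1,p}(\Omega)$, $X^0_{\infty,p}(\Omega)$ are the closures of $C(\Omega)$ in them. Spaces with $(\Omega;\mathbb{C}^{2\times2})$ consist of $2\times2$ matrix functions with entries in the scalar space, with the corresponding norm (absolute value replaced by a matrix norm). Transformation operators: let $e_{\pm}(\cdot,\lambda)=e_{\pm,Q}(\cdot,\lambda)$ be the solution of $-iB^{-1}y'+Q(x)y=\lambda y$ on $[0,1]$ with $e_\pm(0,\lambda)=\binom{1}{\pm1}$, and $e^0_\pm(x,\lambda)=\binom{e^{ib_1\lambda x}}{\pm e^{ib_2\lambda x}}$. It is known that there are (uniquely determined) matrix kernels $K^\pm_Q=(K^\pm_{jk})_{j,k=1}^2\in X^0_{1,1}(\Omega;\mathbb{C}^{2\times2})\cap X^0_{\infty,1}(\Omega;\mathbb{C}^{2\times2})$ with $$e_\pm(x,\lambda)=e^0_\pm(x,\lambda)+\int_0^xK_Q^\pm(x,t)e^0_\pm(t,\lambda)\,dt,\qquad x\in[0,1],\ \lambda\in\mathbb{C}.$$ These are the kernels of the transformation operators for $Q$. *)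

(* Defs.v *)
From HB Require Import structures.
From mathcomp Require Import all_boot all_order all_algebra.
From mathcomp Require Import complex.
From mathcomp Require Import all_classical all_reals all_analysis.
From mathcomp Require Import ess_sup_inf.

Set Implicit Arguments.
Unset Strict Implicit.
Unset Printing Implicit Defensive.

Import Order.TTheory GRing.Theory Num.Theory.
Import numFieldNormedType.Exports.

Local Open Scope classical_set_scope.
Local Open Scope ring_scope.
Local Open Scope complex_scope.

Definition cexp (R : realType) (z : R[i]) : R[i] :=
  (expR (complex.Re z))%:C *
  (cos (complex.Im z) +i* sin (complex.Im z)).

Definition cmeasurable_fun d (T : measurableType d) (R : realType)
    (D : set T) (f : T -> R[i]) : Prop :=
  measurable_fun D (fun x => complex.Re (f x)) /\
  measurable_fun D (fun x => complex.Im (f x)).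

Definition cintegrable (R : realType) (D : set R) (f : R -> R[i]) : Prop :=
  (@lebesgue_measure R).-integrable D (fun x => (complex.Re (f x))%:E) /\
  (@lebesgue_measure R).-integrable D (fun x => (complex.Im (f x))%:E).

Definition cintegral (R : realType) (D : set R) (f : R -> R[i]) : R[i] :=
  (\int[@lebesgue_measure R]_(x in D) complex.Re (f x)) +i*
  (\int[@lebesgue_measure R]_(x in D) complex.Im (f x)).

Definition vintegral (R : realType) (D : set R) (f : R -> 'cV[R[i]]_2) :
    'cV[R[i]]_2 :=
  \col_j cintegral D (fun x => f x j 0).

Definition ccontinuous_on (T : topologicalType) (R : realType)
    (D : set T) (f : T -> R[i]) : Prop :=
  {within D, continuous (fun x => complex.Re (f x))} /\
  {within D, continuous (fun x => complex.Im (f x))}.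

Definition is_cderive (R : realType) (f : R -> R[i]) (x : R) (d : R[i]) : Prop :=
  is_derive x 1 (fun u => complex.Re (f u)) (complex.Re d) /\
  is_derive x 1 (fun u => complex.Im (f u)) (complex.Im d).

(* [u i, v i] may be degenerate; such intervals contribute 0 to both sums. *)
Definition abs_continuous (R : realType) (a b : R) (f : R -> R[i]) : Prop :=
  forall eps : R, 0 < eps -> exists2 delta : R, 0 < delta &
    forall (n : nat) (u v : 'I_n -> R),
      (forall i, a <= u i /\ u i <= v i /\ v i <= b) ->
      trivIset [set: 'I_n] (fun i => [set` `]u i, v i[]) ->
      \sum_(i < n) (v i - u i) < delta ->
      \sum_(i < n) Normc.normc (f (v i) - f (u i)) < eps.

Definition is_mxnorm (R : realType) (N : 'M[R[i]]_2 -> R) : Prop :=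
  [/\ forall A, N A = 0 -> A = 0,
      forall A1 A2, N (A1 + A2) <= N A1 + N A2
    & forall (c : R[i]) A, N (c *: A) = Normc.normc c * N A].

Definition potential_matrix (R : realType) (Q : R -> 'M[R[i]]_2) : Prop :=
  (forall x, x \in `[0, 1] -> Q x 0 0 = 0 /\ Q x 1 1 = 0) /\
  (forall j k, cintegrable `[0, 1] (fun x => Q x j k)).

Definition Lpnorm (R : realType) (N : 'M[R[i]]_2 -> R) (p : R)
    (Q : R -> 'M[R[i]]_2) : \bar R :=
  ((\int[@lebesgue_measure R]_(x in `[0%R, 1%R]) (N (Q x) `^ p)%:E) `^ p^-1)%E.

Definition Upr (R : realType) (N : 'M[R[i]]_2 -> R) (p r : R)
    (Q : R -> 'M[R[i]]_2) : Prop :=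
  potential_matrix Q /\ (Lpnorm N p Q <= r%:E)%E.

Definition Omega (R : realType) : set (R * R) :=
  [set z | 0 <= z.2 /\ z.2 <= z.1 /\ z.1 <= 1].

Definition ess_sup01 (R : realType) (g : R -> \bar R) : \bar R :=
  ess_sup (mrestr (@lebesgue_measure R) (measurable_itv `[0, 1])) g.

(* The norms below take the pointwise size a(x,t) >= 0 of f: the modulus for
   scalar f, a matrix norm for matrix-valued f. *)
Definition X1norm (R : realType) (p : R) (a : R * R -> R) : \bar R :=
  (ess_sup01 (fun t : R =>
     \int[@lebesgue_measure R]_(x in `[t, 1%R]) (a (x, t) `^ p)%:E) `^ p^-1)%E.

Definition Xinfnorm (R : realType) (p : R) (a : R * R -> R) : \bar R :=
  (ess_sup01 (fun x : R =>
     \int[@lebesgue_measure R]_(t in `[0%R, x]) (a (x, t) `^ p)%:E) `^ p^-1)%E.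

Definition cabs (R : realType) (f : R * R -> R[i]) : R * R -> R :=
  fun z => Normc.normc (f z).

Definition X1 (R : realType) (p : R) (f : R * R -> R[i]) : Prop :=
  cmeasurable_fun (@Omega R) f /\ (X1norm p (cabs f) < +oo)%E.

Definition Xinf (R : realType) (p : R) (f : R * R -> R[i]) : Prop :=
  cmeasurable_fun (@Omega R) f /\ (Xinfnorm p (cabs f) < +oo)%E.

Definition X1_0 (R : realType) (p : R) (f : R * R -> R[i]) : Prop :=
  X1 p f /\
  forall eps : R, 0 < eps -> exists2 F : R * R -> R[i],
    ccontinuous_on (@Omega R) F &
    (X1norm p (cabs (fun z => f z - F z)%R) < eps%:E)%E.

Definition Xinf_0 (R : realType) (p : R) (f : R * R -> R[i]) : Prop :=
  Xinf p f /\
  forall eps : R, 0 < eps -> exists2 F : R * R -> R[i],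
    ccontinuous_on (@Omega R) F &
    (Xinfnorm p (cabs (fun z => f z - F z)%R) < eps%:E)%E.

Definition mxX0 (R : realType) (p : R) (K : R * R -> 'M[R[i]]_2) : Prop :=
  forall j k, X1_0 p (fun z => K z j k) /\ Xinf_0 p (fun z => K z j k).

Definition col2 (R : realType) (a b : R[i]) : 'cV[R[i]]_2 :=
  \col_j [:: a; b]`_j.

Definition Bmx (R : realType) (b1 b2 : R) : 'M[R[i]]_2 :=
  diag_mx (col2 b1%:C b2%:C)^T.

(* s = false stands for the upper sign +, s = true for the lower sign -. *)
Definition e0 (R : realType) (b1 b2 : R) (s : bool) (lambda : R[i]) (x : R) :
    'cV[R[i]]_2 :=
  col2 (cexp ('i * b1%:C * lambda * x%:C))
       ((-1) ^+ s * cexp ('i * b2%:C * lambda * x%:C)).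

(* y = e_{+,Q}(., lambda) (s = false) or e_{-,Q}(., lambda) (s = true): since Q
   is only L^1, a solution is absolutely continuous and satisfies the equation
   almost everywhere. *)
Definition is_e (R : realType) (b1 b2 : R) (Q : R -> 'M[R[i]]_2) (s : bool)
    (lambda : R[i]) (y : R -> 'cV[R[i]]_2) : Prop :=
  [/\ forall j, abs_continuous 0 1 (fun x => y x j 0),
      {ae @lebesgue_measure R, forall x, x \in `[0, 1] ->
        exists2 dy : 'cV[R[i]]_2,
          forall j, is_cderive (fun u => y u j 0) x (dy j 0) &
          - 'i *: (invmx (Bmx b1 b2) *m dy) + Q x *m y x = lambda *: y x}
    & y 0 = col2 1 ((-1) ^+ s)].

(* For every x in [0,1] the slice K(x,.) is required to be integrable, so that
   the integral in the representation is meaningful; K is thus a representative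
   of its class whose slices are the traces of the X_{infty,1}^0-class. *)
Definition is_kernel (R : realType) (b1 b2 : R) (Q : R -> 'M[R[i]]_2)
    (s : bool) (K : R * R -> 'M[R[i]]_2) : Prop :=
  [/\ mxX0 1 K,
      forall (x : R) j k, x \in `[0, 1] ->
        cintegrable `[0, x] (fun t => K (x, t) j k)
    & forall (lambda : R[i]) (y : R -> 'cV[R[i]]_2),
        is_e b1 b2 Q s lambda y ->
        forall x : R, x \in `[0, 1] ->
          y x = e0 b1 b2 s lambda x +
            vintegral `[0, x] (fun t => K (x, t) *m e0 b1 b2 s lambda t)].

(* Main.v *)
(* For [lambda = - i nu] all exponentials are real and, split into real and imaginary parts,
   the system becomes [y_i' = nu c_i y_i + \sum_j A_ij y_j] with [A_ij = 0] unless [i] and [j]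
   travel with different speeds.  Writing
     [y_i(x) = e_i exp(nu c_i x) + \int_0^x exp(nu (d_i xi + c_i (x - xi))) V_i(x, xi) dxi]
   turns it into a Goursat problem for [V] that does not involve [nu]; rescaling [xi] on both
   sides of the zero of the phase shows that the kernel of the transformation operator is [V]
   read along lines.  For continuous potentials, Jensen and Gronwall bound the [L^p] norms of
   the slices of [V], and of differences of two such [V], by the [L^p] norms of the potentials.
   For general [Q], approximate by continuous potentials: the solutions converge to a solution
   for [Q], so the Laplace-type integrals of the approximate kernels converge to those of
   [K(x, .)].  Since [b1 < 0 < b2], these integrals determine the two columns of the kernel,
   hence the approximate kernels converge to [K(x, .)] a.e. for every [x], and by Tonelli also
   on almost every vertical slice.  Fatou's lemma transfers the bounds to the limit. *)

Require Import Defs.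
From HB Require Import structures.
From mathcomp Require Import all_boot all_order all_algebra.
From mathcomp Require Import complex.
From mathcomp Require Import all_classical all_reals all_analysis.
From mathcomp Require Import ring lra ess_sup_inf measurable_realfun.

Import Order.TTheory GRing.Theory Num.Theory.
Import numFieldNormedType.Exports.

Local Open Scope classical_set_scope.
Local Open Scope ring_scope.

Local Notation leb := (@lebesgue_measure).

(** * Calculus on segments *)

(** [is_kernel] constrains [K] only through solutions of the differential equation, and no solution
    is given for a merely integrable [Q]. The waves therefore serve twice: their limits are
    solutions on which [K] can be tested, and their amplitudes yield the continuous kernels that
    approximate [K]. As the equation for [V] is free of [nu], one sequence of kernels serves all
    [nu] at once, as the uniqueness statement requires. Approximations run at the rate [2^-1 ^+ n]:
    summable increments give almost everywhere convergence of the whole sequence, whereas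
    subsequences would depend on the slice. Vertical slices of the kernel are oblique lines for [V];
    hence every estimate comes in two forms, for horizontal slices and for lines of positive slope.
    Estimates are kept for p-th powers, linearly in a bound of the p-th power of the distance of the
    coefficients; roots are taken only at the end. The resulting Lipschitz estimate is used three
    times: between two potentials, against the zero potential (finite norms), and against continuous
    approximations (closures of the continuous functions). *)

Lemma continuous_integrable (R : realType) (a b : R) (f : R -> R) :
  continuous f -> (leb R).-integrable `[a, b] (EFin \o f).
Proof.
move=> cf; apply: continuous_compact_integrable; first exact: segment_compact.
exact: continuous_subspaceT.
Qed.

Lemma continuous_affine (R : realType) (al be : R) :
  continuous (fun x : R => al * x + be).
Proof.
move=> x; apply: cvgD; last exact: cvg_cst.
by apply: cvgM; [exact: cvg_cst|exact: cvg_id].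
Qed.

Lemma continuous_comp_affine (R : realType) (al be : R) (f : R -> R) :
  continuous f -> continuous (fun x : R => f (al * x + be)).
Proof.
move=> cf x; apply: (@continuous_comp _ _ _ (fun x : R => al * x + be) f).
  exact: continuous_affine.
exact: cf.
Qed.

Lemma Rintegral_chasles (R : realType) (a b c : R) (f : R -> R) :
  continuous f -> a <= b -> b <= c ->
  \int[leb R]_(x in `[a, c]) f x =
  \int[leb R]_(x in `[a, b]) f x +
  \int[leb R]_(x in `[b, c]) f x.
Proof.
move=> cf ab bc; have iac := continuous_integrable R a c f cf.
rewrite -(@Rintegral_itv_obnd_cbnd _ b (BRight c)); last first.
  apply: integrableS iac => //.
  by apply: subset_itvr; rewrite bnd_simp.
rewrite -(@Rintegral_itvB _ f (BLeft a) (BRight c) b)// ?bnd_simp//.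
by rewrite addrC subrK.
Qed.

Lemma Rintegral_affine (R : realType) (al be a b : R) (f : R -> R) :
  0 < al -> a <= b -> continuous f ->
  \int[leb R]_(x in `[al * a + be, al * b + be]) f x =
  al * \int[leb R]_(x in `[a, b]) f (al * x + be).
Proof.
move=> al0 ab cf.
have dF (x : R) : is_derive x 1 (fun x => al * x + be) al.
  by apply: is_derive_eq; rewrite /GRing.scale/= mulr1 addr0.
have F' : (fun x => al * x + be)^`()%classic = cst al.
  by apply/funext => x; rewrite derive1E derive_val.
have cF := continuous_affine R al be.
rewrite -RintegralZl//; last first.
  exact: (continuous_integrable _ _ _ _ (continuous_comp_affine R al be f cf)).
rewrite /Rintegral (@integration_by_substitution_increasing _ (fun x => al * x + be))//.
- by rewrite F'; congr fine; apply: eq_integral => x _; rewrite !fctE mulrC.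
- by move=> x y _ _ xy; rewrite ltrD2r ltr_pM2l.
- by rewrite F' => ? _; exact: cvg_cst.
- by rewrite F'; exact: is_cvg_cst.
- by rewrite F'; exact: is_cvg_cst.
- split.
  + by move=> x _; exact: ex_derive.
  + by apply: cvg_at_right_filter; exact: cF.
  + by apply: cvg_at_left_filter; exact: cF.
- exact: continuous_subspaceT.
Qed.

Lemma Rintegral_reflect (R : realType) (x : R) (f : R -> R) :
  0 <= x -> continuous f ->
  \int[leb R]_(t in `[0, x]) f (x - t) =
  \int[leb R]_(t in `[0, x]) f t.
Proof.
move=> x0 cf.
have cg : continuous (fun t : R => f (1 * t + x)) by exact: continuous_comp_affine.
transitivity (\int[leb R]_(t in `[- x, 0]) f (1 * t + x)).
  have := @integration_by_substitution_oppr R _ 0 x x0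
    (continuous_subspaceT cg).
  rewrite oppr0 /Rintegral => ->; congr fine.
  by apply: eq_integral => t _ /=; rewrite mul1r addrC.
have := Rintegral_affine R 1 x (- x) 0 f ltr01 _ cf.
by rewrite !mul1r addNr add0r oppr_le0 => -> //.
Qed.

Lemma continuous_prodl (R : realType) (phi : R * R -> R) (z : R) :
  continuous phi -> continuous (fun s => phi (s, z)).
Proof.
move=> cphi s; apply: (@continuous_comp _ _ _ (fun s : R => (s, z)) phi).
  apply: (@cvg_pair _ _ _ (nbhs s) (nbhs s) (nbhs z) _ _ _ id (cst z)).
    exact: cvg_id.
  exact: cvg_cst.
exact: cphi.
Qed.

Lemma continuous_prodr (R : realType) (phi : R * R -> R) (z : R) :
  continuous phi -> continuous (fun s => phi (z, s)).
Proof.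
move=> cphi s; apply: (@continuous_comp _ _ _ (fun s : R => (z, s)) phi).
  apply: (@cvg_pair _ _ _ (nbhs s) (nbhs z) (nbhs s) _ _ _ (cst z) id).
    exact: cvg_cst.
  exact: cvg_id.
exact: cphi.
Qed.

(** The product sigma-algebra is generated by measurable rectangles, so an open set has to be
    written as a countable union of them: rational boxes indexed by two pairs of endpoints, a box
    not contained in [U] being replaced by the empty set. *)
Lemma open_measurable2 (R : realType) (U : set (R * R)) : open U -> measurable U.
Proof.
have cover : open U -> U = \bigcup_(i : rat * rat * (rat * rat))
    (if `[< `]ratr i.1.1, ratr i.1.2[%classic `*` `]ratr i.2.1, ratr i.2.2[%classic `<=` U >]
     then `]ratr i.1.1, ratr i.1.2[%classic `*` `]ratr i.2.1, ratr i.2.2[%classic else set0).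
  move=> oU; apply/seteqP; split=> [[x y] Uxy|z [i _]]; last first.
    by case: ifPn => // /asboolP; apply.
  have : nbhs (x, y) U by exact: open_nbhs_nbhs.
  move=> [[/= A B] [/nbhs_ballP[e1 /= e10 eA] /nbhs_ballP[e2 /= e20 eB]] AB].
  have [a1] := @rat_in_itvoo R (x - e1) x ltac:(lra); rewrite in_itv/= => /andP[a1l a1r].
  have [a2] := @rat_in_itvoo R x (x + e1) ltac:(lra); rewrite in_itv/= => /andP[a2l a2r].
  have [c1] := @rat_in_itvoo R (y - e2) y ltac:(lra); rewrite in_itv/= => /andP[c1l c1r].
  have [c2] := @rat_in_itvoo R y (y + e2) ltac:(lra); rewrite in_itv/= => /andP[c2l c2r].
  exists ((a1, a2), (c1, c2)) => //=.
  case: ifPn => [_|/asboolP[]]; first by split; rewrite /= in_itv/=; lra.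
  move=> [u v] [/= uI vI]; apply: AB; split => /=.
    by apply: eA; rewrite ball_itv/=; move: uI; rewrite /= !in_itv/=; lra.
  by apply: eB; rewrite ball_itv/=; move: vI; rewrite /= !in_itv/=; lra.
move=> /cover ->; apply: countable_bigcupT_measurable; first exact: countableP.
by move=> i; case: ifPn => // _; exact: measurableX.
Qed.

Lemma continuous_measurable2 (R : realType) (phi : R * R -> R) :
  continuous phi -> measurable_fun setT phi.
Proof.
move=> cphi; apply: (measurability _ (RGenOInfty.measurableE R)) => _ [_ [r ->] <-].
rewrite setTI; apply: open_measurable2; apply: open_comp; last exact: interval_open.
by move=> x _; exact: cphi.
Qed.

Lemma patch_itvE (R : realType) (a b : R) (f : R -> \bar R) (u : R) :
  (f \_ `[a, b]) u = if a <= u <= b then f u else 0%E.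
Proof. by rewrite patchE mem_setE in_itv. Qed.

(** Fubini for the closed triangle [D] of the points (s, xi) with 0 <= xi <= s <= x. Extending [phi]
    by zero off [D] makes both sides iterated integrals of one function on the plane; it is
    integrable since [phi] is bounded on the compact square around [D]. *)
Lemma Rintegral_triangle_swap (R : realType) (x : R) (phi : R * R -> R) :
  0 <= x -> continuous phi ->
  \int[leb R]_(xi in `[0, x])
    (\int[leb R]_(s in `[xi, x]) phi (s, xi)) =
  \int[leb R]_(s in `[0, x])
    (\int[leb R]_(xi in `[0, s]) phi (s, xi)).
Proof.
move=> x0 cphi.
pose I0x : set R := `[0, x]%classic.
have mI : measurable I0x by exact: measurable_itv.
pose D : set (R * R) := [set z | 0 <= z.2] `&` ([set z | z.2 <= z.1] `&` [set z | z.1 <= x]).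
have mD : measurable D.
  have m1 : measurable_fun [set: R * R] (fst : R * R -> R) by exact: measurable_fst.
  have m2 : measurable_fun [set: R * R] (snd : R * R -> R) by exact: measurable_snd.
  have mle (f g : R * R -> R) : measurable_fun setT f -> measurable_fun setT g ->
      measurable [set z | f z <= g z].
    by move=> mf mg; have := measurable_fun_le measurableT mf mg; rewrite setTI.
  by apply: measurableI; [|apply: measurableI]; apply: mle => //; exact: measurable_cst.
have Dsub : D `<=` I0x `*` I0x.
  by move=> [u v] [/= v0 [vu ux]]; split; rewrite /I0x/= in_itv/=; lra.
have Dfin : (((leb R) \x (leb R)) D < +oo)%E.
  apply: (@le_lt_trans _ _ (((leb R) \x (leb R)) (I0x `*` I0x))%E).
    by apply: le_measure => //; rewrite inE//; exact: measurableX.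
  have lI : (leb R I0x < +oo)%E.
    by apply: compact_finite_measure; exact: segment_compact.
  by rewrite product_measure1E//; apply: lte_mul_pinfty => //; rewrite ge0_fin_numE.
pose f := (EFin \o phi) \_ D.
have intf : ((leb R) \x (leb R))%E.-integrable setT f.
  rewrite /f -integrable_mkcond//; apply: measurable_bounded_integrable => //.
    by apply: measurable_funTS; exact: continuous_measurable2.
  have : bounded_set (phi @` (I0x `*` I0x)).
    apply: compact_bounded; apply: continuous_compact; first exact: continuous_subspaceT.
    by apply: compact_setX; exact: segment_compact.
  move=> [M [Mr HM]]; exists M; split => // r Mr' z Dz.
  by apply: HM => //; exists z => //; exact: Dsub.
have fin a b (g : R -> R) : continuous g ->
    (\int[leb R]_(s in `[a, b]) (g s)%:E)%E \is a fin_num.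
  by move=> cg; apply: integrable_fin_num => //; exact: continuous_integrable.
rewrite /Rintegral; congr fine.
transitivity (\int[leb R]_v \int[leb R]_u f (u, v))%E; last first.
  rewrite -Fubini// [RHS]integral_mkcond; apply: eq_integral => u _.
  rewrite [RHS]patch_itvE; case: ifPn.
    move=> /andP[u0 ux]; rewrite fineK; last exact/fin/continuous_prodr.
    rewrite [RHS]integral_mkcond; apply: eq_integral => v _.
    rewrite patch_itvE /f patchE; congr (if _ then _ else _).
    by apply/idP/idP; rewrite inE/= /D/=; lra.
  move=> ux; apply: integral0_eq => v _; rewrite /f patchE ifF//.
  by apply/negP; rewrite inE/D/= => -[? [? ?]]; move: ux; lra.
rewrite [LHS]integral_mkcond; apply: eq_integral => v _.
rewrite [LHS]patch_itvE; case: ifPn.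
  move=> /andP[v0 vx]; rewrite fineK; last exact/fin/continuous_prodl.
  rewrite [LHS]integral_mkcond; apply: eq_integral => u _.
  rewrite patch_itvE /f patchE; congr (if _ then _ else _).
  by apply/idP/idP; rewrite inE/= /D/=; lra.
move=> vx; apply/esym/integral0_eq => u _; rewrite /f patchE ifF//.
by apply/negP; rewrite inE/D/= => -[? [? ?]]; move: vx; lra.
Qed.
Lemma continuous_add_fun (R : realType) (T : topologicalType) (f g : T -> R) :
  continuous f -> continuous g -> continuous (fun z => f z + g z).
Proof. by move=> cf cg z; apply: cvgD; [exact: cf|exact: cg]. Qed.

Lemma continuous_sum_fun (R : realType) (T : topologicalType) (I : finType)
    (f : I -> T -> R) :
  (forall i, continuous (f i)) -> continuous (fun z => \sum_i f i z).
Proof. move=> cf; rewrite (_ : (fun z => _) = \sum_i f i).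
  by elim/big_ind: _ => [|g h cg ch|//]; [exact: cst_continuous|exact: continuous_add_fun].
by apply/funext => z; rewrite fct_sumE. Qed.

Lemma continuous_mul_fun (R : realType) (T : topologicalType) (f g : T -> R) :
  continuous f -> continuous g -> continuous (fun z => f z * g z).
Proof. by move=> cf cg z; apply: cvgM; [exact: cf|exact: cg]. Qed.

Lemma continuous_sub_fun (R : realType) (T : topologicalType) (f g : T -> R) :
  continuous f -> continuous g -> continuous (fun z => f z - g z).
Proof. by move=> cf cg z; apply: cvgB; [exact: cf|exact: cg]. Qed.

Lemma continuous_norm_fun (R : realType) (T : topologicalType) (f : T -> R) :
  continuous f -> continuous (fun z => `|f z|).
Proof. by move=> cf z; apply: cvg_norm; exact: cf. Qed.

Lemma continuous_comp_fun (T U V : topologicalType) (f : T -> U) (g : U -> V) :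
  continuous f -> continuous g -> continuous (fun z => g (f z)).
Proof. by move=> cf cg z; apply: (@continuous_comp _ _ _ f g); [exact: cf|exact: cg]. Qed.

Lemma continuous_pair_fun (T U V : topologicalType) (f : T -> U) (g : T -> V) :
  continuous f -> continuous g -> continuous (fun z => (f z, g z)).
Proof.
by move=> cf cg z; apply: (@cvg_pair _ _ _ (nbhs z) (nbhs (f z)) (nbhs (g z)));
  [exact: cf|exact: cg].
Qed.

Lemma continuous_fst_fun (U V : topologicalType) : continuous (fun z : U * V => z.1).
Proof. by move=> z; exact: cvg_fst. Qed.

Lemma continuous_snd_fun (U V : topologicalType) : continuous (fun z : U * V => z.2).
Proof. by move=> z; exact: cvg_snd. Qed.

Lemma continuous_powR_fun (R : realType) (T : topologicalType) (p : R) (f : T -> R) :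
  1 <= p -> (forall z, 0 <= f z) -> continuous f -> continuous (fun z => f z `^ p).
Proof.
move=> p1 f0 cf.
(* Away from 0 the power is differentiable. At 0 continuity follows from u^p <= u for 0 < u <= 1,
   which uses [1 <= p]. *)
have cpow : continuous (fun t : R => `|t| `^ p).
  move=> t; have [->|t0] := eqVneq t 0.
    apply/cvgrPdist_le => e e0; rewrite normr0 powR0; last by lra.
    near=> u; rewrite sub0r normrN ger0_norm ?powR_ge0//.
    have [->|u0] := eqVneq u 0; first by rewrite normr0 powR0 ?ltW//; lra.
    have u1 : `|u| <= Num.min 1 e.
      near: u; apply: (@nbhs0_le R R^o); by rewrite lt_min ltr01.
    move: u1; rewrite le_min => /andP[u1 ue].
    by apply: le_trans ue; apply: ge1r_powR => //; rewrite normr_gt0 u0.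
  apply: (@continuous_comp _ _ _ (fun t : R => `|t|) (fun t => t `^ p)).
    exact: norm_continuous.
  apply: differentiable_continuous; apply/derivable1_diffP.
  by apply: derivable_powR; rewrite in_itv/= normr_gt0 t0.
have -> : (fun z => f z `^ p) = (fun z => `|f z| `^ p).
  by apply/funext => z; rewrite ger0_norm.
exact: continuous_comp_fun cpow.
Unshelve. all: by end_near. Qed.

Lemma powR_add_le (R : realType) (p x y : R) : 1 <= p -> 0 <= x -> 0 <= y ->
  (x + y) `^ p <= 2 `^ p * (x `^ p + y `^ p).
Proof.
move=> p1 x0 y0.
have p0 : 0 <= p by lra.
wlog xy : x y x0 y0 / x <= y.
  move=> H; have [xy|yx] := leP x y; first exact: H.
  by rewrite (addrC x) (addrC (x `^ p)); apply: H => //; exact: ltW.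
apply: (@le_trans _ _ ((2 * y) `^ p)).
  by apply: ge0_ler_powR; rewrite ?nnegrE//; lra.
by rewrite powRM//; apply: ler_wpM2l; rewrite ?powR_ge0// lerDr powR_ge0.
Qed.

(** The convex function t^p lies above its tangent at [c]. This is read off from Young's inequality
    for [h] and c^(p-1) with exponents p and p / (p - 1); the case p = 1, where the second exponent
    is infinite, is separate. *)
Lemma powR_tangent (R : realType) (p c h : R) : 1 <= p -> 0 <= c -> 0 <= h ->
  p * c `^ (p - 1) * h <= h `^ p + (p - 1) * c `^ p.
Proof.
move=> p1 c0 h0; have [->|p_neq1] := eqVneq p 1.
  by rewrite subrr powRr0 powRr1//; lra.
have p1' : 0 < p - 1 by rewrite subr_gt0 lt_neqAle eq_sym p_neq1.
have p0 : 0 < p by lra.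
have q0 : 0 < p / (p - 1) by rewrite divr_gt0.
have := @conjugate_powR R h (c `^ (p - 1)) p (p / (p - 1)) h0 (powR_ge0 _ _) p0 q0.
have -> : p^-1 + (p / (p - 1))^-1 = 1 by rewrite invf_div; field; lra.
move=> /(_ erefl); rewrite -powRrM.
have -> : (p - 1) * (p / (p - 1)) = p by field; lra.
move=> H; have := ler_wpM2l (ltW p0) H.
rewrite mulrDr invf_div.
have -> : p * (h `^ p / p) = h `^ p by field; lra.
have -> : p * (c `^ p * ((p - 1) / p)) = (p - 1) * c `^ p by field; lra.
by rewrite -mulrA (mulrC h).
Qed.

(** Jensen's inequality for the measure q ds, given only an upper bound [m] of its mass: the tangent
    inequality is integrated at the fictitious mean X / m. A bound of the mass on [0, 1] can thus be
    used on every subinterval. *)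
Lemma Rintegral_jensen (R : realType) (p m a b : R) (q h : R -> R) :
  1 <= p -> 0 < m -> continuous q -> continuous h ->
  (forall s, 0 <= q s) -> (forall s, 0 <= h s) ->
  \int[leb R]_(s in `[a, b]) q s <= m ->
  (\int[leb R]_(s in `[a, b]) (q s * h s)) `^ p <=
  m `^ (p - 1) * \int[leb R]_(s in `[a, b]) (q s * h s `^ p).
Proof.
move=> p1 m0 cq ch q0 h0 qm.
set X := \int[_]_(_ in _) (q _ * h _).
set Y := \int[_]_(_ in _) (q _ * h _ `^ p).
have chp : continuous (fun s => h s `^ p) by exact: continuous_powR_fun.
have X0 : 0 <= X by apply: Rintegral_ge0 => s _; exact: mulr_ge0.
pose c := X / m.
have c0 : 0 <= c by rewrite divr_ge0// ltW.
have : p * c `^ (p - 1) * X <= Y + (p - 1) * c `^ p * m.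
  apply: (@le_trans _ _ (Y + (p - 1) * c `^ p * \int[leb R]_(s in `[a, b]) q s)).
    have cqh := continuous_mul_fun _ _ q h cq ch.
    have cqhp := continuous_mul_fun _ _ q _ cq chp.
    have ccq := continuous_mul_fun R R (cst ((p - 1) * c `^ p)) q (@cst_continuous _ _ _) cq.
    rewrite -RintegralZl//; last exact: continuous_integrable.
    rewrite -RintegralZl//; last exact: continuous_integrable.
    rewrite -RintegralD//; [|exact: continuous_integrable..].
    apply: le_Rintegral => //.
    - apply: continuous_integrable.
      exact: (continuous_mul_fun R R (cst _) _ (@cst_continuous _ _ _) cqh).
    - exact: (continuous_integrable _ _ _ _ (continuous_add_fun _ _ _ _ cqhp ccq)).
    move=> s _.
    have := powR_tangent R p c (h s) p1 c0 (h0 s).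
    move=> /(ler_wpM2l (q0 s)); lra.
  by rewrite lerD2l ler_wpM2l// mulr_ge0 ?powR_ge0//; lra.
(* As X = c m, the tangent terms combine into c^p m <= Y, and X^p = c^p m m^(p-1). *)
have -> : p * c `^ (p - 1) * X = p * (c `^ p * m).
  rewrite -mulrA; congr (_ * _).
  rewrite -[c `^ p]mulr_powRB1//; last by lra.
  by rewrite {2}/c; field; lra.
have cm : c `^ p * m * m `^ (p - 1) = X `^ p.
  rewrite -mulrA mulr_powRB1 ?(ltW m0)//; last by lra.
  rewrite -powRM ?(ltW m0)//; congr (_ `^ _); rewrite /c; field; lra.
move=> H; have {}H : c `^ p * m <= Y by lra.
by rewrite -cm mulrC; apply: ler_wpM2l H; exact: powR_ge0.
Qed.

Lemma continuous_Rintegral_param (R : realType) (a b : R) (phi : R * R -> R) :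
  continuous phi ->
  continuous (fun z => \int[leb R]_(s in `[a, b]) phi (s, z)).
Proof.
move=> cphi z0.
have cK : compact (`[a, b]%classic `*` `[z0 - 1, z0 + 1]%classic : set (R * R)).
  by apply: compact_setX; exact: segment_compact.
have [M [Mr HM]] : bounded_set (phi @` (`[a, b]%classic `*` `[z0 - 1, z0 + 1]%classic)).
  by apply: compact_bounded; apply: continuous_compact => //; exact: continuous_subspaceT.
have MM : M < `|M| + 1 by rewrite (le_lt_trans (ler_norm _))// ltrDl.
apply: (@continuity_under_integral R _ _ (leb R)
  (fun z s => phi (s, z)) `[a, b] _ (z0 - 1) (z0 + 1) _ _ (cst (`|M| + 1)) _ _ z0) => //.
- move=> z _; exact/continuous_integrable/continuous_prodl.
- apply: aeW => s _ z _; exact: continuous_prodr.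
- by apply: continuous_integrable; exact: cst_continuous.
- move=> z; rewrite /= in_itv/= => zI; apply: aeW => s sI.
  apply: (HM _ MM); exists (s, z) => //; split => //=.
  by rewrite in_itv/=; lra.
- by rewrite inE/= in_itv/=; lra.
Qed.

Lemma continuous_Rintegral_itv (R : realType) (T : topologicalType) (a b z : T -> R)
    (phi : R * R -> R) :
  continuous a -> continuous b -> continuous z -> continuous phi ->
  continuous (fun t => \int[leb R]_(s in `[a t, b t]) phi (s, z t)).
Proof.
move=> ca cb cz cphi.
(* Where b t < a t the interval is empty; replacing [b] by the maximum of [a] and [b] then leaves a
   single point, of integral 0, and keeps the endpoint continuous. *)
wlog ab : b cb / forall t, a t <= b t.
  move=> H; have := H (fun t => Num.max (a t) (b t)).
  have -> : (fun t => \int[leb R]_(s in `[a t, b t]) phi (s, z t)) =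
      (fun t => \int[leb R]_(s in `[a t, Num.max (a t) (b t)]) phi (s, z t)).
    apply/funext => t; have [ab|ba] := leP (a t) (b t); first by [].
    rewrite set_itv1 Rintegral_set1 set_itv_ge ?Rintegral_set0//.
    by rewrite bnd_simp -ltNge.
  apply; last by move=> t; rewrite le_max lexx.
  by move=> t; apply: (@continuous_max _ _ a b); [exact: ca|exact: cb].
(* Near t0 the integral is a difference of two integrals from a base point [c] strictly below
   [a t0], so only one endpoint moves in each. That movement changes the integral by at most M times
   the displacement, and the parameter is handled with the endpoint frozen. *)
suff cP (c : R) (u : T -> R) (t0 : T) : continuous u -> c < u t0 ->
    (\int[leb R]_(s in `[c, u t]) phi (s, z t)) @[t --> t0] -->
     \int[leb R]_(s in `[c, u t0]) phi (s, z t0).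
  move=> t0; pose c := a t0 - 1.
  have ca0 : c < a t0 by rewrite /c; lra.
  have cb0 : c < b t0 by have := ab t0; lra.
  have E t : c < a t -> \int[leb R]_(s in `[a t, b t]) phi (s, z t) =
      \int[leb R]_(s in `[c, b t]) phi (s, z t) -
      \int[leb R]_(s in `[c, a t]) phi (s, z t).
    move=> cat; rewrite (@Rintegral_chasles _ c (a t) (b t) _ _ (ltW cat) (ab t)).
      by rewrite addrAC subrr add0r.
    exact: continuous_prodl.
  rewrite /prop_for /continuous_at E//.
  have H := cvgB (cP c b t0 cb cb0) (cP c a t0 ca ca0).
  have {}H := H (nbhs_filter t0).
  apply: (cvg_trans _ H); apply: near_eq_cvg.
  near=> t; rewrite [RHS]E//; near: t.
  exact: (cvgr_gt (a t0) (ca t0) c ca0).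
move=> cu cut0.
have [L [L0 cL zL uL]] : exists L : R, [/\ 0 < L, `|c| < L, `|z t0| < L & `|u t0| < L].
  exists (`|c| + `|z t0| + `|u t0| + 1); split;
  have := normr_ge0 c; have := normr_ge0 (z t0); have := normr_ge0 (u t0); lra.
have [M0 [Mr HM]] : bounded_set (phi @` (`[- L, L]%classic `*` `[- L, L]%classic)).
  apply: compact_bounded; apply: continuous_compact; first exact: continuous_subspaceT.
  by apply: compact_setX; exact: segment_compact.
pose M : R := `|M0| + 1.
have {}HM (s w : R) : - L <= s <= L -> - L <= w <= L -> `|phi (s, w)| <= M.
  move=> sL wL; apply: (HM M).
    by rewrite /M (le_lt_trans (ler_norm _))// ltrDl.
  by exists (s, w) => //; split; rewrite /= in_itv.
have M0' : 0 < M by rewrite /M ltr_pwDr.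
have cL' : - L < c by move: cL; rewrite ltr_norml => /andP[].
have bnd (x y w : R) : c <= x -> x <= y -> y <= L -> - L <= w <= L ->
    `|\int[leb R]_(s in `[c, y]) phi (s, w) -
      \int[leb R]_(s in `[c, x]) phi (s, w)| <= M * (y - x).
  move=> cx xy yL wL.
  have cphw := continuous_prodl _ phi w cphi.
  rewrite (@Rintegral_chasles _ c x y)// addrAC subrr add0r.
  apply: (le_trans (le_normr_Rintegral _ _)) => //.
    exact: continuous_integrable.
  apply: (@le_trans _ _ (\int[leb R]_(s in `[x, y]) M)).
    apply: le_Rintegral => //.
    - by apply: continuous_integrable; exact: continuous_norm_fun.
    - by apply: continuous_integrable; exact: cst_continuous.
    by move=> s; rewrite /= in_itv/= => sI; apply: HM => //; lra.
  rewrite Rintegral_cst//= lebesgue_measure_itv/= lte_fin.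
  by case: ifPn => /=; rewrite ?mulr0// mulr_ge0//; lra.
apply/cvgrPdist_lt => e e0.
have cz0 : {for t0, continuous (fun t => \int[leb R]_(s in `[c, u t0]) phi (s, z t))}.
  apply: (@continuous_comp _ _ _ z
    (fun w => \int[leb R]_(s in `[c, u t0]) phi (s, w))); first exact: cz.
  exact: continuous_Rintegral_param.
have e2 : 0 < e / 2 by lra.
have uL2 : u t0 <= L by exact: le_trans (ler_norm _) (ltW uL).
have eM : 0 < e / (2 * M) by rewrite divr_gt0// mulr_gt0.
near=> t.
have H1 : `|\int[leb R]_(s in `[c, u t0]) phi (s, z t0) -
    \int[leb R]_(s in `[c, u t0]) phi (s, z t)| < e / 2.
  by near: t; move/cvgrPdist_lt : cz0; exact.
have ut : `|u t0 - u t| < e / (2 * M).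
  by near: t; move/cvgrPdist_lt : (cu t0); exact.
have zt : `|z t| < L.
  by near: t; apply: (cvgr_lt `|z t0|) zL; apply: cvg_norm; exact: cz.
have utL : `|u t| < L.
  by near: t; apply: (cvgr_lt `|u t0|) uL; apply: cvg_norm; exact: cu.
have cut : c < u t by near: t; exact: (cvgr_gt (u t0) (cu t0) c cut0).
have H2 : `|\int[leb R]_(s in `[c, u t]) phi (s, z t) -
    \int[leb R]_(s in `[c, u t0]) phi (s, z t)| <= M * `|u t0 - u t|.
  have ztL : - L <= z t <= L by move: zt; rewrite ltr_norml; lra.
  have [uu|uu] := leP (u t0) (u t).
    rewrite [`|u t0 - u t|]ler0_norm ?subr_le0//.
    by rewrite opprB; apply: bnd => //; [exact: ltW|exact: le_trans (ler_norm _) (ltW utL)].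
  rewrite distrC [`|u t0 - u t|]gtr0_norm ?subr_gt0//.
  by apply: bnd => //; exact: ltW.
have H3 : M * `|u t0 - u t| < e / 2.
  have -> : e / 2 = M * (e / (2 * M)) by field; lra.
  by rewrite ltr_pM2l.
rewrite distrC in H2.
have := ler_distD (\int[leb R]_(s in `[c, u t0]) phi (s, z t))
  (\int[leb R]_(s in `[c, u t0]) phi (s, z t0))
  (\int[leb R]_(s in `[c, u t]) phi (s, z t)).
lra.
Unshelve. all: by end_near. Qed.
(** * Gronwall and Volterra inequalities *)

Lemma le_Rintegral_continuous (R : realType) (a b : R) (f g : R -> R) :
  continuous f -> continuous g -> (forall x, a <= x <= b -> f x <= g x) ->
  \int[leb R]_(x in `[a, b]) f x <=
  \int[leb R]_(x in `[a, b]) g x.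
Proof.
move=> cf cg fg; apply: le_Rintegral; first exact: measurable_itv.
- exact: continuous_integrable cf.
- exact: continuous_integrable cg.
- by move=> x; rewrite /= in_itv/=; exact: fg.
Qed.

Lemma Rintegral_subitv (R : realType) (a b c d : R) (f : R -> R) :
  continuous f -> (forall x, a <= x <= b -> 0 <= f x) -> a <= c -> c <= d -> d <= b ->
  \int[leb R]_(x in `[c, d]) f x <=
  \int[leb R]_(x in `[a, b]) f x.
Proof.
move=> cf f0 ac cd db.
rewrite (Rintegral_chasles _ a c b)// ?(le_trans cd)// (Rintegral_chasles _ c d b)//.
have H1 : 0 <= \int[leb R]_(x in `[a, c]) f x.
  by apply: Rintegral_ge0 => x; rewrite /= in_itv/= => xI; apply: f0; lra.
have H2 : 0 <= \int[leb R]_(x in `[d, b]) f x.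
  by apply: Rintegral_ge0 => x; rewrite /= in_itv/= => xI; apply: f0; lra.
by rewrite addrCA lerDl addr_ge0.
Qed.

Lemma continuous_primitive (R : realType) (a : R) (f : R -> R) :
  continuous f -> continuous (fun x => \int[leb R]_(s in `[a, x]) f s).
Proof.
move=> cf; apply: (continuous_Rintegral_itv R R (cst a) id (cst 0) (fun z => f z.1)).
- exact: cst_continuous.
- by move=> x; exact: cvg_id.
- exact: cst_continuous.
- exact: (continuous_comp_fun _ _ _ _ _ (continuous_fst_fun _ _) cf).
Qed.

(** The integrand is the derivative of exp(k W), where W is the primitive of [w]. With a suitable
    [k] this weight absorbs the integral term both in Gronwall's inequality and in the Picard
    iteration. *)
Lemma Rintegral_exp_primitive (R : realType) (k x : R) (w : R -> R) :
  continuous w -> 0 <= x ->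
  \int[leb R]_(s in `[0, x])
    (k * w s * expR (k * \int[leb R]_(t in `[0, s]) w t)) =
  expR (k * \int[leb R]_(t in `[0, x]) w t) - 1.
Proof.
move=> cw; rewrite le_eqVlt => /predU1P[<-|x0].
  by rewrite !set_itv1 !Rintegral_set1 mulr0 expR0 subrr.
pose W s := \int[leb R]_(t in `[0, s]) w t.
have cW : continuous W by exact: continuous_primitive.
have ckw : continuous (fun s => k * w s).
  by apply: continuous_mul_fun => //; exact: cst_continuous.
have ceW : continuous (fun s => expR (k * W s)).
  apply: (continuous_comp_fun _ _ _ (fun s => k * W s)); last exact: continuous_expR.
  by apply: continuous_mul_fun => //; exact: cst_continuous.
have cf := continuous_mul_fun _ _ _ _ ckw ceW.
have dW (s : R) : 0 < s -> is_derive s 1 W (w s).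
  move=> s0; have [dW W's] := @continuous_FTC1_closed R w 0 s (s + 1)
    ltac:(lra) (continuous_integrable _ _ _ _ cw) s0 (cw s).
  by rewrite /W; apply: DeriveDef; [exact: dW|rewrite -derive1E; exact: W's].
have dF (s : R) : 0 < s -> is_derive s 1 (fun s : R => expR (k * W s)) (k * w s * expR (k * W s)).
  move=> /dW dWs; apply: is_derive_eq; rewrite /GRing.scale/=; ring.
rewrite /Rintegral (@continuous_FTC2 R _ (fun s => expR (k * W s)) 0 x x0).
- by rewrite /W set_itv1 Rintegral_set1 mulr0 expR0.
- exact: continuous_subspaceT.
- split.
  + by move=> s; rewrite in_itv/= => /andP[s0 _]; have [] := dF _ s0.
  + by apply: cvg_at_right_filter; exact: ceW.
  + by apply: cvg_at_left_filter; exact: ceW.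
- move=> s; rewrite in_itv/= => /andP[s0 _].
  by rewrite derive1E; have [_ ->] := dF _ s0.
Qed.

(** Instead of iterating, the supremum S of A exp(-k W) over [0, 1] is estimated at a point where it
    is attained. For k = 2 c1 the integral term contributes at most S / 2, so S <= c0 + S / 2; this
    is the origin of the factors 2. *)
Lemma gronwall (R : realType) (c0 c1 : R) (A w : R -> R) :
  0 <= c0 -> 0 < c1 -> continuous A -> continuous w ->
  (forall x, 0 <= A x) -> (forall x, 0 <= w x) ->
  (forall x, 0 <= x <= 1 ->
    A x <= c0 + c1 * \int[leb R]_(s in `[0, x]) (w s * A s)) ->
  forall x, 0 <= x <= 1 ->
    A x <= 2 * c0 * expR (2 * c1 * \int[leb R]_(s in `[0, 1]) w s).
Proof.
move=> c00 c10 cA cw A0 w0 H.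
pose W s := \int[leb R]_(t in `[0, s]) w t.
pose k := 2 * c1.
have k0 : 0 < k by rewrite /k; lra.
have W0 s : 0 <= W s by apply: Rintegral_ge0.
have ce l : continuous (fun s => expR (l * W s)).
  apply: (continuous_comp_fun _ _ _ (fun s => l * W s)); last exact: continuous_expR.
  by apply: continuous_mul_fun; [exact: cst_continuous|exact: continuous_primitive].
have cg : continuous (fun s => A s * expR (- k * W s)) by exact: continuous_mul_fun.
have [y yI ymax] := @EVT_max R (fun s => A s * expR (- k * W s)) 0 1 ler01
  (continuous_subspaceT cg).
have [S SE] : exists S, S = A y * expR (- k * W y) by exists (A y * expR (- k * W y)).
rewrite -SE in ymax.
have S0 : 0 <= S by rewrite SE mulr_ge0// expR_ge0.
have AS (s : R) : 0 <= s <= 1 -> A s <= S * expR (k * W s).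
  move=> sI; have := ymax s; rewrite in_itv/= => /(_ sI) {}H'.
  have := ler_wpM2r (expR_ge0 (k * W s)) H'.
  by rewrite -mulrA -expRD mulNr addNr expR0 mulr1.
have yI' : 0 <= y <= 1 by move: yI; rewrite in_itv.
have I1 : k * \int[leb R]_(s in `[0, y]) (w s * A s) <= S * (expR (k * W y) - 1).
  have cwA : continuous (fun s => w s * A s) by exact: continuous_mul_fun.
  have ckwe : continuous (fun s => k * w s * expR (k * W s)).
    apply: continuous_mul_fun => //.
    by apply: continuous_mul_fun => //; exact: cst_continuous.
  rewrite -[X in _ <= _ * X]Rintegral_exp_primitive//; last by lra.
  rewrite -RintegralZl//; last exact: continuous_integrable.
  rewrite -RintegralZl//; last exact: continuous_integrable.
  apply: le_Rintegral_continuous.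
  - by apply: continuous_mul_fun => //; exact: cst_continuous.
  - by apply: continuous_mul_fun => //; exact: cst_continuous.
  move=> s sI; have {}AS := AS s ltac:(lra).
  rewrite [leRHS](_ : _ = k * (w s * (S * expR (k * W s)))); last by ring.
  by rewrite ler_pM2l//; apply: ler_wpM2l.
have Sle : S <= 2 * c0.
  have Hy := H y yI'.
  have E1 : expR (- k * W y) * expR (k * W y) = 1 by rewrite -expRD mulNr addNr expR0.
  have e1 : expR (- k * W y) <= 1.
    by rewrite -[leRHS]expR0 ler_expR mulNr oppr_le0 mulr_ge0// ltW.
  have Hy2 : A y <= c0 + S * (expR (k * W y) - 1) / 2.
    by move: I1 Hy; rewrite /k; lra.
  have := ler_wpM2r (expR_ge0 (- k * W y)) Hy2; rewrite -SE.
  rewrite [leRHS](_ : _ = c0 * expR (- k * W y) +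
    S / 2 * (expR (- k * W y) * expR (k * W y) - expR (- k * W y))); last by ring.
  rewrite E1.
  have := expR_ge0 (- k * W y).
  set e := expR (- k * W y) in e1 *.
  move=> e0 H1.
  have H2 : c0 * e <= c0 by rewrite ler_piMr.
  have H3 : S / 2 * (1 - e) <= S / 2 by rewrite ler_piMr//; lra.
  lra.
move=> x xI; apply: (le_trans (AS x xI)).
apply: (@le_trans _ _ (S * expR (2 * c1 * W 1))).
  apply: ler_wpM2l => //; rewrite ler_expR ler_pM2l//.
  by apply: Rintegral_subitv => //; lra.
by apply: ler_wpM2r => //; exact: expR_ge0.
Qed.

Lemma continuous_slice_integral (R : realType) (v : R * R -> R) : continuous v ->
  continuous (fun x : R => \int[leb R]_(t in `[0, x]) v (x, t)).
Proof.
move=> cv; apply: (continuous_Rintegral_itv R R (cst 0) id id (fun z => v (z.2, z.1))).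
- exact: cst_continuous.
- by move=> x; exact: cvg_id.
- by move=> x; exact: cvg_id.
- apply: (continuous_comp_fun _ _ _ _ _ _ cv).
  by apply: continuous_pair_fun; [exact: continuous_snd_fun|exact: continuous_fst_fun].
Qed.

Lemma continuous_shear (R : realType) (v : R * R -> R) : continuous v ->
  continuous (fun z : R * R => v (z.1, z.1 - z.2)).
Proof.
move=> cv; apply: (continuous_comp_fun _ _ _ (fun z : R * R => (z.1, z.1 - z.2)) _ _ cv).
apply: continuous_pair_fun; first exact: continuous_fst_fun.
by apply: continuous_sub_fun; [exact: continuous_fst_fun|exact: continuous_snd_fun].
Qed.

Lemma continuous_shear_mul (R : realType) (q : R -> R) (v : R * R -> R) :
  continuous q -> continuous v ->
  continuous (fun z : R * R => q z.1 * v (z.1, z.1 - z.2)).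
Proof.
move=> cq cv; apply: continuous_mul_fun; last exact: continuous_shear.
exact: (continuous_comp_fun _ _ _ _ _ (continuous_fst_fun _ _) cq).
Qed.

Lemma continuous_volterra (R : realType) (q : R -> R) (v : R * R -> R) :
  continuous q -> continuous v ->
  continuous (fun z : R * R =>
    \int[leb R]_(s in `[z.2, z.1]) (q s * v (s, s - z.2))).
Proof.
move=> cq cv.
apply: (continuous_Rintegral_itv R _ snd fst snd (fun z => q z.1 * v (z.1, z.1 - z.2))).
- exact: continuous_snd_fun.
- exact: continuous_fst_fun.
- exact: continuous_snd_fun.
- exact: continuous_shear_mul.
Qed.

(** After the exchange of integrals, the reflection xi -> s - xi turns the diagonal values v (s, s -
    xi) into the horizontal slice of [v] at [s]. Slices of a Volterra term are thus controlled by
    earlier slices of [v], as Gronwall's inequality demands. *)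
Lemma volterra_swap (R : realType) (x : R) (q : R -> R) (v : R * R -> R) :
  0 <= x -> continuous q -> continuous v ->
  \int[leb R]_(xi in `[0, x])
    (\int[leb R]_(s in `[xi, x]) (q s * v (s, s - xi))) =
  \int[leb R]_(s in `[0, x])
    (q s * \int[leb R]_(t in `[0, s]) v (s, t)).
Proof.
move=> x0 cq cv.
rewrite (Rintegral_triangle_swap _ _ (fun z => q z.1 * v (z.1, z.1 - z.2)))//; last first.
  exact: continuous_shear_mul.
apply: eq_Rintegral => s; rewrite inE/= in_itv/= => sI.
have cvs := continuous_prodr _ v s cv.
rewrite -(Rintegral_reflect _ s (fun t => v (s, t)))//; last by lra.
rewrite -RintegralZl//; apply: continuous_integrable.
exact: (continuous_prodr _ _ s (continuous_shear _ v cv)).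
Qed.

Section VolterraEstimates.
Context (R : realType) (p m : R) (q : R -> R) (v : R * R -> R).
Hypotheses (p1 : 1 <= p) (m0 : 0 < m) (cq : continuous q) (cv : continuous v).
Hypotheses (q0 : forall s, 0 <= q s) (v0 : forall z, 0 <= v z).
Hypothesis qm : \int[leb R]_(s in `[0, 1]) q s <= m.

Let B x := \int[leb R]_(t in `[0, x]) (v (x, t) `^ p).
Let h (x xi : R) := \int[leb R]_(s in `[xi, x]) (q s * v (s, s - xi)).

Let cvp : continuous (fun z => v z `^ p).
Proof. exact: continuous_powR_fun. Qed.

Let ch : continuous (fun z : R * R => h z.1 z.2).
Proof. exact: continuous_volterra. Qed.

Let h0 x xi : 0 <= h x xi.
Proof. by apply: Rintegral_ge0 => s _; rewrite mulr_ge0. Qed.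

Let chp : continuous (fun z : R * R => h z.1 z.2 `^ p).
Proof. exact: continuous_powR_fun. Qed.

Let cqB : continuous (fun s => q s * B s).
Proof.
apply: continuous_mul_fun => //.
exact: (continuous_slice_integral R (fun z => v z `^ p)).
Qed.

Lemma volterra_jensen (x xi : R) : 0 <= xi -> xi <= x -> x <= 1 ->
  h x xi `^ p <= m `^ (p - 1) *
    \int[leb R]_(s in `[xi, x]) (q s * v (s, s - xi) `^ p).
Proof.
move=> xi0 xix x1; apply: Rintegral_jensen => //.
  by have := continuous_shear _ _ cv => /continuous_prodl; apply.
by apply: le_trans qm; apply: Rintegral_subitv.
Qed.

Lemma volterra_slice (x : R) : 0 <= x <= 1 ->
  \int[leb R]_(xi in `[0, x]) (h x xi `^ p) <=
  m `^ (p - 1) * \int[leb R]_(s in `[0, x]) (q s * B s).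
Proof.
move=> xI; rewrite /B -(volterra_swap R x q (fun z => v z `^ p))//; last by lra.
have c1 := continuous_volterra R q (fun z => v z `^ p) cq cvp.
have c2 := continuous_prodr _ _ x c1.
rewrite -RintegralZl//; last exact: (continuous_integrable _ _ _ _ c2).
apply: le_Rintegral_continuous.
- exact: (continuous_prodr _ _ x chp).
- by apply: continuous_mul_fun c2; exact: cst_continuous.
by move=> xi xiI; apply: volterra_jensen; lra.
Qed.

(** Extending the inner integral from [xi, x] to [xi, 1] leaves a function [H] of xi alone. The
    substitution xi = al x + be then costs the factor 1 / al and leads back to horizontal slices
    through [volterra_swap]. *)
Lemma volterra_line (al be t : R) : 0 < al -> 0 <= t <= 1 ->
  (forall x, t <= x <= 1 -> 0 <= al * x + be <= x) ->
  \int[leb R]_(x in `[t, 1]) (h x (al * x + be) `^ p) <=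
  al^-1 * (m `^ (p - 1) * \int[leb R]_(s in `[0, 1]) (q s * B s)).
Proof.
move=> al0 tI line.
have lt := line t ltac:(lra); have l1 := line 1 ltac:(lra).
have tal : al * t + be <= al * 1 + be by rewrite lerD2r ler_pM2l//; lra.
have lt0 : 0 <= al * t + be by lra.
have l11 : al * 1 + be <= 1 by lra.
have c1 := continuous_volterra R q (fun z => v z `^ p) cq cvp.
have c2 := continuous_prodr _ _ 1 c1; rewrite /= in c2.
set H := fun xi => \int[leb R]_(s in `[xi, 1]) (q s * v (s, s - xi) `^ p).
have cH : continuous H by exact: c2.
have cHl := continuous_comp_affine R al be H cH.
have cqv xi : continuous (fun s => q s * v (s, s - xi) `^ p).
  exact: (continuous_prodl _ _ xi (continuous_shear_mul R q _ cq cvp)).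
have mH0 xi : 0 <= m `^ (p - 1) * H xi.
  by rewrite mulr_ge0 ?powR_ge0//; apply: Rintegral_ge0 => s _; rewrite mulr_ge0 ?powR_ge0.
apply: (@le_trans _ _ (\int[leb R]_(x in `[t, 1]) (m `^ (p - 1) * H (al * x + be)))).
  apply: le_Rintegral_continuous.
  - apply: (continuous_comp_fun _ _ _ (fun x => (x, al * x + be)) _ _ chp).
    by apply: continuous_pair_fun; [move=> x; exact: cvg_id|exact: continuous_affine].
  - by apply: continuous_mul_fun cHl; exact: cst_continuous.
  move=> x xI; have lx := line x xI.
  apply: (le_trans (volterra_jensen x (al * x + be) _ _ _)); [lra..|].
  apply: ler_wpM2l; first exact: powR_ge0.
  apply: Rintegral_subitv => //; [|lra..].
  by move=> s _; rewrite mulr_ge0 ?powR_ge0.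
rewrite RintegralZl//; last exact: continuous_integrable.
have := Rintegral_affine R al be t 1 H al0 ltac:(lra) cH => E.
have -> : \int[leb R]_(x in `[t, 1]) H (al * x + be) =
    al^-1 * \int[leb R]_(x in `[al * t + be, al * 1 + be]) H x.
  by rewrite E mulKf// gt_eqF.
rewrite mulrCA ler_pM2l ?invr_gt0//; apply: ler_wpM2l; first exact: powR_ge0.
rewrite /B -(volterra_swap R 1 q (fun z => v z `^ p))//.
have H0 xi : 0 <= xi <= 1 -> 0 <= H xi.
  by move=> _; apply: Rintegral_ge0 => s _; rewrite mulr_ge0 ?powR_ge0.
exact: (Rintegral_subitv R 0 1 _ _ H cH H0 lt0 tal l11).
Qed.

End VolterraEstimates.

(** The factor of G that [gronwall] returns for c0 = 2^p G, c1 = 2^p m^(p-1) and a weight of mass at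
    most m. *)
Definition volterra_cst (R : realType) (p m : R) : R :=
  2 * 2 `^ p * expR (2 * (2 `^ p * m `^ (p - 1)) * m).

(** On horizontal slices the p-th power of the inequality closes up and Gronwall applies. On a line
    it does not, since the Volterra term leaves the line; but [volterra_line] bounds this term by
    horizontal slices, which are then already estimated. *)
Lemma volterra_ineq (R : realType) (p m G : R) (w : R -> R) (u g : R * R -> R) :
  1 <= p -> 0 < m -> continuous w -> continuous u -> continuous g ->
  (forall s, 0 <= w s) -> (forall z, 0 <= u z) -> (forall z, 0 <= g z) ->
  \int[leb R]_(s in `[0, 1]) w s <= m ->
  (forall x xi, 0 <= xi -> xi <= x -> x <= 1 -> u (x, xi) <= g (x, xi) +
    \int[leb R]_(s in `[xi, x]) (w s * u (s, s - xi))) ->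
  0 <= G ->
  (forall x, 0 <= x <= 1 ->
    \int[leb R]_(xi in `[0, x]) (g (x, xi) `^ p) <= G) ->
  (forall x, 0 <= x <= 1 ->
    \int[leb R]_(xi in `[0, x]) (u (x, xi) `^ p) <= volterra_cst R p m * G) /\
  (forall al be t, 0 < al -> 0 <= t <= 1 ->
    (forall x, t <= x <= 1 -> 0 <= al * x + be <= x) ->
    \int[leb R]_(x in `[t, 1]) (u (x, al * x + be) `^ p) <=
    2 `^ p * (\int[leb R]_(x in `[t, 1]) (g (x, al * x + be) `^ p) +
      al^-1 * (m `^ p * volterra_cst R p m * G))).
Proof.
move=> p1 m0 cw cu cg w0 u0 g0 wm uineq G0 gG.
pose h (z : R * R) := \int[leb R]_(s in `[z.2, z.1]) (w s * u (s, s - z.2)).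
have ch : continuous h by exact: continuous_volterra.
have h0 z : 0 <= h z by apply: Rintegral_ge0 => s _; rewrite mulr_ge0.
have chp : continuous (fun z => h z `^ p) by exact: continuous_powR_fun.
have cup : continuous (fun z => u z `^ p) by exact: continuous_powR_fun.
have cgp : continuous (fun z => g z `^ p) by exact: continuous_powR_fun.
have cghp := continuous_add_fun _ _ _ _ cgp chp.
have c2 : continuous (fun z => 2 `^ p * (g z `^ p + h z `^ p)).
  by apply: continuous_mul_fun cghp; exact: cst_continuous.
have up x xi : 0 <= xi -> xi <= x -> x <= 1 ->
    u (x, xi) `^ p <= 2 `^ p * (g (x, xi) `^ p + h (x, xi) `^ p).
  move=> xi0 xix x1; apply: le_trans (powR_add_le R p _ _ p1 (g0 _) (h0 _)).
  apply: ge0_ler_powR; rewrite ?nnegrE//; first by lra.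
    by rewrite addr_ge0.
  exact: uineq.
pose A x := \int[leb R]_(xi in `[0, x]) (u (x, xi) `^ p).
have A0 x : 0 <= A x by apply: Rintegral_ge0 => s _; rewrite powR_ge0.
have cA : continuous A by exact: (continuous_slice_integral R (fun z => u z `^ p)).
have Aineq x : 0 <= x <= 1 -> A x <= 2 `^ p * G +
    2 `^ p * m `^ (p - 1) * \int[leb R]_(s in `[0, x]) (w s * A s).
  move=> xI.
  apply: (@le_trans _ _ (\int[leb R]_(xi in `[0, x])
      (2 `^ p * (g (x, xi) `^ p + h (x, xi) `^ p)))).
    apply: le_Rintegral_continuous.
    - exact: continuous_prodr cup.
    - exact: continuous_prodr c2.
    - by move=> xi xiI; apply: up; lra.
  rewrite RintegralZl//; last exact: (continuous_integrable _ _ _ _ (continuous_prodr _ _ x cghp)).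
  rewrite RintegralD//; last 2 first.
  - exact: (continuous_integrable _ _ _ _ (continuous_prodr _ _ x cgp)).
  - exact: (continuous_integrable _ _ _ _ (continuous_prodr _ _ x chp)).
  rewrite mulrDr -mulrA; apply: lerD; apply: ler_wpM2l; rewrite ?powR_ge0//.
    exact: gG.
  exact: (volterra_slice R p m w u).
have c10 : 0 < 2 `^ p * m `^ (p - 1) by rewrite mulr_gt0// powR_gt0.
have Abnd x : 0 <= x <= 1 -> A x <= volterra_cst R p m * G.
  move=> xI.
  have c00 : 0 <= 2 `^ p * G by rewrite mulr_ge0// powR_ge0.
  apply: (le_trans (gronwall R _ _ A w c00 c10 cA cw A0 w0 Aineq x xI)).
  rewrite (_ : volterra_cst R p m * G = 2 * (2 `^ p * G) *
    expR (2 * (2 `^ p * m `^ (p - 1)) * m)); last by rewrite /volterra_cst; ring.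
  apply: ler_wpM2l; first by rewrite mulr_ge0.
  by rewrite ler_expR ler_wpM2l// mulr_ge0// ltW.
split=> // al be t al0 tI line.
have cl : continuous (fun x : R => (x, al * x + be)).
  by apply: continuous_pair_fun; [move=> x; exact: cvg_id|exact: continuous_affine].
apply: (@le_trans _ _ (\int[leb R]_(x in `[t, 1])
    (2 `^ p * (g (x, al * x + be) `^ p + h (x, al * x + be) `^ p)))).
  apply: le_Rintegral_continuous.
  - exact: (continuous_comp_fun _ _ _ _ _ cl cup).
  - exact: (continuous_comp_fun _ _ _ _ _ cl c2).
  - by move=> x xI; have := line x xI => lx; apply: up; lra.
rewrite RintegralZl//; last exact: (continuous_integrable _ _ _ _ (continuous_comp_fun _ _ _ _ _ cl cghp)).
rewrite RintegralD//; last 2 first.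
- exact: (continuous_integrable _ _ _ _ (continuous_comp_fun _ _ _ _ _ cl cgp)).
- exact: (continuous_integrable _ _ _ _ (continuous_comp_fun _ _ _ _ _ cl chp)).
apply: ler_wpM2l; first exact: powR_ge0.
rewrite lerD2l; apply: (le_trans (volterra_line R p m w u p1 m0 cw cu w0 u0 wm al be t al0 tI line)).
rewrite ler_pM2l ?invr_gt0//.
have -> : m `^ p * volterra_cst R p m * G = m `^ (p - 1) * (m * (volterra_cst R p m * G)).
  by rewrite -(mulr_powRB1 (ltW m0))//; [ring|lra].
apply: ler_wpM2l; first exact: powR_ge0.
have K0 : 0 <= volterra_cst R p m * G.
  by rewrite !mulr_ge0 ?expR_ge0 ?powR_ge0.
apply: (@le_trans _ _ (\int[leb R]_(s in `[0, 1]) (w s * (volterra_cst R p m * G)))).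
  apply: le_Rintegral_continuous.
  - exact: continuous_mul_fun.
  - by apply: continuous_mul_fun => //; exact: cst_continuous.
  - by move=> s sI; apply: ler_wpM2l => //; exact: Abnd.
rewrite RintegralZr//; last exact: continuous_integrable.
exact: ler_wpM2r.
Qed.
Lemma Rintegral_sum (R : realType) (I : finType) (a b : R) (f : I -> R -> R) :
  (forall i, continuous (f i)) ->
  \int[leb R]_(x in `[a, b]) (\sum_i f i x) =
  \sum_i \int[leb R]_(x in `[a, b]) f i x.
Proof.
move=> cf.
have cs (s : seq I) : continuous (fun x => \sum_(i <- s) f i x).
  elim: s => [|i s IH].
    by under eq_fun do rewrite big_nil; exact: cst_continuous.
  by under eq_fun do rewrite big_cons; exact: continuous_add_fun.
elim: (index_enum I) => [|i s IH].
  under eq_Rintegral do rewrite big_nil.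
  by rewrite big_nil Rintegral_cst ?mul0r.
under eq_Rintegral do rewrite big_cons.
rewrite big_cons RintegralD// ?IH//.
- exact: continuous_integrable.
- exact: continuous_integrable.
Qed.

(** * The Goursat problem *)

(** The sequences u_n - 2 K / 2^n and u_n + 2 K / 2^n are monotone and squeeze the limit, which
    yields convergence and its rate at the same time. *)
Lemma geometric_cvg (R : realType) (u : nat -> R) (K : R) :
  (forall n, `|u n.+1 - u n| <= K * 2^-1 ^+ n) ->
  exists2 l, u @ \oo --> l & forall n, `|u n - l| <= 2 * K * 2^-1 ^+ n.
Proof.
move=> uK.
have g0 n : 0 < 2^-1 ^+ n :> R by rewrite exprn_gt0// invr_gt0.
have K0 : 0 <= K by have := le_trans (normr_ge0 _) (uK 0%N); rewrite expr0 mulr1.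
pose v n := u n - 2 * K * 2^-1 ^+ n.
pose w n := u n + 2 * K * 2^-1 ^+ n.
have vS n : v n <= v n.+1.
  have := uK n; rewrite ler_norml /v exprS => /andP[H _].
  rewrite [2 * K * (_ * _)](_ : _ = K * 2^-1 ^+ n); last by field.
  move: H; lra.
have wS n : w n.+1 <= w n.
  have := uK n; rewrite ler_norml /w exprS => /andP[_ H].
  rewrite [2 * K * (_ * _)](_ : _ = K * 2^-1 ^+ n); last by field.
  move: H; lra.
have ndv : nondecreasing_seq v by apply/nondecreasing_seqP.
have niw : nonincreasing_seq w by apply/nonincreasing_seqP.
have vw n : v n <= w n.
  rewrite /v /w lerD2l lerNl; apply: (@le_trans _ _ 0); last by rewrite !mulr_ge0// ltW.
  by rewrite oppr_le0 !mulr_ge0// ltW.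
have g_cvg : (fun n => 2 * K * 2^-1 ^+ n) @ \oo --> (0 : R).
  rewrite -[X in _ --> X](mulr0 (2 * K)); apply: cvgM; first exact: cvg_cst.
  by apply: cvg_expr; rewrite ger0_norm ?invr_ge0//; lra.
have cv : cvgn v.
  apply: nondecreasing_is_cvgn => //; exists (w 0%N) => _ [n _ <-].
  by apply: (le_trans (vw n)); exact: niw.
have uE : u = (fun n => v n + 2 * K * 2^-1 ^+ n).
  by apply/funext => n; rewrite /v subrK.
have cu : u @ \oo --> limn v.
  rewrite uE -[X in _ --> X]addr0; exact: cvgD.
exists (limn v) => // n.
have cw : w @ \oo --> limn v.
  by rewrite -[X in _ --> X]addr0; apply: cvgD.
rewrite ler_norml; apply/andP; split.
  have -> : limn v = limn w by apply/esym/cvg_lim.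
  have := nonincreasing_cvgn_ge niw (cvgP _ cw) n.
  rewrite {2}/w; lra.
have := nondecreasing_cvgn_le ndv cv n.
rewrite {1}/v; lra.
Qed.

Lemma geometric_eq0 (R : realType) (a K : R) :
  (forall n, `|a| <= K * 2^-1 ^+ n) -> a = 0.
Proof.
move=> H; apply/eqP; rewrite -normr_eq0 eq_le normr_ge0 andbT.
have g_cvg : (fun n => K * 2^-1 ^+ n) @ \oo --> (0 : R).
  rewrite -[X in _ --> X](mulr0 K); apply: cvgM; first exact: cvg_cst.
  by apply: cvg_expr; rewrite ger0_norm ?invr_ge0//; lra.
rewrite -(cvg_lim _ g_cvg)//; apply: limr_ge; first exact: cvgP g_cvg.
exact: nearW.
Qed.

Lemma uniform_limit_continuous_fun (R : realType) (T : topologicalType)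
    (f : nat -> T -> R) (g : T -> R) (K : R) :
  (forall n, continuous (f n)) ->
  (forall n z, `|f n z - g z| <= K * 2^-1 ^+ n) -> continuous g.
Proof.
move=> cf fg z; apply/cvgrPdist_lt => e e0.
have g_cvg : (fun n => K * 2^-1 ^+ n) @ \oo --> (0 : R).
  rewrite -[X in _ --> X](mulr0 K); apply: cvgM; first exact: cvg_cst.
  by apply: cvg_expr; rewrite ger0_norm ?invr_ge0//; lra.
have e3 : 0 < e / 3 by lra.
have [n _ /(_ n (leqnn n))] := cvgr_lt 0 g_cvg (e / 3) e3.
rewrite /= => Kn.
near=> t.
have H1 : `|f n z - f n t| < e / 3.
  by near: t; move/cvgrPdist_lt : (cf n z); exact.
have H2 := fg n z; have H3 := fg n t.
have := ler_distD (f n z) (g z) (g t).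
have := ler_distD (f n t) (f n z) (g t).
rewrite (distrC (g z) (f n z)); lra.
Unshelve. all: by end_near. Qed.

(** Freezing arguments at the ends of [0, 1] makes the Picard iterates, and later the limits of
    waves, continuous on the whole space instead of a subspace; the equations are claimed only where
    it is the identity. *)
Definition clamp01 (R : realType) (t : R) : R := Num.max 0 (Num.min t 1).

Lemma clamp01_id (R : realType) (t : R) : 0 <= t <= 1 -> clamp01 R t = t.
Proof. by move=> /andP[t0 t1]; rewrite /clamp01 min_l// max_r. Qed.

Lemma clamp01_itv (R : realType) (t : R) : 0 <= clamp01 R t <= 1.
Proof. by rewrite /clamp01 le_max lexx/= ge_max ler01/= ge_min lexx orbT. Qed.

Lemma continuous_clamp01 (R : realType) : continuous (@clamp01 R).
Proof.
move=> t; apply: (@continuous_max _ _ (cst 0) (fun t : R => Num.min t 1)).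
  exact: cst_continuous.
apply: (@continuous_min _ _ id (cst 1)); last exact: cst_continuous.
exact: cvg_id.
Qed.

Section Picard.
Context (R : realType) (I : finType) (A : I -> I -> R -> R) (f : I -> R -> R).
Hypotheses (cA : forall i j, continuous (A i j)) (cf : forall i, continuous (f i)).

Let c := @clamp01 R.
Let w (s : R) := \sum_i \sum_j `|A i j s|.

Let picard (V : I -> R * R -> R) (i : I) (z : R * R) : R :=
  f i (c z.2) +
  \int[leb R]_(s in `[c z.2, c z.1]) (\sum_j A i j s * V j (s, s - c z.2)).

Let cc1 : continuous (fun z : R * R => c z.1).
Proof. exact: (continuous_comp_fun _ _ _ _ _ (continuous_fst_fun _ _) (continuous_clamp01 R)). Qed.

Let cc2 : continuous (fun z : R * R => c z.2).
Proof. exact: (continuous_comp_fun _ _ _ _ _ (continuous_snd_fun _ _) (continuous_clamp01 R)). Qed.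

Let cw : continuous w.
Proof.
apply: continuous_sum_fun => i; apply: continuous_sum_fun => j.
exact: continuous_norm_fun.
Qed.

Let w0 s : 0 <= w s.
Proof. by apply: sumr_ge0 => i _; apply: sumr_ge0 => j _. Qed.

Let cAV i (V : I -> R * R -> R) : (forall j, continuous (V j)) ->
  continuous (fun z : R * R => \sum_j A i j z.1 * V j (z.1, z.1 - z.2)).
Proof. by move=> cV; apply: continuous_sum_fun => j; exact: continuous_shear_mul. Qed.

Let picard_continuous V : (forall i, continuous (V i)) -> forall i, continuous (picard V i).
Proof.
move=> cV i; apply: continuous_add_fun.
  exact: (continuous_comp_fun _ _ _ _ _ cc2 (cf i)).
exact: (continuous_Rintegral_itv R _ _ _ _ _ cc2 cc1 cc2 (cAV i V cV)).
Qed.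

(** A bound uniform in the second variable survives integration along the diagonal (s, s - xi), so
    the iteration can be estimated in the first variable alone. *)
Let picard_diff (U V : I -> R * R -> R) (g : R -> R) :
  (forall i, continuous (U i)) -> (forall i, continuous (V i)) -> continuous g ->
  (forall s xi, 0 <= s <= 1 -> \sum_j `|U j (s, xi) - V j (s, xi)| <= g s) ->
  forall z, \sum_i `|picard U i z - picard V i z| <=
    \int[leb R]_(s in `[c z.2, c z.1]) (w s * g s).
Proof.
move=> cU cV cg UVg z.
have cD i : continuous (fun s => \sum_j A i j s * (U j (s, s - c z.2) - V j (s, s - c z.2))).
  have /= := continuous_prodl _ _ (c z.2) (cAV i (fun j z => U j z - V j z)
    (fun j => continuous_sub_fun _ _ _ _ (cU j) (cV j))); exact.
have cND i := continuous_norm_fun _ _ _ (cD i).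
apply: (@le_trans _ _ (\sum_i \int[leb R]_(s in `[c z.2, c z.1])
    `|\sum_j A i j s * (U j (s, s - c z.2) - V j (s, s - c z.2))|)).
  apply: ler_sum => i _; rewrite /picard opprD addrACA subrr add0r.
  rewrite -RintegralB//; last 2 first.
  - exact: (continuous_integrable _ _ _ _ (continuous_prodl _ _ (c z.2) (cAV i U cU))).
  - exact: (continuous_integrable _ _ _ _ (continuous_prodl _ _ (c z.2) (cAV i V cV))).
  under eq_Rintegral do rewrite -sumrB.
  under eq_Rintegral do under eq_bigr do rewrite -mulrBr.
  by apply: le_normr_Rintegral => //; exact: (continuous_integrable _ _ _ _ (cD i)).
rewrite -Rintegral_sum//; apply: le_Rintegral_continuous.
- exact: continuous_sum_fun.
- exact: continuous_mul_fun.
move=> s sI.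
have s01 : 0 <= s <= 1.
  have := clamp01_itv R z.2; have := clamp01_itv R z.1; rewrite -/c.
  by move=> /andP[_ h1] /andP[h2 _]; move/andP: sI => [h3 h4]; rewrite (le_trans h2)// (le_trans h4).
have H := UVg s (s - c z.2) s01.
apply: (@le_trans _ _ (w s * \sum_j `|U j (s, s - c z.2) - V j (s, s - c z.2)|)); last first.
  exact: ler_wpM2l.
rewrite /w mulr_suml; apply: ler_sum => i _.
apply: (le_trans (ler_norm_sum _ _ _)).
rewrite mulr_suml; apply: ler_sum => j _; rewrite normrM; apply: ler_wpM2l => //.
rewrite (bigD1 j)//= lerDl; exact: sumr_ge0.
Qed.

Let W (x : R) := \int[leb R]_(s in `[0, x]) w s.
Let V_ n := iter n picard (fun _ => cst 0).

Let cV_ n i : continuous (V_ n i).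
Proof.
elim: n i => [i|n IH i]; first exact: cst_continuous.
exact: picard_continuous.
Qed.

Let cW : continuous W. Proof. exact: continuous_primitive. Qed.

Let ceW : continuous (fun s => expR (2 * W s)).
Proof.
apply: (continuous_comp_fun _ _ _ (fun s => 2 * W s)); last exact: continuous_expR.
by apply: continuous_mul_fun => //; exact: cst_continuous.
Qed.

Let W_mono x : 0 <= x <= 1 -> 0 <= W x <= W 1.
Proof.
move=> /andP[x0 x1]; apply/andP; split; first by apply: Rintegral_ge0.
by apply: Rintegral_subitv.
Qed.

(** The source of the contraction ratio 1/2: the weight exp(2 W) integrates against [w] to at most
    half of itself, whatever the size of the coefficients. *)
Let int_weight x xi : 0 <= x <= 1 -> 0 <= xi <= 1 ->
  \int[leb R]_(s in `[xi, x]) (w s * expR (2 * W s)) <= 2^-1 * expR (2 * W x).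
Proof.
move=> xI xiI.
have cwe : continuous (fun s => w s * expR (2 * W s)) by exact: continuous_mul_fun.
have we0 s : 0 <= w s * expR (2 * W s) by rewrite mulr_ge0 ?expR_ge0.
have [xix|xxi] := leP xi x; last first.
  rewrite set_itv_ge ?Rintegral_set0; first by rewrite mulr_ge0 ?expR_ge0// invr_ge0.
  by rewrite bnd_simp -ltNge.
apply: (@le_trans _ _ (\int[leb R]_(s in `[0, x]) (w s * expR (2 * W s)))).
  apply: Rintegral_subitv => //; by case/andP: xiI.
have x0 : 0 <= x by case/andP: xI.
have := Rintegral_exp_primitive R 2 x w cw x0.
under eq_Rintegral do rewrite -mulrA.
rewrite RintegralZl//; last exact: continuous_integrable.
rewrite -/(W x) => E.
rewrite -(ler_pM2l (ltr0Sn R 1)) E mulrA divff// mul1r.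
by rewrite lerBlDr lerDl.
Qed.

(** Picard iteration from zero, with increments measured relative to exp(2 W). The iterates converge
    pointwise at a geometric rate, and the uniformity of this rate gives the continuity of the limit
    and its equation. *)
Lemma goursat_exists : exists V : I -> R * R -> R,
  (forall i, continuous (V i)) /\
  (forall i x xi, 0 <= xi -> xi <= x -> x <= 1 -> V i (x, xi) =
    f i xi + \int[leb R]_(s in `[xi, x]) (\sum_j A i j s * V j (s, s - xi))).
Proof.
have [F F0 HF] : exists2 F, 0 <= F & forall s, 0 <= s <= 1 -> \sum_i `|f i s| <= F.
  have cF : continuous (fun s => \sum_i `|f i s|).
    by apply: continuous_sum_fun => i; exact: continuous_norm_fun.
  have [y yI ymax] := @EVT_max R _ 0 1 ler01 (continuous_subspaceT cF).
  exists (\sum_i `|f i y|); first exact: sumr_ge0.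
  by move=> s sI; apply: ymax; rewrite in_itv.
have VS n z : \sum_i `|V_ n.+1 i z - V_ n i z| <= F * 2^-1 ^+ n * expR (2 * W (c z.1)).
  elim: n z => [z|n IH z].
    rewrite expr0 mulr1; apply: (@le_trans _ _ F).
      apply: le_trans (HF (c z.2) (clamp01_itv R z.2)); apply: ler_sum => i _.
      rewrite /V_/= subr0 /picard [X in _ + X](_ : _ = 0) ?addr0//.
      under eq_Rintegral do under eq_bigr do rewrite mulr0.
      under eq_Rintegral do rewrite big1//.
      by rewrite Rintegral_cst ?mul0r.
    rewrite ler_peMr// -[leLHS]expR0 ler_expR mulr_ge0//.
    by have /andP[] := W_mono _ (clamp01_itv R z.1).
  have cg : continuous (fun s => F * 2^-1 ^+ n * expR (2 * W s)).
    by apply: continuous_mul_fun => //; exact: cst_continuous.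
  apply: (le_trans (picard_diff _ _ _ (cV_ n.+1) (cV_ n) cg _ z)).
    by move=> s xi sI; apply: (le_trans (IH (s, xi))); rewrite /= /c clamp01_id.
  have cwe : continuous (fun s => w s * expR (2 * W s)) by exact: continuous_mul_fun.
  under eq_Rintegral do rewrite mulrCA.
  rewrite RintegralZl//; last exact: continuous_integrable.
  rewrite exprS.
  have -> : F * (2^-1 * 2^-1 ^+ n) * expR (2 * W (c z.1)) =
    F * 2^-1 ^+ n * (2^-1 * expR (2 * W (c z.1))) by ring.
  apply: ler_wpM2l; first by rewrite mulr_ge0// exprn_ge0// invr_ge0.
  by apply: int_weight; exact: clamp01_itv.
pose K := F * expR (2 * W 1).
have VK n z : \sum_i `|V_ n.+1 i z - V_ n i z| <= K * 2^-1 ^+ n.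
  apply: (le_trans (VS n z)); rewrite /K mulrAC.
  apply: ler_wpM2r; first by rewrite exprn_ge0// invr_ge0.
  apply: ler_wpM2l => //; rewrite ler_expR; apply: ler_wpM2l => //.
  by have /andP[] := W_mono _ (clamp01_itv R z.1).
have VKi i z n : `|V_ n.+1 i z - V_ n i z| <= K * 2^-1 ^+ n.
  by apply: le_trans (VK n z); rewrite (bigD1 i)//= lerDl; exact: sumr_ge0.
have /choice[V HV] : forall iz : I * (R * R), exists l,
    forall n, `|V_ n iz.1 iz.2 - l| <= 2 * K * 2^-1 ^+ n.
  by move=> [i z]; have [l _ Hl] := geometric_cvg R _ K (VKi i z); exists l.
pose V' i z := V (i, z).
have HV' i n z : `|V_ n i z - V' i z| <= 2 * K * 2^-1 ^+ n by exact: (HV (i, z)).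
have cV' i : continuous (V' i).
  exact: (uniform_limit_continuous_fun _ _ (fun n => V_ n i) _ (2 * K)).
exists V'; split=> // i x xi xi0 xix x1.
have -> : f i xi + \int[leb R]_(s in `[xi, x])
    (\sum_j A i j s * V' j (s, s - xi)) = picard V' i (x, xi).
  by rewrite /picard /= /c !clamp01_id// ?xi0 ?(le_trans xix)// (le_trans xi0).
apply/eqP; rewrite -subr_eq0; apply/eqP.
pose L := \sum_(j : I) (2 * K).
pose B := \int[leb R]_(s in `[c xi, c x]) w s.
apply: (geometric_eq0 _ _ (K + B * L)) => n.
have H1 : `|V_ n.+1 i (x, xi) - V' i (x, xi)| <= K * 2^-1 ^+ n.
  by apply: (le_trans (HV' i n.+1 (x, xi))); rewrite exprS mulrCA !mulrA mulVf// mul1r.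
(* [V_ n.+1] is [picard (V_ n)], so [picard_diff] with a constant bound compares it with the image
   of the limit. *)
have H2 : `|V_ n.+1 i (x, xi) - picard V' i (x, xi)| <= B * L * 2^-1 ^+ n.
  have ccst : continuous (cst (L * 2^-1 ^+ n) : R -> R) by exact: cst_continuous.
  have bnd s eta : 0 <= s <= 1 -> \sum_j `|V_ n j (s, eta) - V' j (s, eta)| <= cst (L * 2^-1 ^+ n) s.
    by move=> _; rewrite /L mulr_suml; apply: ler_sum => j _; exact: HV'.
  have := picard_diff _ _ _ (cV_ n) cV' ccst bnd (x, xi).
  rewrite /= RintegralZr//; last exact: continuous_integrable.
  rewrite -/B mulrA; apply: le_trans.
  by rewrite (bigD1 i)//= lerDl; exact: sumr_ge0.
rewrite mulrDl.
have := ler_distD (V_ n.+1 i (x, xi)) (V' i (x, xi)) (picard V' i (x, xi)).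
rewrite (distrC (V' i _) (V_ n.+1 i _)) => /le_trans; apply; exact: lerD.
Qed.

End Picard.
Definition mx_abs (R : realType) (I : finType) (A : I -> I -> R -> R) (s : R) : R :=
  \sum_i \sum_j `|A i j s|.

Lemma mx_abs_ge0 (R : realType) (I : finType) (A : I -> I -> R -> R) (s : R) :
  0 <= mx_abs R I A s.
Proof. by apply: sumr_ge0 => i _; exact: sumr_ge0. Qed.

Lemma continuous_mx_abs (R : realType) (I : finType) (A : I -> I -> R -> R) :
  (forall i j, continuous (A i j)) -> continuous (mx_abs R I A).
Proof.
move=> cA; apply: continuous_sum_fun => i; apply: continuous_sum_fun => j.
exact: continuous_norm_fun.
Qed.

Lemma mx_abs_apply (R : realType) (I : finType) (A : I -> I -> R -> R) (s : R)
    (e : I -> R) :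
  \sum_i `|\sum_j A i j s * e j| <= mx_abs R I A s * \sum_j `|e j|.
Proof.
rewrite /mx_abs mulr_suml; apply: ler_sum => i _.
apply: (le_trans (ler_norm_sum _ _ _)); rewrite mulr_suml.
apply: ler_sum => j _; rewrite normrM; apply: ler_wpM2l => //.
by rewrite (bigD1 j)//= lerDl; exact: sumr_ge0.
Qed.

Lemma mx_abs_apply1 (R : realType) (I : finType) (A : I -> I -> R -> R) (s : R)
    (e : I -> R) :
  (forall j, `|e j| <= 1) -> \sum_i `|\sum_j A i j s * e j| <= mx_abs R I A s.
Proof.
move=> e1; apply: ler_sum => i _; apply: (le_trans (ler_norm_sum _ _ _)).
by apply: ler_sum => j _; rewrite normrM; exact: ler_piMr.
Qed.

(* [V i (x, xi)] is the amplitude at [x] of the waves of speed [c i] that have so far covered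
   the distance [xi] with the other speed. *)
Definition goursat_sol (R : realType) (I : finType) (A : I -> I -> R -> R) (e : I -> R)
    (V : I -> R * R -> R) : Prop :=
  (forall i, continuous (V i)) /\
  (forall i x xi, 0 <= xi -> xi <= x -> x <= 1 -> V i (x, xi) =
    \sum_j A i j xi * e j +
    \int[leb R]_(s in `[xi, x]) (\sum_j A i j s * V j (s, s - xi))).

Lemma powR_le_root (R : realType) (p x d : R) : 1 <= p -> 0 <= x -> 0 <= d ->
  x `^ p <= d -> x <= d `^ p^-1.
Proof.
move=> p1 x0 d0 xd.
have p0 : 0 < p by exact: lt_le_trans p1.
rewrite -[leLHS](powRr1 x0) -(@mulfV _ p) ?gt_eqF// powRrM.
by apply: ge0_ler_powR; rewrite ?nnegrE ?invr_ge0 ?powR_ge0 ?(ltW p0).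
Qed.

Lemma Rintegral_powR_le (R : realType) (p d : R) (f : R -> R) :
  1 <= p -> 0 <= d -> continuous f -> (forall s, 0 <= f s) ->
  \int[leb R]_(s in `[0, 1]) (f s `^ p) <= d ->
  \int[leb R]_(s in `[0, 1]) f s <= d `^ p^-1.
Proof.
move=> p1 d0 cf f0 fd; apply: powR_le_root => //; first exact: Rintegral_ge0.
have := @Rintegral_jensen R p 1 0 1 (cst 1) f p1 ltr01 (@cst_continuous _ _ _) cf
  (fun _ => ler01) f0.
rewrite Rintegral_cst//= lebesgue_measure_itv/= lte01 oppr0 adde0/= mul1r powR1 mul1r.
move=> /(_ (lexx _)); under eq_Rintegral do rewrite mul1r.
move=> /le_trans; apply.
by under eq_Rintegral do rewrite mul1r.
Qed.

(** If a number of at least 1 bounds the integral of the p-th power over [0, 1], it also bounds the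
    integral itself; hence the condition [1 <= rho] below. *)
Lemma powR_root_le_self (R : realType) (p d : R) : 1 <= p -> 1 <= d -> d `^ p^-1 <= d.
Proof.
by move=> p1 d1; apply: ler1_powR => //; rewrite invf_le1// (lt_le_trans _ p1).
Qed.

(** The second factor is the constant of the source term in the Volterra inequality for differences,
    [G] divided by [d] below. The first adds the constants that [volterra_ineq] gives for slices and
    for lines. *)
Definition goursat_cst (R : realType) (p rho : R) : R :=
  (volterra_cst R p rho + 2 `^ p * (1 + rho `^ p * volterra_cst R p rho)) *
  (2 `^ p * (1 + volterra_cst R p rho * rho)).

Lemma volterra_cst_ge0 (R : realType) (p rho : R) : 0 <= volterra_cst R p rho.
Proof. by rewrite !mulr_ge0 ?expR_ge0 ?powR_ge0. Qed.

Lemma goursat_cst_ge0 (R : realType) (p rho : R) : 0 <= rho -> 0 <= goursat_cst R p rho.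
Proof.
move=> rho0; have := volterra_cst_ge0 R p rho => K0.
by rewrite /goursat_cst; do !(apply: mulr_ge0 || apply: addr_ge0) => //; exact: powR_ge0.
Qed.

(** * Lipschitz dependence of the amplitudes on the coefficients *)

Section GoursatLipschitz.
Context (R : realType) (I : finType) (A A' : I -> I -> R -> R) (e : I -> R).
Context (V V' : I -> R * R -> R) (p rho d : R).
Hypotheses (cA : forall i j, continuous (A i j)) (cA' : forall i j, continuous (A' i j)).
Hypotheses (e1 : forall j, `|e j| <= 1) (p1 : 1 <= p) (rho1 : 1 <= rho) (d0 : 0 < d).
Hypotheses (solV : goursat_sol R I A e V) (solV' : goursat_sol R I A' e V').
Hypothesis Arho : \int[leb R]_(s in `[0, 1]) (mx_abs R I A s `^ p) <= rho.
Hypothesis A'rho : \int[leb R]_(s in `[0, 1]) (mx_abs R I A' s `^ p) <= rho.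

Let dA i j s := A i j s - A' i j s.
Hypothesis dAd : \int[leb R]_(s in `[0, 1]) (mx_abs R I dA s `^ p) <= d.

Let cV := solV.1.
Let cV' := solV'.1.
Let cdA i j : continuous (dA i j).
Proof. exact: continuous_sub_fun. Qed.
Let wA := mx_abs R I A.
Let wA' := mx_abs R I A'.
Let wd := mx_abs R I dA.
Let cwA : continuous wA. Proof. exact: continuous_mx_abs. Qed.
Let cwA' : continuous wA'. Proof. exact: continuous_mx_abs. Qed.
Let cwd : continuous wd. Proof. exact: continuous_mx_abs. Qed.
Let rho0 : 0 < rho. Proof. exact: lt_le_trans rho1. Qed.
Let p0 : 0 < p. Proof. exact: lt_le_trans p1. Qed.
Let K := volterra_cst R p rho.

Let wA_int : \int[leb R]_(s in `[0, 1]) wA s <= rho.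
Proof.
apply: (le_trans _ (powR_root_le_self R p rho p1 rho1)).
by apply: Rintegral_powR_le => //; [exact: ltW|move=> s; exact: mx_abs_ge0].
Qed.

Let wA'_int : \int[leb R]_(s in `[0, 1]) wA' s <= rho.
Proof.
apply: (le_trans _ (powR_root_le_self R p rho p1 rho1)).
by apply: Rintegral_powR_le => //; [exact: ltW|move=> s; exact: mx_abs_ge0].
Qed.

Let m := d `^ p^-1.
Let m0 : 0 < m. Proof. exact: powR_gt0. Qed.
Let wd_int : \int[leb R]_(s in `[0, 1]) wd s <= m.
Proof. by apply: Rintegral_powR_le => //; [exact: ltW|move=> s; exact: mx_abs_ge0]. Qed.

(** [m] bounds the mass of the weight [wd], and Jensen's inequality contributes a further m^(p-1).
    Together they give exactly [d], so the p-th powers of the differences stay linear in [d].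
    Jensen's inequality wants a positive mass bound, whence [0 < d]. *)
Let mp : m `^ (p - 1) * m = d.
Proof.
by rewrite mulrC mulr_powRB1 ?(ltW m0)// /m -powRrM mulVf ?gt_eqF// powRr1// ltW.
Qed.

Let v (z : R * R) := \sum_i `|V' i z|.
Let D (z : R * R) := \sum_i `|V i z - V' i z|.

Let cv : continuous v.
Proof. by apply: continuous_sum_fun => i; exact: continuous_norm_fun. Qed.

Let cD : continuous D.
Proof.
by apply: continuous_sum_fun => i; apply: continuous_norm_fun; exact: continuous_sub_fun.
Qed.

Let v0 z : 0 <= v z. Proof. exact: sumr_ge0. Qed.
Let D0 z : 0 <= D z. Proof. exact: sumr_ge0. Qed.

Let cAV (B : I -> I -> R -> R) (U : I -> R * R -> R) i xi :
  (forall i j, continuous (B i j)) -> (forall j, continuous (U j)) ->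
  continuous (fun s => \sum_j B i j s * U j (s, s - xi)).
Proof.
move=> cB cU; apply: continuous_sum_fun => j.
exact: (continuous_prodl _ _ xi (continuous_shear_mul R _ _ (cB i j) (cU j))).
Qed.

Let int_abs (B : I -> I -> R -> R) (U : I -> R * R -> R) x xi :
  (forall i j, continuous (B i j)) -> (forall j, continuous (U j)) ->
  \sum_i `|\int[leb R]_(s in `[xi, x]) (\sum_j B i j s * U j (s, s - xi))| <=
  \int[leb R]_(s in `[xi, x]) (mx_abs R I B s * \sum_j `|U j (s, s - xi)|).
Proof.
move=> cB cU.
have cBU i := cAV B U i xi cB cU.
have cNBU i := continuous_norm_fun _ _ _ (cBU i).
apply: (@le_trans _ _ (\sum_i \int[leb R]_(s in `[xi, x])
    `|\sum_j B i j s * U j (s, s - xi)|)).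
  apply: ler_sum => i _; apply: le_normr_Rintegral => //.
  exact: (continuous_integrable _ _ _ _ (cBU i)).
rewrite -Rintegral_sum//; apply: le_Rintegral_continuous.
- exact: continuous_sum_fun.
- apply: continuous_mul_fun; first exact: continuous_mx_abs.
  apply: continuous_sum_fun => j; apply: continuous_norm_fun.
  exact: (continuous_prodl _ _ xi (continuous_shear _ _ (cU j))).
- by move=> s _; exact: mx_abs_apply.
Qed.

Let v_ineq x xi : 0 <= xi -> xi <= x -> x <= 1 -> v (x, xi) <= wA' xi +
  \int[leb R]_(s in `[xi, x]) (wA' s * v (s, s - xi)).
Proof.
move=> xi0 xix x1.
apply: (@le_trans _ _ (\sum_i `|\sum_j A' i j xi * e j| +
  \sum_i `|\int[leb R]_(s in `[xi, x]) (\sum_j A' i j s * V' j (s, s - xi))|)).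
  by rewrite -big_split/=; apply: ler_sum => i _; rewrite solV'.2//; exact: ler_normD.
apply: lerD; last exact: int_abs.
exact: mx_abs_apply1.
Qed.

Let v_slice x : 0 <= x <= 1 ->
  \int[leb R]_(xi in `[0, x]) (v (x, xi) `^ p) <= K * rho.
Proof.
have cg : continuous (fun z : R * R => wA' z.2).
  exact: (continuous_comp_fun _ _ _ _ _ (continuous_snd_fun _ _) cwA').
have cwp : continuous (fun s => wA' s `^ p).
  by apply: continuous_powR_fun => // s; exact: mx_abs_ge0.
have [H _] := volterra_ineq R p rho rho wA' v (fun z => wA' z.2) p1 rho0 cwA' cv cg
  (fun s => mx_abs_ge0 R I A' s) v0 (fun z => mx_abs_ge0 R I A' z.2) wA'_int v_ineq (ltW rho0)
  (fun x xI => le_trans (Rintegral_subitv R 0 1 0 x _ cwp (fun s _ => powR_ge0 _ _)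
    (lexx 0) (proj1 (andP xI)) (proj2 (andP xI))) A'rho).
exact: H.
Qed.

Let h (z : R * R) :=
  \int[leb R]_(s in `[z.2, z.1]) (wd s * v (s, s - z.2)).
Let g (z : R * R) := wd z.2 + h z.

Let ch : continuous h. Proof. exact: continuous_volterra. Qed.
Let cwd2 : continuous (fun z : R * R => wd z.2).
Proof. exact: (continuous_comp_fun _ _ _ _ _ (continuous_snd_fun _ _) cwd). Qed.
Let cg : continuous g. Proof. exact: continuous_add_fun. Qed.
Let h0 z : 0 <= h z.
Proof. by apply: Rintegral_ge0 => s _; rewrite mulr_ge0//; exact: mx_abs_ge0. Qed.
Let wd0 s : 0 <= wd s. Proof. exact: mx_abs_ge0. Qed.
Let g0 z : 0 <= g z. Proof. by rewrite addr_ge0. Qed.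

(** In V - V' the difference of the coefficients is made to act on V' and on the initial vector
    only, which puts it into the source [g]; the remaining Volterra term has the coefficients A and
    acts on V - V' itself. *)
Let D_ineq x xi : 0 <= xi -> xi <= x -> x <= 1 -> D (x, xi) <= g (x, xi) +
  \int[leb R]_(s in `[xi, x]) (wA s * D (s, s - xi)).
Proof.
move=> xi0 xix x1.
pose dV j z := V j z - V' j z.
have cdV j : continuous (dV j) by exact: continuous_sub_fun.
have E i : V i (x, xi) - V' i (x, xi) = (\sum_j dA i j xi * e j +
    \int[leb R]_(s in `[xi, x]) (\sum_j dA i j s * V' j (s, s - xi))) +
    \int[leb R]_(s in `[xi, x]) (\sum_j A i j s * dV j (s, s - xi)).
  rewrite solV.2// solV'.2// opprD addrACA -sumrB -addrA; congr (_ + _).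
    by apply: eq_bigr => j _; rewrite /dA mulrBl.
  rewrite -RintegralB//; [|exact: (continuous_integrable _ _ _ _ (cAV _ _ i xi _ _))..].
  rewrite -RintegralD//; [|exact: (continuous_integrable _ _ _ _ (cAV _ _ i xi _ _))..].
  apply: eq_Rintegral => s _; rewrite -sumrB -big_split/=; apply: eq_bigr => j _.
  by rewrite /dA /dV; ring.
apply: (@le_trans _ _ ((\sum_i `|\sum_j dA i j xi * e j| +
  \sum_i `|\int[leb R]_(s in `[xi, x]) (\sum_j dA i j s * V' j (s, s - xi))|) +
  \sum_i `|\int[leb R]_(s in `[xi, x]) (\sum_j A i j s * dV j (s, s - xi))|)).
  rewrite -!big_split/=; apply: ler_sum => i _; rewrite E.
  by apply: (le_trans (ler_normD _ _)); rewrite lerD2r; exact: ler_normD.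
apply: lerD; last exact: int_abs.
apply: lerD; last exact: int_abs.
exact: mx_abs_apply1.
Qed.

Let cwdp : continuous (fun s => wd s `^ p). Proof. exact: continuous_powR_fun. Qed.
Let chp : continuous (fun z => h z `^ p). Proof. exact: continuous_powR_fun. Qed.
Let cgp : continuous (fun z => g z `^ p). Proof. exact: continuous_powR_fun. Qed.
Let cB : continuous (fun x : R => \int[leb R]_(t in `[0, x]) (v (x, t) `^ p)).
Proof. by apply: (continuous_slice_integral R (fun z => v z `^ p)); exact: continuous_powR_fun. Qed.

Let Kr0 : 0 <= K * rho.
Proof. by rewrite mulr_ge0 ?volterra_cst_ge0// ltW. Qed.

Let wdB x : 0 <= x <= 1 -> m `^ (p - 1) * \int[leb R]_(s in `[0, x])
  (wd s * \int[leb R]_(t in `[0, s]) (v (s, t) `^ p)) <= K * rho * d.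
Proof.
move=> /andP[x0 x1].
have cwdK : continuous (fun s => wd s * (K * rho)).
  by apply: continuous_mul_fun => //; exact: cst_continuous.
apply: (@le_trans _ _ (m `^ (p - 1) * (m * (K * rho)))); last by rewrite mulrA mp mulrC.
apply: ler_wpM2l; first exact: powR_ge0.
apply: (@le_trans _ _ (\int[leb R]_(s in `[0, x]) (wd s * (K * rho)))).
  apply: le_Rintegral_continuous => //; first exact: continuous_mul_fun.
  move=> s /andP[s0 sx]; apply: ler_wpM2l => //; apply: v_slice.
  by rewrite s0 (le_trans sx).
rewrite RintegralZr//; last exact: continuous_integrable.
apply: ler_wpM2r => //; apply: le_trans wd_int.
by apply: Rintegral_subitv.
Qed.

Let G := 2 `^ p * (1 + K * rho) * d.

Let g_pow z : g z `^ p <= 2 `^ p * (wd z.2 `^ p + h z `^ p).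
Proof. exact: powR_add_le. Qed.

Let g_slice x : 0 <= x <= 1 ->
  \int[leb R]_(xi in `[0, x]) (g (x, xi) `^ p) <= G.
Proof.
move=> xI; have /andP[x0 x1] := xI.
have chx := continuous_prodr _ _ x chp.
have cs := continuous_add_fun _ _ _ _ cwdp chx.
apply: (@le_trans _ _ (\int[leb R]_(xi in `[0, x])
    (2 `^ p * (wd xi `^ p + h (x, xi) `^ p)))).
  apply: le_Rintegral_continuous.
  - exact: (continuous_prodr _ _ x cgp).
  - by apply: continuous_mul_fun cs; exact: cst_continuous.
  - by move=> xi _; exact: g_pow.
rewrite RintegralZl//; last exact: (continuous_integrable _ _ _ _ cs).
rewrite RintegralD//; [|exact: continuous_integrable|exact: (continuous_integrable _ _ _ _ chx)].
rewrite /G -mulrA; apply: ler_wpM2l; first exact: powR_ge0.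
rewrite mulrDl mul1r; apply: lerD.
  apply: le_trans dAd; apply: Rintegral_subitv => // s _; exact: powR_ge0.
apply: le_trans (wdB x xI).
exact: (volterra_slice R p m wd v p1 m0 cwd cv wd0 v0 wd_int x xI).
Qed.

Let g_line al be t : 0 < al -> 0 <= t <= 1 ->
  (forall x, t <= x <= 1 -> 0 <= al * x + be <= x) ->
  \int[leb R]_(x in `[t, 1]) (g (x, al * x + be) `^ p) <= al^-1 * G.
Proof.
move=> al0 tI line; have /andP[t0 t1] := tI.
have /andP[lt0 _] : 0 <= al * t + be <= t by apply: line; rewrite lexx.
have /andP[_ l11] : 0 <= al * 1 + be <= 1 by apply: line; rewrite lexx andbT.
have ltl1 : al * t + be <= al * 1 + be by rewrite lerD2r ler_pM2l.
have cl : continuous (fun x : R => (x, al * x + be)).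
  by apply: continuous_pair_fun; [move=> x; exact: cvg_id|exact: continuous_affine].
have c1 := continuous_comp_affine R al be _ cwdp.
have c2 := continuous_comp_fun _ _ _ _ _ cl chp.
have cs := continuous_add_fun _ _ _ _ c1 c2.
apply: (@le_trans _ _ (\int[leb R]_(x in `[t, 1])
    (2 `^ p * (wd (al * x + be) `^ p + h (x, al * x + be) `^ p)))).
  apply: le_Rintegral_continuous.
  - exact: (continuous_comp_fun _ _ _ _ _ cl cgp).
  - by apply: continuous_mul_fun cs; exact: cst_continuous.
  - by move=> x _; exact: g_pow.
rewrite RintegralZl//; last exact: (continuous_integrable _ _ _ _ cs).
rewrite RintegralD//; [|exact: (continuous_integrable _ _ _ _ c1)|exact: (continuous_integrable _ _ _ _ c2)].
have -> : al^-1 * G = 2 `^ p * (al^-1 * d + al^-1 * (K * rho * d)) by rewrite /G; ring.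
apply: ler_wpM2l; first exact: powR_ge0.
apply: lerD.
  rewrite -(ler_pM2l al0) -(Rintegral_affine R al be t 1 (fun s => wd s `^ p))//.
  rewrite mulrA divff ?gt_eqF// mul1r; apply: le_trans dAd.
  by apply: Rintegral_subitv => // s _; exact: powR_ge0.
apply: (le_trans (volterra_line R p m wd v p1 m0 cwd cv wd0 v0 wd_int al be t al0 tI line)).
by apply: ler_wpM2l; [rewrite invr_ge0 ltW|apply: wdB; rewrite lexx ler01].
Qed.

Let G0 : 0 <= G.
Proof. by rewrite !mulr_ge0 ?powR_ge0 ?(ltW d0)// addr_ge0. Qed.

Lemma goursat_lipschitz :
  (forall x, 0 <= x <= 1 ->
    \int[leb R]_(xi in `[0, x]) (D (x, xi) `^ p) <= goursat_cst R p rho * d) /\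
  (forall al be t, 0 < al -> 0 <= t <= 1 ->
    (forall x, t <= x <= 1 -> 0 <= al * x + be <= x) ->
    \int[leb R]_(x in `[t, 1]) (D (x, al * x + be) `^ p) <=
    al^-1 * (goursat_cst R p rho * d)).
Proof.
have [H1 H2] := volterra_ineq R p rho G wA D g p1 rho0 cwA cD cg
  (fun s => mx_abs_ge0 R I A s) D0 g0 wA_int D_ineq G0 g_slice.
have K0 : 0 <= K := volterra_cst_ge0 R p rho.
have E : goursat_cst R p rho * d = K * G + 2 `^ p * (G + rho `^ p * K * G).
  by rewrite /goursat_cst -/K /G; ring.
have T1 : 0 <= K * G by rewrite mulr_ge0.
have T2 : 0 <= 2 `^ p * (G + rho `^ p * K * G).
  apply: mulr_ge0; first exact: powR_ge0.
  by apply: addr_ge0 => //; rewrite -mulrA; apply: mulr_ge0 => //; exact: powR_ge0.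
split=> [x xI|al be t al0 tI line].
  by rewrite E; apply: (le_trans (H1 x xI)); rewrite lerDl.
apply: (le_trans (H2 al be t al0 tI line)).
apply: (@le_trans _ _ (al^-1 * (2 `^ p * (G + rho `^ p * K * G)))); last first.
  by rewrite E ler_pM2l ?invr_gt0// lerDr.
rewrite [leRHS]mulrCA; apply: ler_wpM2l; first exact: powR_ge0.
by rewrite mulrDr lerD2r; exact: g_line.
Qed.

End GoursatLipschitz.

(** * From amplitudes back to solutions of the system *)

Section GoursatWave.
Context (R : realType) (I : finType) (A : I -> I -> R -> R) (e : I -> R).
Context (V : I -> R * R -> R) (c d : I -> R) (nu : R).
Hypotheses (cA : forall i j, continuous (A i j)) (solV : goursat_sol R I A e V).
Hypothesis speeds : forall i j, (c j = d i /\ d j = c i) \/ (forall s, A i j s = 0).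

Definition wave (i : I) (x : R) : R := e i * expR (nu * c i * x) +
  \int[leb R]_(xi in `[0, x]) (expR (nu * (d i * xi + c i * (x - xi))) * V i (x, xi)).

Let cV := solV.1.

Let cexp2 a b : continuous (fun z : R * R => expR (nu * (a * z.2 + b * (z.1 - z.2)))).
Proof.
apply: (continuous_comp_fun _ _ _ (fun z : R * R => nu * (a * z.2 + b * (z.1 - z.2)))); last first.
  exact: continuous_expR.
apply: continuous_mul_fun; first exact: cst_continuous.
apply: continuous_add_fun; apply: continuous_mul_fun.
- exact: cst_continuous.
- exact: continuous_snd_fun.
- exact: cst_continuous.
- by apply: continuous_sub_fun; [exact: continuous_fst_fun|exact: continuous_snd_fun].
Qed.

Let cexp1 a : continuous (fun x : R => expR (a * x)).
Proof.
apply: (continuous_comp_fun _ _ _ (fun x : R => a * x)); last exact: continuous_expR.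
by apply: continuous_mul_fun; [exact: cst_continuous|move=> x; exact: cvg_id].
Qed.

Lemma continuous_wave i : continuous (wave i).
Proof.
apply: continuous_add_fun.
  by apply: continuous_mul_fun; [exact: cst_continuous|exact: cexp1].
apply: (continuous_slice_integral R (fun z => expR (nu * (d i * z.2 + c i * (z.1 - z.2))) * V i z)).
by apply: continuous_mul_fun; [exact: cexp2|exact: cV].
Qed.

(** Inserting the Goursat equation and exchanging the integrals leaves, for each s, an integral of
    V_j (s, s - xi). The reflection xi -> s - xi turns its exponential into that of the j-th wave,
    because [j] has the two speeds of [i] in opposite order. The exponential factor on the left
    removes the diagonal term of the system. *)
Lemma wave_equation i x : 0 <= x <= 1 ->
  wave i x * expR (- (nu * c i * x)) = e i +
  \int[leb R]_(s in `[0, x]) (expR (- (nu * c i * s)) * \sum_j A i j s * wave j s).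
Proof.
move=> /andP[x0 x1].
have cV2 j a b : continuous (fun z : R * R => expR (nu * (a * z.2 + b * (z.1 - z.2))) * V j z).
  by apply: continuous_mul_fun; [exact: cexp2|exact: cV].
pose E xi := expR (nu * (d i - c i) * xi).
have cE : continuous E by exact: cexp1.
have cAe : continuous (fun xi => \sum_j A i j xi * e j).
  by apply: continuous_sum_fun => j; apply: continuous_mul_fun => //; exact: cst_continuous.
pose phi (z : R * R) := \sum_j A i j z.1 * (E z.2 * V j (z.1, z.1 - z.2)).
have cphi : continuous phi.
  apply: continuous_sum_fun => j; apply: continuous_mul_fun.
    exact: (continuous_comp_fun _ _ _ _ _ (continuous_fst_fun _ _) (cA i j)).
  apply: continuous_mul_fun; last exact: continuous_shear.
  exact: (continuous_comp_fun _ _ _ _ _ (continuous_snd_fun _ _) cE).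
have cexpx : continuous (fun xi => expR (nu * (d i * xi + c i * (x - xi))) * V i (x, xi)).
  exact: (continuous_prodr _ _ x (cV2 i (d i) (c i))).
have cInt : continuous (fun xi => \int[leb R]_(s in `[xi, x]) phi (s, xi)).
  have := continuous_Rintegral_itv R R id (cst x) id phi; apply => //.
  - by move=> y; exact: cvg_id.
  - exact: cst_continuous.
  - by move=> y; exact: cvg_id.
have EL : wave i x * expR (- (nu * c i * x)) = e i +
    (\int[leb R]_(xi in `[0, x]) (E xi * \sum_j A i j xi * e j) +
     \int[leb R]_(xi in `[0, x])
       (\int[leb R]_(s in `[xi, x]) phi (s, xi))).
  rewrite /wave mulrDl -mulrA -expRD subrr expR0 mulr1; congr (_ + _).
  rewrite mulrC -RintegralZl//; last exact: (continuous_integrable _ _ _ _ cexpx).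
  rewrite -RintegralD//; last 2 first.
  - exact: (continuous_integrable _ _ _ _ (continuous_mul_fun _ _ _ _ cE cAe)).
  - exact: (continuous_integrable _ _ _ _ cInt).
  apply: eq_Rintegral => xi; rewrite inE/= in_itv/= => /andP[xi0 xix].
  rewrite mulrA -expRD.
  have -> : - (nu * c i * x) + nu * (d i * xi + c i * (x - xi)) = nu * (d i - c i) * xi by ring.
  rewrite -/(E xi) solV.2// mulrDr; congr (_ + _).
  rewrite -RintegralZl//; last first.
    apply: (continuous_integrable _ _ _ (fun s => \sum_j A i j s * V j (s, s - xi))).
    apply: continuous_sum_fun => j.
    exact: (continuous_prodl _ _ xi (continuous_shear_mul R _ _ (cA i j) (cV j))).
  apply: eq_Rintegral => s _; rewrite /phi mulr_sumr; apply: eq_bigr => j _ /=; ring.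
rewrite EL; congr (_ + _).
rewrite Rintegral_triangle_swap//.
have cIs : continuous (fun s : R => \int[leb R]_(xi in `[0, s]) phi (s, xi)).
  exact: continuous_slice_integral.
rewrite -RintegralD//; last 2 first.
- exact: (continuous_integrable _ _ _ _ (continuous_mul_fun _ _ _ _ cE cAe)).
- exact: (continuous_integrable _ _ _ _ cIs).
apply: eq_Rintegral => s; rewrite inE/= in_itv/= => /andP[s0 sx].
have cph j : continuous (fun xi => A i j s * (E xi * V j (s, s - xi))).
  apply: continuous_mul_fun; first exact: cst_continuous.
  by apply: continuous_mul_fun => //; exact: (continuous_prodr _ _ s (continuous_shear _ _ (cV j))).
rewrite /phi/= Rintegral_sum// !mulr_sumr -big_split/=; apply: eq_bigr => j _.
(* An entry without exchanged speeds vanishes and drops out on both sides. *)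
have [[cj dj]|A0] := speeds i j; last first.
  rewrite A0 !mul0r !mulr0 add0r; under eq_Rintegral do rewrite mul0r.
  by rewrite Rintegral_cst ?mul0r.
rewrite /wave cj dj mulrDr mulrDr; congr (_ + _).
  have -> : E s = expR (- (nu * c i * s)) * expR (nu * d i * s).
    by rewrite -expRD /E; congr expR; ring.
  ring.
have cEV : continuous (fun xi => E xi * V j (s, s - xi)).
  by apply: continuous_mul_fun => //; exact: (continuous_prodr _ _ s (continuous_shear _ _ (cV j))).
rewrite RintegralZl//; last exact: (continuous_integrable _ _ _ _ cEV).
rewrite mulrCA; congr (_ * _).
have cs := continuous_prodr _ _ s (cV2 j (c i) (d i)).
rewrite -(Rintegral_reflect _ s (fun xi => expR (nu * (c i * xi + d i * (s - xi))) * V j (s, xi)))//.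
rewrite -RintegralZl//; last first.
  have csub : continuous (fun xi : R => s - xi).
    by apply: continuous_sub_fun; [exact: cst_continuous|move=> y; exact: cvg_id].
  exact: (continuous_integrable _ _ _ _ (continuous_comp_fun _ _ _ _ _ csub cs)).
apply: eq_Rintegral => xi _; rewrite mulrA -expRD; congr (expR _ * _); ring.
Qed.

End GoursatWave.
(** * Approximation in L^p and Fatou bounds *)

Lemma ae_and (R : realType) (P Q : R -> Prop) : {ae leb R, forall s, P s} ->
  {ae leb R, forall s, Q s} -> {ae leb R, forall s, P s /\ Q s}.
Proof.
case=> [N1 [mN1 N10 s1]] [N2 [mN2 N20 s2]]; exists (N1 `|` N2).
split; first exact: measurableU.
  by apply: null_set_setU.
by move=> t /= /not_andP[H|H]; [left; apply: s1|right; apply: s2].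
Qed.

Lemma ae_imp (R : realType) (P Q : R -> Prop) : (forall s, P s -> Q s) ->
  {ae leb R, forall s, P s} -> {ae leb R, forall s, Q s}.
Proof. by move=> PQ [N [mN N0 PN]]; exists N; split=> // s nQ; apply: PN => /PQ. Qed.

(** Holds for functions not known to be measurable, since the integral of a nonnegative function is
    a supremum over the simple functions below it. The function N (Q x), for an arbitrary matrix
    norm, is treated in this way. *)
Lemma ge0_le_integral_all d (T : measurableType d) (R : realType)
    (mu : {measure set T -> \bar R}) (D : set T) (f g : T -> \bar R) :
  (forall x, D x -> 0 <= f x)%E -> (forall x, D x -> f x <= g x)%E ->
  (\int[mu]_(x in D) f x <= \int[mu]_(x in D) g x)%E.
Proof.
move=> f0 fg; rewrite !(integral_mkcond D).
have h1 x : (0 <= (f \_ D) x)%E by exact: erestrict_ge0.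
have h12 x : ((f \_ D) x <= (g \_ D) x)%E.
  by rewrite !patchE; case: ifPn => // /set_mem; exact: fg.
rewrite !ge0_integralTE//; last by move=> x; exact: le_trans (h12 x).
apply: ereal_sup_le => _ [h hf <-]; exists h => // x.
exact: le_trans (hf x) (h12 x).
Qed.

(** The tangent inequality at the bound [c] itself: on a set of measure at most 1, the integral
    times p c^(p-1) is at most c^p + (p - 1) c^p. *)
Lemma integral_le_of_powR (R : realType) (D : set R) (p c : R) (h : R -> R) :
  measurable D -> (leb R D <= 1)%E -> 1 <= p -> 0 < c ->
  measurable_fun D h -> (forall s, D s -> 0 <= h s) ->
  (\int[leb R]_(s in D) (h s `^ p)%:E <= (c `^ p)%:E)%E ->
  (\int[leb R]_(s in D) (h s)%:E <= c%:E)%E.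
Proof.
move=> mD D1 p1 c0 mh h0 hp.
have k0 : 0 < p * c `^ (p - 1) by rewrite mulr_gt0 ?powR_gt0// (lt_le_trans ltr01 p1).
have mEh : measurable_fun D (EFin \o h) by exact/measurable_EFinP.
have mhp : measurable_fun D (fun s => h s `^ p) 
  by exact: (measurableT_comp (measurable_powR p) mh).
have E0 s : D s -> (0 <= (h s)%:E)%E by move=> Ds; rewrite lee_fin h0.
have B0 : 0 <= (p - 1) * c `^ p by rewrite mulr_ge0 ?powR_ge0// subr_ge0.
rewrite -(@lee_pmul2l _ (p * c `^ (p - 1))%:E); [|by []|by rewrite lte_fin].
rewrite -ge0_integralZl_EFin//; last exact: ltW.
apply: (@le_trans _ _ (\int[leb R]_(s in D) ((h s `^ p)%:E + ((p - 1) * c `^ p)%:E))%E).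
  apply: ge0_le_integral_all.
  - by move=> s Ds; rewrite -EFinM lee_fin mulr_ge0 ?h0// ltW.
  - move=> s Ds; rewrite -EFinM -EFinD lee_fin.
    by apply: powR_tangent => //; [exact: ltW|exact: h0].
have hp0 s : D s -> (0 <= (h s `^ p)%:E)%E by move=> _; rewrite lee_fin powR_ge0.
have mEhp : measurable_fun D (fun s => (h s `^ p)%:E) by exact/measurable_EFinP.
rewrite ge0_integralD//.
rewrite integral_cst//.
apply: (@le_trans _ _ ((c `^ p)%:E + ((p - 1) * c `^ p)%:E)%E).
  apply: leeD => //; rewrite -[leRHS]mule1; apply: lee_wpmul2l => //.
rewrite -EFinD -EFinM lee_fin -mulrA mulrC [c `^ (p - 1) * c]mulrC mulr_powRB1 ?(ltW c0)//; last first.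
  exact: lt_le_trans p1.
by rewrite [leLHS](_ : _ = p * c `^ p)//; ring.
Qed.

Definition trunc (R : realType) (M x : R) : R := Num.max (- M) (Num.min x M).

Lemma trunc_le (R : realType) (M x : R) : 0 <= M -> `|trunc R M x| <= M.
Proof.
by move=> M0; rewrite /trunc ler_norml le_max lexx/= ge_max ge_min lexx orbT andbT ge0_cp.
Qed.

Lemma trunc_id (R : realType) (M x : R) : `|x| <= M -> trunc R M x = x.
Proof. by rewrite ler_norml /trunc => /andP[xM Mx]; rewrite min_l// max_r. Qed.

Lemma trunc_lipschitz (R : realType) (M x y : R) :
  `|trunc R M x - trunc R M y| <= `|x - y|.
Proof.
wlog xy : x y / x <= y.
  move=> H; have [xy|/ltW yx] := leP x y; first exact: H.
  by rewrite distrC (distrC x); exact: H.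
rewrite (distrC x) (ger0_norm (_ : 0 <= y - x)) ?subr_ge0// ler_norml /trunc.
have mx : forall z, (Num.max (- M) (Num.min z M) = - M /\ (z <= - M \/ M <= - M)) \/
    (Num.max (- M) (Num.min z M) = z /\ - M <= z <= M) \/
    (Num.max (- M) (Num.min z M) = M /\ M <= z /\ - M <= M).
  move=> z; have [zM|/ltW Mz] := leP z M.
    have [zM'|/ltW zM'] := leP (- M) z; first by right; left; split=> //; rewrite ?zM' ?zM.
    by left; split=> //; left.
  have [MM|/ltW MM] := leP (- M) M; first by right; right.
  by left; split=> //; right.
by case: (mx x) => [[-> [?|?]]|[[-> ?]|[-> ?]]]; case: (mx y) => [[-> [?|?]]|[[-> ?]|[-> ?]]]; lra.
Qed.

Lemma continuous_trunc (R : realType) (M : R) : continuous (trunc R M).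
Proof.
move=> t; apply: (@continuous_max _ _ (cst (- M)) (fun t : R => Num.min t M)).
  exact: cst_continuous.
apply: (@continuous_min _ _ id (cst M)); last exact: cst_continuous.
exact: cvg_id.
Qed.

Lemma sub_trunc_le (R : realType) (M x : R) : 0 <= M -> `|x - trunc R M x| <= `|x|.
Proof.
move=> M0; rewrite /trunc.
have [xM|/ltW Mx] := leP x M.
  have [xM'|/ltW xM'] := leP (- M) x; first by rewrite subrr normr0.
  by rewrite opprK (ler0_norm (_ : x <= 0)) ?ler_norml; lra.
by rewrite max_r ?ge0_cp// (ger0_norm (_ : 0 <= x)) ?ler_norml; lra.
Qed.

Lemma continuous_abs_powR (R : realType) (p : R) : 1 <= p -> continuous (fun t : R => `|t| `^ p).
Proof.
move=> p1; apply: continuous_powR_fun => //; exact: norm_continuous.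
Qed.

(** Reduction to approximation in L^1. Truncation at a high level n costs little, by dominated
    convergence. Between functions bounded by n the p-th power of the difference is at most a
    constant times the difference, so an L^1 approximation of the truncated function, truncated
    again, is good in L^p. *)
Lemma Lp_continuous_approx (R : realType) (p eps : R) (q : R -> R) :
  1 <= p -> 0 < eps -> measurable_fun (`[0, 1]%classic : set R) q ->
  (\int[leb R]_(s in `[0%R, 1%R]) (`|q s| `^ p)%:E < +oo)%E ->
  exists2 g : R -> R, continuous g &
    (\int[leb R]_(s in `[0%R, 1%R]) (`|q s - g s| `^ p)%:E <= eps%:E)%E.
Proof.
move=> p1 eps0 mq qp.
have p0 : 0 < p by exact: lt_le_trans p1.
have mpow (h : R -> R) : measurable_fun (`[0, 1]%classic : set R) h -> measurable_fun (`[0, 1]%classic : set R) (fun s => (`|h s| `^ p)%:E).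
  move=> mh; apply/measurable_EFinP.
  exact: (measurableT_comp (continuous_measurable_fun (continuous_abs_powR R p p1)) mh).
have mtr n : measurable_fun (`[0, 1]%classic : set R) (fun s => trunc R n%:R (q s)).
  exact: (measurableT_comp (continuous_measurable_fun (continuous_trunc R n%:R)) mq).
pose c := (2 `^ p)^-1 * (eps / 2).
have c0 : 0 < c by rewrite mulr_gt0 ?invr_gt0 ?powR_gt0// divr_gt0.
have [n Hn] : exists n : nat, (\int[leb R]_(s in `[0%R, 1%R])
    (`|q s - trunc R n%:R (q s)| `^ p)%:E <= c%:E)%E.
  have ig : (leb R).-integrable `[0, 1] (fun s => (`|q s| `^ p)%:E).
    apply/integrableP; split; first exact: mpow.
    by under eq_integral do rewrite gee0_abs ?lee_fin ?powR_ge0//.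
  have := @dominated_convergence _ _ _ (leb R) `[0%R, 1%R]%classic (measurable_itv _)
    (fun n s => (`|q s - trunc R n%:R (q s)| `^ p)%:E) (cst 0%E) (fun s => (`|q s| `^ p)%:E).
  case.
  - by move=> n; apply: mpow; apply: measurable_funB.
  - exact: measurable_cst.
  - apply: aeW => s _; apply: cvg_near_cst.
    near=> n; rewrite trunc_id ?subrr ?normr0 ?powR0// ?gt_eqF//.
    near: n; exact: nbhs_infty_ger.
  - exact: ig.
  - apply: aeW => s n _; rewrite gee0_abs ?lee_fin ?powR_ge0//.
    apply: ge0_ler_powR; rewrite ?nnegrE ?(ltW p0)//.
    by apply: sub_trunc_le; exact: ler0n.
  move=> _ _; rewrite integral0 => /fine_cvgP[fin H].
  have [n1 _ {}fin] := fin; have [n2 _ H2] := cvgr_lt 0 H c c0.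
  exists (maxn n1 n2); have /= := fin _ (leq_maxl n1 n2) => fi.
  by have /= := H2 _ (leq_maxr n1 n2); rewrite -lte_fin fineK// => /ltW.
pose T := trunc R n%:R.
have n0 : 0 <= n%:R :> R by exact: ler0n.
have iT : (leb R).-integrable `[0, 1] (EFin \o (T \o q)).
  apply: measurable_bounded_integrable => //.
  - by rewrite /= lebesgue_measure_itv/= lte01 oppr0 adde0 ltry.
  - exact: mtr.
  - exists n%:R; split; first exact: num_real.
    by move=> M nM s _; apply: le_trans (ltW nM); exact: trunc_le.
(* Two functions bounded by n differ by at most 2 n; the summand 1 keeps [k] positive also for n =
   0. *)
pose k := (2 * n%:R + 1) `^ (p - 1) : R.
have k0 : 0 < k by rewrite powR_gt0// ltr_wpDl// mulr_ge0.
have l1 : (leb R `[0%R, 1%R]%classic < +oo)%E.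
  by rewrite /= lebesgue_measure_itv/= lte01 oppr0 adde0 ltry.
have [h_ [ch_ ih_ /fine_cvgP[fin H]]] := @approximation_continuous_integrable R _ (T \o q) (measurable_itv _) l1 iT.
have ck0 : 0 < c / k by rewrite divr_gt0.
have [m Hm] : exists m, (\int[leb R]_(z in `[0%R, 1%R]) `|((T \o q) z - h_ m z)%:E| <= (c / k)%:E)%E.
  have [n1 _ {}fin] := fin; have [n2 _ H2] := cvgr_lt 0 H _ ck0.
  exists (maxn n1 n2); have /= := fin _ (leq_maxl n1 n2) => fi.
  by have /= := H2 _ (leq_maxr n1 n2); rewrite -lte_fin fineK// => /ltW.
have cg : continuous (fun s => T (h_ m s)).
  exact: (continuous_comp_fun _ _ _ _ _ (ch_ m) (continuous_trunc R n%:R)).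
exists (fun s => T (h_ m s)) => //.
have mh : measurable_fun (`[0, 1]%classic : set R) (h_ m).
  by apply: measurable_funTS; exact: continuous_measurable_fun.
have Th s : `|T (q s) - T (h_ m s)| `^ p <= k * `|(T \o q) s - h_ m s|.
  (* Truncation is idempotent, so its Lipschitz property can compare the truncated [q] with [h_ m]
     before truncation. *)
  have TT : T (T (q s)) = T (q s) by rewrite /T trunc_id// trunc_le.
  have L1 : `|T (q s) - T (h_ m s)| <= `|(T \o q) s - h_ m s|.
    by rewrite -TT; exact: trunc_lipschitz.
  have L2 : `|T (q s) - T (h_ m s)| <= 2 * n%:R + 1.
    apply: (le_trans (ler_normB _ _)).
    by have := trunc_le R _ (q s) n0; have := trunc_le R _ (h_ m s) n0; rewrite -/T; lra.
  rewrite -[leLHS]mulr_powRB1// mulrC; apply: ler_pM => //.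
  apply: ge0_ler_powR; rewrite ?nnegrE ?subr_ge0//; lra.
apply: (@le_trans _ _ (\int[leb R]_(s in `[0%R, 1%R])
   ((2 `^ p)%:E * ((`|q s - T (q s)| `^ p)%:E + k%:E * `|((T \o q) s - h_ m s)%:E|)))%E).
  apply: ge0_le_integral_all.
  - by move=> s _; rewrite lee_fin powR_ge0.
  - move=> s _.
    rewrite [leRHS](_ : _ = (2 `^ p * (`|q s - T (q s)| `^ p + k * `|(T \o q) s - h_ m s|))%:E)//.
    rewrite lee_fin.
    apply: (@le_trans _ _ ((`|q s - T (q s)| + `|T (q s) - T (h_ m s)|) `^ p)).
      apply: ge0_ler_powR; rewrite ?nnegrE ?(ltW p0)// ?addr_ge0//.
      exact: ler_distD.
    apply: (le_trans (powR_add_le R p _ _ p1 _ _)) => //.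
    apply: ler_wpM2l; first exact: powR_ge0.
    by rewrite lerD2l.
have m1 : measurable_fun (`[0, 1]%classic : set R) (fun s => (`|q s - T (q s)| `^ p)%:E).
  by apply: mpow; apply: measurable_funB => //; exact: mtr.
have m2 : measurable_fun (`[0, 1]%classic : set R) (fun s => `|((T \o q) s - h_ m s)%:E|%E).
  apply: measurableT_comp => //; apply/measurable_EFinP; apply: measurable_funB => //; exact: mtr.
have m3 : measurable_fun (`[0, 1]%classic : set R) (fun s => k%:E * `|((T \o q) s - h_ m s)%:E|)%E.
  exact: measurable_funeM.
have q0 s : (0 <= (`|q s - T (q s)| `^ p)%:E)%E by rewrite lee_fin powR_ge0.
have q1 s : (0 <= k%:E * `|((T \o q) s - h_ m s)%:E|)%E.
  by rewrite mule_ge0// lee_fin ltW.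
rewrite ge0_integralZl_EFin ?powR_ge0//; last 2 first.
- by move=> s _; exact: adde_ge0.
- exact: emeasurable_funD.
rewrite ge0_integralD// ge0_integralZl_EFin ?(ltW k0)//.
apply: (@le_trans _ _ ((2 `^ p)%:E * (c%:E + k%:E * (c / k)%:E))%E).
  apply: lee_wpmul2l; first by rewrite lee_fin powR_ge0.
  by apply: leeD => //; apply: lee_wpmul2l => //; rewrite lee_fin ltW.
rewrite [leLHS](_ : _ = (2 `^ p * (c + k * (c / k)))%:E)// lee_fin /c.
have p2 : 2 `^ p != 0 :> R by rewrite gt_eqF// powR_gt0.
have kn0 : k != 0 by rewrite gt_eqF.
rewrite [leLHS](_ : _ = eps)//; clear -p2 kn0.
by field; rewrite kn0 p2.
Unshelve. all: by end_near. Qed.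

(** The bounds may vary with n because the distance of the approximating potentials reaches that of
    the given ones only in the limit. *)
Lemma integral_fatou_le (R : realType) (D : set R) (f_ : nat -> R -> R) (f : R -> R)
    (c_ : nat -> R) (c : R) :
  measurable D -> (forall n, measurable_fun D (f_ n)) -> measurable_fun D f ->
  (forall n s, D s -> 0 <= f_ n s) -> (forall s, D s -> 0 <= f s) ->
  {ae leb R, forall s, D s -> f_ ^~ s @ \oo --> f s} ->
  (forall n, (\int[leb R]_(s in D) (f_ n s)%:E <= (c_ n)%:E)%E) ->
  c_ @ \oo --> c ->
  (\int[leb R]_(s in D) (f s)%:E <= c%:E)%E.
Proof.
move=> mD mf_ mf f_0 f0 aef intc cc.
have mE n : measurable_fun D (EFin \o f_ n) by exact/measurable_EFinP.
have := @fatou _ _ _ (leb R) D mD (fun n => EFin \o f_ n) mE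
  (fun n s Ds => (f_0 n s Ds : (0 <= (f_ n s)%:E)%E)).
have -> : (\int[leb R]_(x in D) limn_einf ((fun n => EFin \o f_ n)^~ x))%E =
    (\int[leb R]_(x in D) (f x)%:E)%E.
  apply: ae_eq_integral => //.
  - apply: (@measurableT_comp _ _ _ _ _ _ oppe) => //.
    apply: (@measurable_fun_limn_esup _ _ _ D (fun n s => - (f_ n s)%:E)%E) => n.
    by apply: (@measurableT_comp _ _ _ _ _ _ oppe) => //; exact: mE.
  - exact/measurable_EFinP.
  - apply: ae_imp aef => s H Ds; have {}H := H Ds.
    have HE : (EFin \o (f_ ^~ s)) @ \oo --> (f s)%:E 
      by apply/fine_cvgP; split; [exact: nearW|].
    by have [-> _] := cvg_limn_einf_sup HE.
move=> /le_trans; apply.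
have cE : (EFin \o c_) @ \oo --> c%:E 
  by apply/fine_cvgP; split; [exact: nearW|].
have [<- _] := cvg_limn_einf_sup cE.
rewrite !limn_einf_lim; apply: lee_lim; [exact: is_cvg_einfs..|].
apply: nearW => n; apply: le_ereal_inf_tmp => _ [m nm <-].
by apply: le_trans (intc m); apply: ereal_inf_lbound; exists m.
Qed.
(** * Uniqueness for sums of two Laplace-type integrals *)

Lemma summable_increments_cvg (R : realType) (u : nat -> R) (M : R) :
  (forall n, \sum_(0 <= k < n) `|u k.+1 - u k| <= M) -> cvgn u.
Proof.
move=> HM.
have c1 : cvgn (series (telescope u)).
  apply: normed_cvg; apply: nondecreasing_is_cvgn.
    by apply/nondecreasing_seqP => n; rewrite /= ?/series/= big_nat_recr//= lerDl.
  by exists M => _ [n _ <-]; exact: HM.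
rewrite (_ : u = fun n => u 0%N + series (telescope u) n); last first.
  by apply/funext => n; rewrite -eq_sum_telescope.
by apply: is_cvgD => //; exact: is_cvg_cst.
Qed.

Lemma increments_bound (R : realType) (u : nat -> R) n :
  `|u n| <= `|u 0%N| + \sum_(0 <= k < n) `|u k.+1 - u k|.
Proof.
elim: n => [|n IH]; first by rewrite big_geq// addr0.
rewrite big_nat_recr//= addrA.
rewrite -{1}(subrK (u n) (u n.+1)) addrC; apply: (le_trans (ler_normD _ _)).
exact: lerD.
Qed.

(** |f_0| plus the sum of all increments is integrable by monotone convergence and dominates the
    sequence. Hence the whole sequence converges almost everywhere, and the same domination admits
    bounded weights [w], which will be exponentials. *)
Lemma L1_geometric_limit (R : realType) (D : set R) (f_ : nat -> R -> R) (K : R) :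
  measurable D -> (forall n, (leb R).-integrable D (EFin \o f_ n)) ->
  (forall n, (\int[leb R]_(t in D) (`|f_ n.+1 t - f_ n t|)%:E <=
    (K * 2^-1 ^+ n)%:E)%E) ->
  exists F : R -> R, [/\ (leb R).-integrable D (EFin \o F),
    {ae leb R, forall t, D t -> f_ ^~ t @ \oo --> F t} &
    forall w : R -> R, measurable_fun D w -> (exists C : R, forall t, D t -> `|w t| <= C) ->
      (fun n => \int[leb R]_(t in D) (f_ n t * w t)) @ \oo -->
      \int[leb R]_(t in D) (F t * w t)].
Proof.
move=> mD if_ fK.
have mf_ n : measurable_fun D (f_ n).
  by apply/measurable_EFinP; exact: (measurable_int _ (if_ n)).
pose dlt n t := (`|f_ n.+1 t - f_ n t|)%:E.
have md n : measurable_fun D (dlt n).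
  by apply/measurable_EFinP; apply: measurableT_comp => //; exact: measurable_funB.
have d0 n t : (0 <= dlt n t)%E by rewrite lee_fin.
pose G t := (\sum_(n <oo) dlt n t)%E.
have G0 t : (0 <= G t)%E by apply: nneseries_ge0.
have mG : measurable_fun D G by apply: ge0_emeasurable_sum.
have iG : (leb R).-integrable D G.
  apply/integrableP; split => //.
  under eq_integral do rewrite gee0_abs//.
  rewrite integral_nneseries//.
  apply: (@le_lt_trans _ _ (2 * K)%:E); last exact: ltry.
  apply: lime_le; first by apply: is_cvg_nneseries => n _ _; apply: integral_ge0.
  apply: nearW => n.
  apply: (@le_trans _ _ (\sum_(0 <= k < n) (K * 2^-1 ^+ k)%:E)%E).
    by apply: lee_sum => k _; exact: fK.
  have K0 : 0 <= K.
    have I0 : (0 <= \int[leb R]_(t in D) dlt 0%N t)%E by apply: integral_ge0.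
    by have := le_trans I0 (fK 0%N); rewrite expr0 mulr1 lee_fin.
  rewrite sumEFin lee_fin.
  have -> : \sum_(0 <= k < n) K * 2^-1 ^+ k = 2 * K - 2 * K * 2^-1 ^+ n.
    elim: n => [|n IH]; first by rewrite big_geq// expr0 mulr1 subrr.
    by rewrite big_nat_recr//= IH exprS; field.
  by rewrite gerBl !mulr_ge0// exprn_ge0// invr_ge0.
pose g t := ((`|f_ 0%N t|)%:E + G t)%E.
have ig : (leb R).-integrable D g.
  apply: integrableD => //; exact: (integrable_norm (if_ 0%N)).
have psum t n : (\sum_(0 <= k < n) dlt k t <= G t)%E.
  by apply: nneseries_lim_ge => k _ _.
have fg n t : (`|(f_ n t)%:E| <= g t)%E.
  rewrite abse_EFin; apply: (@le_trans _ _ (`|f_ 0%N t| + \sum_(0 <= k < n) `|f_ k.+1 t - f_ k t|)%:E).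
    by rewrite lee_fin; exact: (increments_bound R (f_ ^~ t)).
  by rewrite EFinD leeD2l// -sumEFin; exact: psum.
have aeG : {ae leb R, forall t, D t -> G t \is a fin_num}.
  exact: integrable_ae iG.
pose E := D `&` [set t | (G t < +oo)%E].
have mE : measurable E by exact: emeasurable_fun_infty_o.
have GE t : E t -> cvgn (f_ ^~ t).
  move=> [_ /= Gt]; have Gfin : G t \is a fin_num by rewrite ge0_fin_numE.
  apply: (summable_increments_cvg R _ (fine (G t))) => n.
  by rewrite -lee_fin fineK// -sumEFin; exact: psum.
(* Set to 0 off the measurable set [E] where the increments are summable, so that [F] is measurable
   as a pointwise limit of the restricted [f_ n]. *)
pose F := (fun t => limn (f_ ^~ t)) \_ E.
have cF t : D t -> G t \is a fin_num -> f_ ^~ t @ \oo --> F t.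
  move=> Dt Gt; have Et : E t by split=> //=; rewrite -ge0_fin_numE.
  by rewrite /F patchE mem_set//; exact: GE.
have mF : measurable_fun D (EFin \o F).
  apply/measurable_EFinP; apply: (measurable_fun_cvg (h := fun n => f_ n \_ E)).
    move=> n; apply/(measurable_restrict _ mE mD).
    by apply: measurable_funS (mf_ n) => //; exact: subIsetl.
  move=> t Dt; rewrite /F patchE; case: ifPn => [/set_mem Et|nEt].
    by under eq_fun do rewrite patchE mem_set//; exact: GE.
  by under eq_fun do rewrite patchE (negbTE nEt); exact: cvg_cst.
have aeF : {ae leb R, forall t, D t -> f_ ^~ t @ \oo --> F t}.
  by apply: ae_imp aeG => t H Dt; apply: cF => //; exact: H.
exists F.
have mEf n : measurable_fun D (EFin \o f_ n) by exact/measurable_EFinP.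
have aefg : {ae leb R, forall t n, D t -> (`|(EFin \o f_ n) t| <= g t)%E}.
  by apply: aeW => t n _; exact: fg.
have aeF' : {ae leb R, forall t, D t -> (fun n => (EFin \o f_ n) t) @ \oo --> (EFin \o F) t}.
  by apply: ae_imp aeF => t H Dt; apply/fine_cvgP; split; [exact: nearW|exact: H].
have [iF _ _] := @dominated_convergence _ _ _ (leb R) D mD _ _ _ mEf mF aeF' ig aefg.
split=> // w mw [C wC].
have C0 t : D t -> 0 <= C by move=> Dt; exact: le_trans (wC t Dt).
have mFw n : measurable_fun D (fun t => (f_ n t * w t)%:E).
  by apply/measurable_EFinP; exact: measurable_funM.
have mFw' : measurable_fun D (fun t => (F t * w t)%:E).
  by apply/measurable_EFinP; apply: measurable_funM => //; exact/measurable_EFinP.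
have igC : (leb R).-integrable D (fun t => `|C|%:E * g t)%E.
  exact: integrableZl.
have ae1 : {ae leb R, forall t, D t ->
    (fun n => (f_ n t * w t)%:E) @ \oo --> (F t * w t)%:E}.
  apply: ae_imp aeF => t H Dt; apply/fine_cvgP; split; first exact: nearW.
  by apply: cvgM; [exact: H|exact: cvg_cst].
have ae2 : {ae leb R, forall t n, D t ->
    (`|(f_ n t * w t)%:E| <= `|C|%:E * g t)%E}.
  apply: aeW => t n Dt; rewrite EFinM abseM muleC; apply: lee_pmul => //.
  by rewrite abse_EFin lee_fin (le_trans (wC t Dt))// ler_norm.
have [iFw _ H] := @dominated_convergence _ _ _ (leb R) D mD _ _ _ mFw mFw' ae1 igC ae2.
have fin : (\int[leb R]_(t in D) (F t * w t)%:E)%E \is a fin_num.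
  exact: integrable_fin_num iFw.
rewrite /Rintegral.
move: H; rewrite -[X in _ --> X](fineK fin) => /fine_cvgP[_]; exact.
Qed.

Lemma integrable_add_fun (R : realType) (D : set R) (f g : R -> R) : measurable D ->
  (leb R).-integrable D (EFin \o f) ->
  (leb R).-integrable D (EFin \o g) ->
  (leb R).-integrable D (EFin \o (fun t => f t + g t)).
Proof.
move=> mD if_ ig.
have : (leb R).-integrable D ((EFin \o f) \+ (EFin \o g))%E by exact: integrableD.
exact.
Qed.

Section LaplaceUniqueness.
Context (R : realType).
Local Notation mu := (leb R).

(** The polynomials of the Brosowski-Deutsch proof of the Stone-Weierstrass theorem. On [0, 1] they
    stay in [0, 1] and tend to 1 for v < 1/2 and to 0 for v > 1/2, so that orthogonality to
    exponentials is carried over to an indicator function. *)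
Let P n (v : R) := (1 - v ^+ n) ^+ (2 ^ n).

Let bernoulli (z : R) (N : nat) : -1 <= z -> 1 + N%:R * z <= (1 + z) ^+ N.
Proof.
move=> z1; elim: N => [|N IH]; first by rewrite mul0r addr0 expr0.
rewrite exprS.
have h1 : 0 <= 1 + z by lra.
apply: (le_trans _ (ler_wpM2l h1 IH)).
rewrite -natr1.
have : 0 <= N%:R * (z * z) by rewrite mulr_ge0// -expr2 sqr_ge0.
lra.
Qed.

Let P_itv n v : 0 <= v <= 1 -> 0 <= P n v <= 1.
Proof.
move=> /andP[v0 v1]; have w0 : 0 <= v ^+ n by exact: exprn_ge0.
have w1 : v ^+ n <= 1 by exact: exprn_ile1.
by rewrite /P exprn_ge0 ?subr_ge0//= exprn_ile1// ?subr_ge0// gerBl.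
Qed.

Let P_low v : 0 <= v -> v < 2^-1 -> P ^~ v @ \oo --> (1 : R).
Proof.
move=> v0 v2.
have v1 : v <= 1 by lra.
apply: (@squeeze_cvgr _ _ _ _ (fun n => 1 - (2 * v) ^+ n) (cst 1)); last exact: cvg_cst.
  apply: nearW => n; rewrite (andP (P_itv n v _)).2 ?v0// andbT.
  have w1 : v ^+ n <= 1 by exact: exprn_ile1.
  have := bernoulli (- v ^+ n) (2 ^ n)%N ltac:(lra).
  by rewrite /P exprMn natrX mulrN.
rewrite -[X in _ --> X]subr0; apply: cvgB; first exact: cvg_cst.
by apply: cvg_expr; rewrite ger0_norm; lra.
Qed.

(** The product of P_n(v) with (1 + v^n)^(2^n) is (1 - v^(2n))^(2^n) <= 1, and by Bernoulli's
    inequality this second factor exceeds (2 v)^n. *)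
Let P_high v : 2^-1 < v -> v <= 1 -> P ^~ v @ \oo --> (0 : R).
Proof.
move=> v2 v1.
have v0 : 0 < v by lra.
have u0 : 0 < (2 * v)^-1 by rewrite invr_gt0; lra.
have u1 : (2 * v)^-1 < 1 by rewrite invf_lt1; lra.
apply: (@squeeze_cvgr _ _ _ _ (cst 0) (fun n => (2 * v)^-1 ^+ n)); last first.
- by apply: cvg_expr; rewrite gtr0_norm.
- exact: cvg_cst.
apply: nearW => n; rewrite (andP (P_itv n v _)).1 ?(ltW v0)//=.
have w0 : 0 <= v ^+ n by rewrite exprn_ge0// ltW.
have w1 : v ^+ n <= 1 by apply: exprn_ile1 => //; exact: ltW.
have := bernoulli (v ^+ n) (2 ^ n)%N ltac:(lra); rewrite natrX -exprMn => B.
have q0 : 0 < (2 * v) ^+ n by rewrite exprn_gt0//; lra.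
have Q1 : P n v * (1 + v ^+ n) ^+ (2 ^ n) <= 1.
  rewrite /P -exprMn -subr_sqr expr1n exprn_ile1// ?subr_ge0 ?gerBl ?sqr_ge0//.
  by rewrite exprn_ile1.
have P0 : 0 <= P n v by rewrite (andP (P_itv n v _)).1 ?(ltW v0).
rewrite exprVn -[leRHS]mul1r ler_pdivlMr//; apply: le_trans Q1.
by apply: ler_wpM2l => //; lra.
Qed.

Lemma integrable_mul_continuous (a b : R) (h phi : R -> R) :
  mu.-integrable `[a, b] (EFin \o h) -> continuous phi ->
  mu.-integrable `[a, b] (EFin \o (fun t => h t * phi t)).
Proof.
move=> ih cphi.
have [M [Mr HM]] : bounded_set (phi @` (`[a, b]%classic : set R)).
  apply: compact_bounded; apply: continuous_compact; first exact: continuous_subspaceT.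
  exact: segment_compact.
have := @integrableMl _ _ _ mu `[a, b]%classic (measurable_itv _) (EFin \o h) phi ih.
apply; first by apply: measurable_funTS; exact: continuous_measurable_fun.
by exists M; split=> // N' MN t tI; apply: (HM N' MN); exists t.
Qed.

Lemma ae_derive_primitive (X : R) (f : R -> R) : mu.-integrable `[0, X] (EFin \o f) ->
  {ae mu, forall y : R, 0 < y ->
    is_derive y (1 : R) (fun z : R => \int[mu]_(t in `[0, z]) (f \_ `[0, X]) t) ((f \_ `[0, X]) y)}.
Proof.
move=> intf.
have i1 : mu.-integrable setT (EFin \o (f \_ `[0, X])).
  by rewrite -restrict_EFin; apply/integrable_restrict => //; rewrite setTI.
have i2 y : mu.-integrable [set` Interval (BLeft 0) (BRight y)] (EFin \o (f \_ `[0, X])).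
  exact: integrableS i1.
have := FTC1 i2 (integrable_locally (measurable_itv _) intf).
apply: ae_imp => y H y0; have [d1 d2] := H y0.
by apply: DeriveDef; [exact: d1|rewrite -derive1E; exact: d2].
Qed.

Lemma ae_neq (a : R) : {ae mu, forall t : R, t != a}.
Proof.
exists [set a]; split=> //; first exact: lebesgue_measure_set1.
by move=> t /= /negP/negPn/eqP.
Qed.

(** The primitive of [h] is constant inside the interval and so has derivative 0 there, while by
    Lebesgue's differentiation theorem its derivative is [h] almost everywhere. *)
Lemma ae_zero_of_tail_integrals (x : R) (h : R -> R) :
  mu.-integrable `[0, x] (EFin \o h) ->
  (forall tau, 0 < tau < x -> \int[mu]_(t in `]tau, x]) h t = 0) ->
  {ae mu, forall t, t \in `[0, x] -> h t = 0}.
Proof.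
move=> ih tail.
pose F (y : R) := \int[mu]_(t in `[0, y]) (h \_ `[0, x]) t.
have FC y : 0 < y < x -> F y = \int[mu]_(t in `[0, x]) h t.
  move=> yI; have := @Rintegral_itvB R h (BLeft 0) (BRight x) y ih.
  rewrite !bnd_simp tail// => /(_ _ _)/eqP; rewrite subr_eq0 => E.
  rewrite (eqP (E _ _)); [|lra|lra].
  rewrite /F; apply: eq_Rintegral => t; rewrite inE/= in_itv/= => tI.
  rewrite patchE mem_set//= in_itv/=; lra.
have ends := ae_and _ _ _ (ae_neq 0) (ae_neq x).
have der2 := ae_and _ _ _ ends (ae_derive_primitive x h ih).
apply: ae_imp der2 => t [[t0 tx] dt]; rewrite in_itv/= => /andP[t0' tx'].
have t0'' : 0 < t by rewrite lt_neqAle eq_sym t0.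
have tx'' : t < x by rewrite lt_neqAle tx.
have {}dt := dt t0''.
have E : (h \_ `[0, x]) t = h t.
  by rewrite patchE mem_set//= in_itv/= t0' tx'.
have d0 : is_derive t (1 : R) F 0.
  apply: (near_eq_is_derive (f := cst (\int[mu]_(t in `[0, x]) h t))).
    near=> z; rewrite FC//; apply/andP; split; near: z.
      exact: (cvgr_gt t cvg_id 0 t0'').
    exact: (cvgr_lt t cvg_id x tx'').
rewrite -E; have [_ <-] := dt; by have [_ ->] := d0.
Unshelve. all: by end_near. Qed.

(** The power with exponent e of exp(m b t + be) is exp(e be) times the exponential with nu = e m.
    As this prefactor does not depend on [b], it can be taken out of both terms and [orth]
    applies. *)
Lemma exp_sum_orthogonal (x b1 b2 : R) (h1 h2 : R -> R) :
  mu.-integrable `[0, x] (EFin \o h1) -> mu.-integrable `[0, x] (EFin \o h2) ->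
  (forall nu : R, \int[mu]_(t in `[0, x])
    (h1 t * expR (nu * b1 * t) + h2 t * expR (nu * b2 * t)) = 0) ->
  forall (m be : R) (c : nat -> R) (e : nat -> nat) N,
  \int[mu]_(t in `[0, x])
    (h1 t * (\sum_(k < N) c k * expR (m * b1 * t + be) ^+ e k) +
     h2 t * (\sum_(k < N) c k * expR (m * b2 * t + be) ^+ e k)) = 0.
Proof.
move=> i1 i2 orth m be c e.
have cE b : continuous (fun t : R => expR (m * b * t + be)).
  apply: (continuous_comp_fun _ _ _ (fun t : R => m * b * t + be)); last exact: continuous_expR.
  exact: continuous_affine.
have cX b k : continuous (fun t : R => c k * expR (m * b * t + be) ^+ e k).
  apply: continuous_mul_fun; first exact: cst_continuous.
  by move=> t; apply: (@continuous_comp _ _ _ (fun t => expR (m * b * t + be)) (fun y => y ^+ e k));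
    [exact: cE|exact: exprn_continuous].
have cS b N : continuous (fun t : R => \sum_(k < N) c k * expR (m * b * t + be) ^+ e k).
  by apply: (continuous_sum_fun _ _ _ (fun k : 'I_N => fun t => c k * expR (m * b * t + be) ^+ e k)).
have iS N := integrable_add_fun _ _ _ _ (measurable_itv _) (integrable_mul_continuous _ _ _ _ i1 (cS b1 N))
  (integrable_mul_continuous _ _ _ _ i2 (cS b2 N)).
elim=> [|N IH].
  under eq_Rintegral do rewrite !big_ord0 !mulr0 addr0.
  by rewrite Rintegral_cst ?mul0r.
under eq_Rintegral do rewrite !big_ord_recr/= !mulrDr addrACA.
rewrite RintegralD//; last 2 first.
- exact: iS.
- have := integrable_add_fun _ _ _ _ (measurable_itv _) (integrable_mul_continuous _ _ _ _ i1 (cX b1 N))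
    (integrable_mul_continuous _ _ _ _ i2 (cX b2 N)); exact.
rewrite IH add0r.
have cB b : continuous (fun t : R => expR ((e N)%:R * m * b * t)).
  apply: (continuous_comp_fun _ _ _ (fun t : R => (e N)%:R * m * b * t)); last exact: continuous_expR.
  by apply: continuous_mul_fun; [exact: cst_continuous|move=> t; exact: cvg_id].
transitivity (c N * expR ((e N)%:R * be) * \int[mu]_(t in `[0, x])
    (h1 t * expR ((e N)%:R * m * b1 * t) + h2 t * expR ((e N)%:R * m * b2 * t))).
  rewrite -RintegralZl//; last first.
    have := integrable_add_fun _ _ _ _ (measurable_itv _) (integrable_mul_continuous _ _ _ _ i1 (cB b1))
      (integrable_mul_continuous _ _ _ _ i2 (cB b2)); exact.
  apply: eq_Rintegral => t _.
  have EE b : expR (m * b * t + be) ^+ e N = expR ((e N)%:R * be) * expR ((e N)%:R * m * b * t).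
    by rewrite -expRM_natl mulrDr expRD mulrC !mulrA.
  by rewrite !EE; ring.
by rewrite orth mulr0.
Qed.

(** A tail integral of [h1] is isolated by a choice of [m] and [be] for which exp(m b1 t + be)
    decreases through 1/2 at [tau], while exp(m b2 t + be) stays in ]1/2, 1] on [0, x]. Then [P n]
    turns the first exponential into the indicator of ]tau, x] and suppresses the second. The
    opposite signs of the speeds make this possible. *)
Lemma laplace_unique_fst (x b1 b2 : R) (h1 h2 : R -> R) : b1 < 0 -> 0 < b2 ->
  mu.-integrable `[0, x] (EFin \o h1) -> mu.-integrable `[0, x] (EFin \o h2) ->
  (forall nu : R, \int[mu]_(t in `[0, x])
    (h1 t * expR (nu * b1 * t) + h2 t * expR (nu * b2 * t)) = 0) ->
  {ae mu, forall t, t \in `[0, x] -> h1 t = 0}.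
Proof.
move=> b10 b20 i1 i2 orth; apply: ae_zero_of_tail_integrals => // tau /andP[tau0 taux].
have x0 : 0 < x by lra.
have den : 0 < b2 * x - b1 * tau.
  have := mulr_gt0 b20 x0; have : b1 * tau < 0 by rewrite nmulr_rlt0.
  lra.
have l2 : 0 < ln (2 : R) by rewrite ln_gt0// ltr1n.
(* Two conditions fix [m] and [be]: the second exponential equals 1 at t = x, and the first equals
   1/2 at t = tau. *)
pose m := ln 2 / (b2 * x - b1 * tau).
have m0 : 0 < m by rewrite divr_gt0.
pose be := - (m * b2 * x).
pose v b t := expR (m * b * t + be).
have half : expR (- ln 2) = 2^-1 :> R by rewrite expRN lnK// posrE.
have mE : m * b1 * tau + be = - ln 2.
  rewrite /be /m; field; lra.
have v1 t : v b1 t = expR (- ln 2 + m * b1 * (t - tau)).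
  by rewrite /v -mE; congr expR; ring.
have v1_low t : tau < t -> v b1 t < 2^-1.
  move=> tt; rewrite v1 -half ltr_expR gtrDl nmulr_rlt0 ?subr_gt0//.
  by rewrite pmulr_rlt0.
have v1_high t : t < tau -> 2^-1 < v b1 t.
  move=> tt; rewrite v1 -half ltr_expR ltrDl nmulr_rgt0 ?subr_lt0//.
  by rewrite pmulr_rlt0.
have v1_le1 t : 0 <= t -> v b1 t <= 1.
  move=> t0; rewrite -[leRHS]expR0 ler_expR /be.
  have : m * b1 * t <= 0 by rewrite nmulr_rle0// pmulr_rlt0.
  have : 0 <= m * b2 * x by apply: mulr_ge0; [apply: mulr_ge0|]; exact: ltW.
  lra.
have v2E t : v b2 t = expR (m * b2 * (t - x)) by rewrite /v /be; congr expR; ring.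
have v2_le1 t : t <= x -> v b2 t <= 1.
  move=> tx; rewrite v2E -[leRHS]expR0 ler_expR pmulr_rle0 ?subr_le0//.
  by rewrite mulr_gt0.
have v2_high t : 0 <= t -> 2^-1 < v b2 t.
  move=> t0; rewrite v2E -half ltr_expR -mE /be.
  have : 0 <= m * b2 * t by apply: mulr_ge0 => //; apply: mulr_ge0; exact: ltW.
  have : m * b1 * tau < 0 by rewrite nmulr_rlt0// pmulr_rlt0.
  lra.
have v0 b t : 0 <= v b t by exact: expR_ge0.
pose f n t := h1 t * P n (v b1 t) + h2 t * P n (v b2 t).
have cv b : continuous (v b).
  apply: (continuous_comp_fun _ _ _ (fun t : R => m * b * t + be)); last exact: continuous_expR.
  exact: continuous_affine.
have cP n b : continuous (fun t => P n (v b t)).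
  rewrite /P => t; apply: (@continuous_comp _ _ _ (fun t => 1 - v b t ^+ n) (fun y => y ^+ (2 ^ n)));
    last exact: exprn_continuous.
  apply: cvgB; first exact: cvg_cst.
  by apply: (@continuous_comp _ _ _ (v b) (fun y => y ^+ n)); [exact: cv|exact: exprn_continuous].
have iP n := integrable_add_fun _ _ _ _ (measurable_itv _) (integrable_mul_continuous _ _ _ _ i1 (cP n b1))
  (integrable_mul_continuous _ _ _ _ i2 (cP n b2)).
have f0 n : \int[mu]_(t in `[0, x]) f n t = 0.
  have := exp_sum_orthogonal x b1 b2 h1 h2 i1 i2 orth m be
    (fun k => (-1) ^+ k *+ 'C(2 ^ n, k)) (fun k => (n * k)%N) (2 ^ n).+1.
  move=> H; rewrite -[RHS]H; apply: eq_Rintegral => t _.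
  have EP b : P n (v b t) = \sum_(k < (2 ^ n).+1) ((-1) ^+ k *+ 'C(2 ^ n, k)) *
      expR (m * b * t + be) ^+ (n * k)%N.
    rewrite /P exprBn; apply: eq_bigr => k _.
    by rewrite expr1n mulr1 -exprM mulrnAl.
  by rewrite /f !EP.
have mh1 : measurable_fun (`[0, x]%classic : set R) h1 by apply/measurable_EFinP; case/integrableP : i1.
have mh2 : measurable_fun (`[0, x]%classic : set R) h2 by apply/measurable_EFinP; case/integrableP : i2.
have mf n : measurable_fun (`[0, x]%classic : set R) (EFin \o f n).
  by have /integrableP[] := iP n.
pose g t := h1 t * \1_(`]tau, x]%classic : set R) t.
have mg : measurable_fun (`[0, x]%classic : set R) (EFin \o g).
  have mi : measurable_fun (`[0, x]%classic : set R) (\1_(`]tau, x]%classic : set R) : R -> R).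
    by apply: measurable_funTS; exact: measurable_indic.
  by apply/measurable_EFinP; apply: measurable_funM => //; exact: mi.
have ig : mu.-integrable `[0, x] (fun t => (`|h1 t|%:E + `|h2 t|%:E)%E).
  by apply: integrableD => //; [exact: (integrable_norm i1)|exact: (integrable_norm i2)].
have ae1 : {ae mu, forall t, `[0, x]%classic t -> (fun n => (EFin \o f n) t) @ \oo --> (EFin \o g) t}.
  exists [set tau]; split=> //; first exact: lebesgue_measure_set1.
  move=> t /= /not_implyP[]; rewrite in_itv/= => /andP[t0 tx] ncvg.
  apply: contrapT => /eqP tneq; apply: ncvg; apply/fine_cvgP; split; first exact: nearW.
  rewrite /f /g /= -[X in _ --> X]addr0; apply: cvgD; last first.
    rewrite -[X in _ --> X](mulr0 (h2 t)); apply: cvgM; first exact: cvg_cst.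
    by apply: P_high; [exact: v2_high|exact: v2_le1].
  apply: cvgM; first exact: cvg_cst.
  rewrite indicE; have [tt|tt|tt] := ltgtP tau t; last by rewrite tt eqxx in tneq.
    by rewrite mem_set/= ?in_itv/= ?tt//; apply: P_low => //; exact: v1_low.
  rewrite memNset/=; last by rewrite in_itv/= => /andP[]; rewrite ltNge (ltW tt).
  by apply: P_high; [exact: v1_high|exact: v1_le1].
have ae2 : {ae mu, forall t n, `[0, x]%classic t ->
    (`|(EFin \o f n) t| <= `|h1 t|%:E + `|h2 t|%:E)%E}.
  apply: aeW => t n; rewrite /= in_itv/= => /andP[t0 tx].
  rewrite -EFinD lee_fin; apply: (le_trans (ler_normD _ _)); rewrite !normrM.
  have PP b : v b t <= 1 -> `|P n (v b t)| <= 1.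
    move=> vb; have := P_itv n (v b t); rewrite v0 vb => /(_ isT)/andP[p0 p1].
    by rewrite ger0_norm.
  by apply: lerD; apply: ler_piMr => //; apply: PP; [exact: v1_le1|exact: v2_le1].
have [_ _ H] := @dominated_convergence _ _ _ mu `[0, x]%classic (measurable_itv _) _ _ _ mf mg ae1 ig ae2.
have H0 : (\int[mu]_(t in `[0%R, x]) (EFin \o g) t = 0)%E.
  apply/esym; apply: (cvg_unique _ _ H) => //=.
  rewrite (_ : (fun _ => _) = cst 0%E); first exact: cvg_cst.
  apply/funext => n /=; have := f0 n; rewrite /Rintegral.
  have fin : (\int[mu]_(t in `[0%R, x]) (f n t)%:E \is a fin_num)%E.
    exact: integrable_fin_num (iP n).
  by move=> E; rewrite -[LHS](fineK fin) E.
rewrite /Rintegral; transitivity (fine (\int[mu]_(t in `[0%R, x]) (EFin \o g) t)%E);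
  last by rewrite H0.
congr fine; rewrite [LHS]integral_mkcond [RHS]integral_mkcond; apply: eq_integral => t _.
rewrite !patchE /g/= indicE.
have [tI|tI] := boolP (t \in (`]tau, x]%classic : set R)).
  rewrite ifT ?mulr1//; move: tI; rewrite !inE/= !in_itv/= => /andP[h ->].
  by rewrite andbT ltW// (lt_trans tau0).
by rewrite mulr0; case: ifP.
Qed.

Lemma laplace_unique (x b1 b2 : R) (h1 h2 : R -> R) : b1 < 0 -> 0 < b2 ->
  mu.-integrable `[0, x] (EFin \o h1) -> mu.-integrable `[0, x] (EFin \o h2) ->
  (forall nu : R, \int[mu]_(t in `[0, x])
    (h1 t * expR (nu * b1 * t) + h2 t * expR (nu * b2 * t)) = 0) ->
  {ae mu, forall t, t \in `[0, x] -> h1 t = 0} /\ {ae mu, forall t, t \in `[0, x] -> h2 t = 0}.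
Proof.
move=> b10 b20 i1 i2 orth; split; first exact: (laplace_unique_fst x b1 b2 h1 h2).
(* Replacing nu by -nu exchanges the roles of the two speeds. *)
apply: (laplace_unique_fst x (- b2) (- b1) h2 h1); rewrite ?oppr_lt0 ?oppr_gt0// => nu.
rewrite -[RHS](orth (- nu)); apply: eq_Rintegral => t _.
by rewrite !mulrN !mulNr addrC.
Qed.

End LaplaceUniqueness.
(** * Limits of Goursat solutions *)

Lemma integrable_norm_fun (R : realType) (D : set R) (f : R -> R) :
  (leb R).-integrable D (EFin \o f) ->
  (leb R).-integrable D (EFin \o (fun t => `|f t|)).
Proof. by move=> /integrable_norm. Qed.

Lemma integrable_sub_fun (R : realType) (D : set R) (f g : R -> R) : measurable D ->
  (leb R).-integrable D (EFin \o f) ->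
  (leb R).-integrable D (EFin \o g) ->
  (leb R).-integrable D (EFin \o (fun t => f t - g t)).
Proof.
move=> mD if_ ig.
have : (leb R).-integrable D ((EFin \o f) \- (EFin \o g))%E by exact: integrableB.
exact.
Qed.

Lemma integrable_scale_fun (R : realType) (D : set R) (k : R) (f : R -> R) : measurable D ->
  (leb R).-integrable D (EFin \o f) ->
  (leb R).-integrable D (EFin \o (fun t => k * f t)).
Proof.
move=> mD if_.
have : (leb R).-integrable D (fun t => k%:E * (EFin \o f) t)%E.
  exact: integrableZl.
exact.
Qed.

Lemma integrable_sum_fun (R : realType) (D : set R) (I : Type) (r : seq I) (f : I -> R -> R) :
  measurable D -> (forall i, (leb R).-integrable D (EFin \o f i)) ->
  (leb R).-integrable D (EFin \o (fun t => \sum_(i <- r) f i t)).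
Proof.
move=> mD if_; elim: r => [|i r IH].
  rewrite (_ : _ \o _ = cst 0%E); first exact: integrable0.
  by apply/funext => t /=; rewrite big_nil.
rewrite (_ : _ \o _ = EFin \o (fun t => f i t + \sum_(i <- r) f i t)).
  exact: integrable_add_fun.
by apply/funext => t /=; rewrite big_cons.
Qed.

Lemma Rintegral_sum_fun (R : realType) (D : set R) (I : Type) (r : seq I) (f : I -> R -> R) :
  measurable D -> (forall i, (leb R).-integrable D (EFin \o f i)) ->
  \int[leb R]_(x in D) (\sum_(i <- r) f i x) =
  \sum_(i <- r) \int[leb R]_(x in D) f i x.
Proof.
move=> mD if_; elim: r => [|i r IH].
  rewrite big_nil; under eq_Rintegral do rewrite big_nil.
  by rewrite /Rintegral integral0.
rewrite big_cons -IH -RintegralD//; last exact: integrable_sum_fun.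
by apply: eq_Rintegral => t _; rewrite big_cons.
Qed.

Lemma integrable_mx_abs (R : realType) (I : finType) (D : set R) (A : I -> I -> R -> R) :
  measurable D -> (forall i j, (leb R).-integrable D (EFin \o A i j)) ->
  (leb R).-integrable D (EFin \o mx_abs R I A).
Proof.
move=> mD iA; apply: integrable_sum_fun => // i; apply: integrable_sum_fun => // j.
exact: integrable_norm_fun.
Qed.

Lemma Rintegral_mx_abs_le (R : realType) (I : finType) (D : set R) (A : I -> I -> R -> R) (k : R) :
  measurable D -> (forall i j, (leb R).-integrable D (EFin \o A i j)) ->
  (forall i j, \int[leb R]_(s in D) `|A i j s| <= k) ->
  \int[leb R]_(s in D) mx_abs R I A s <= (#|I| * #|I|)%:R * k.
Proof.
move=> mD iA Ak.
have iN i j := integrable_norm_fun _ _ _ (iA i j).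
rewrite /mx_abs Rintegral_sum_fun//; last by move=> i; exact: integrable_sum_fun.
apply: (@le_trans _ _ (\sum_(i : I) \sum_(j : I) k)).
  by apply: ler_sum => i _; rewrite Rintegral_sum_fun//; exact: ler_sum.
by rewrite !sumr_const -mulrnA mulr_natl.
Qed.

Lemma mx_absD (R : realType) (I : finType) (A B : I -> I -> R -> R) (s : R) :
  mx_abs R I (fun i j t => A i j t + B i j t) s <= mx_abs R I A s + mx_abs R I B s.
Proof.
rewrite /mx_abs -big_split/=; apply: ler_sum => i _; rewrite -big_split/=.
by apply: ler_sum => j _; exact: ler_normD.
Qed.

Lemma mx_absN (R : realType) (I : finType) (A : I -> I -> R -> R) (s : R) :
  mx_abs R I (fun i j t => - A i j t) s = mx_abs R I A s.
Proof. by apply: eq_bigr => i _; apply: eq_bigr => j _; exact: normrN. Qed.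

Section GoursatLimit.
Context (R : realType) (I : finType) (A : I -> I -> R -> R) (A_ : nat -> I -> I -> R -> R).
Context (e : I -> R) (V_ : nat -> I -> R * R -> R) (K : R).
Local Notation mu := (leb R).
Hypotheses (iA : forall i j, mu.-integrable `[0, 1] (EFin \o A i j))
  (cA_ : forall n i j, continuous (A_ n i j)) (e1 : forall j, `|e j| <= 1)
  (solV : forall n, goursat_sol R I (A_ n) e (V_ n)).
Hypothesis AK : forall n i j,
  \int[mu]_(s in `[0, 1]) `|A_ n i j s - A i j s| <= K * 2^-1 ^+ n.

Let iA_ n i j : mu.-integrable `[0, 1] (EFin \o A_ n i j).
Proof. exact: continuous_integrable. Qed.

Let idA n i j := integrable_sub_fun _ _ _ _ (measurable_itv `[0, 1]) (iA_ n i j) (iA i j).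

Let K0 (i : I) : 0 <= K.
Proof.
have := AK 0%N i i; rewrite expr0 mulr1; apply: le_trans.
by apply: Rintegral_ge0.
Qed.

Let N : R := (#|I| * #|I|)%:R.
Let K1 : R := N * K.

Let K10 : 0 <= K1.
Proof.
case: (pickP I) => [i _|I0]; first by rewrite mulr_ge0// K0.
by rewrite /K1 /N eq_card0// mul0n mul0r.
Qed.

Let half n : (2^-1 : R) ^+ n <= 1.
Proof. by rewrite exprn_ile1// invf_le1// ler1n. Qed.

Let half0 n : 0 < (2^-1 : R) ^+ n.
Proof. by rewrite exprn_gt0// invr_gt0. Qed.

Let int_dA n : \int[mu]_(s in `[0, 1]) mx_abs R I (fun i j t => A_ n i j t - A i j t) s <=
  K1 * 2^-1 ^+ n.
Proof.
by rewrite -mulrA; apply: (Rintegral_mx_abs_le R I _ (fun i j t => A_ n i j t - A i j t)).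
Qed.

Let iW n := integrable_mx_abs R I _ _ (measurable_itv `[0, 1]) (idA n).
Let iWA := integrable_mx_abs R I _ _ (measurable_itv `[0, 1]) iA.

Let rho : R := 1 + (\int[mu]_(s in `[0, 1]) mx_abs R I A s + K1).

Let int_rho n : \int[mu]_(s in `[0, 1]) mx_abs R I (A_ n) s <= rho.
Proof.
apply: (@le_trans _ _ (\int[mu]_(s in `[0, 1]) (mx_abs R I A s +
    mx_abs R I (fun i j t => A_ n i j t - A i j t) s))).
  apply: le_Rintegral => //.
  - exact: integrable_mx_abs.
  - exact: integrable_add_fun.
  move=> s _; apply: le_trans (mx_absD _ _ _ _ _).
  by apply: ler_sum => i _; apply: ler_sum => j _; rewrite addrC subrK.
rewrite RintegralD//; have := int_dA n; have := ler_wpM2l K10 (half n).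
rewrite /rho; lra.
Qed.

(** The summand 1 keeps the bound positive even for K1 = 0, as [goursat_lipschitz] asks of [d]. *)
Let int_d n : \int[mu]_(s in `[0, 1]) mx_abs R I (fun i j t => A_ n.+1 i j t - A_ n i j t) s <=
  (2 * K1 + 1) * 2^-1 ^+ n.
Proof.
apply: (@le_trans _ _ (\int[mu]_(s in `[0, 1]) (
    mx_abs R I (fun i j t => A_ n.+1 i j t - A i j t) s +
    mx_abs R I (fun i j t => A_ n i j t - A i j t) s))).
  apply: le_Rintegral => //.
  - by apply: integrable_mx_abs => // i j; exact: integrable_sub_fun.
  - exact: integrable_add_fun.
  move=> s _; rewrite -(mx_absN _ _ (fun i j t => A_ n i j t - A i j t)).
  apply: le_trans (mx_absD _ _ _ _ _).
  by apply: ler_sum => i _; apply: ler_sum => j _; rewrite opprB addrA subrK.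
rewrite RintegralD//; have := int_dA n; have := int_dA n.+1; rewrite exprS.
have := mulr_ge0 K10 (ltW (half0 n)); have := half0 n.
move: (_ ^+ n) => h h0 kh; move: (\int[mu]_(s in _) _) => u; move: (\int[mu]_(s in _) _) => w.
lra.
Qed.

(** The Lipschitz estimate with exponent 1: L^1 convergence of the coefficients alone controls the
    L^1 norms of all horizontal slices, with one [rho] for all n. *)
Lemma goursat_cauchy : exists2 L : R, 0 <= L & forall n x, 0 <= x <= 1 ->
  \int[mu]_(xi in `[0, x]) (\sum_i `|V_ n.+1 i (x, xi) - V_ n i (x, xi)|) <= L * 2^-1 ^+ n.
Proof.
have rho1 : 1 <= rho.
  rewrite /rho lerDl addr_ge0//; apply: Rintegral_ge0 => s _; exact: mx_abs_ge0.
exists (goursat_cst R 1 rho * (2 * K1 + 1)).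
  apply: mulr_ge0; first by rewrite goursat_cst_ge0// (le_trans ler01).
  by rewrite addr_ge0// mulr_ge0.
move=> n x xI.
have dp : 0 < (2 * K1 + 1) * 2^-1 ^+ n.
  by apply: mulr_gt0 => //; rewrite ltr_wpDl// mulr_ge0.
have pw (f : R -> R) (a b : R) : (forall s, 0 <= f s) ->
    \int[mu]_(s in `[a, b]) (f s `^ 1) = \int[mu]_(s in `[a, b]) f s.
  by move=> f0; apply: eq_Rintegral => s _; rewrite powRr1.
have [H _] := goursat_lipschitz R I (A_ n.+1) (A_ n) e (V_ n.+1) (V_ n) 1 rho _
  (cA_ n.+1) (cA_ n) e1 (lexx _) rho1 dp (solV n.+1) (solV n)
  (eq_ind_r (fun z => z <= rho) (int_rho n.+1) (pw _ 0 1 (fun s => mx_abs_ge0 R I (A_ n.+1) s)))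
  (eq_ind_r (fun z => z <= rho) (int_rho n) (pw _ 0 1 (fun s => mx_abs_ge0 R I (A_ n) s)))
  (eq_ind_r (fun z => z <= _) (int_d n) (pw _ 0 1 (fun s => mx_abs_ge0 R I _ s))).
have := H x xI; rewrite mulrA => /(le_trans _); apply.
by rewrite pw// => s; exact: sumr_ge0.
Qed.

End GoursatLimit.
Lemma exprn_half_ge0 (R : realType) n : 0 <= (2^-1 : R) ^+ n.
Proof. by rewrite exprn_ge0// invr_ge0. Qed.

Lemma continuous_bounded01 (R : realType) (f : R -> R) : continuous f ->
  exists2 M : R, 0 <= M & forall x, 0 <= x <= 1 -> `|f x| <= M.
Proof.
move=> cf; have [M [Mr HM]] : bounded_set (f @` (`[0, 1]%classic : set R)).
  apply: compact_bounded; apply: continuous_compact; first exact: continuous_subspaceT.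
  exact: segment_compact.
exists (`|M| + 1) => // x xI; apply: (HM (`|M| + 1)).
  by rewrite (le_lt_trans (ler_norm _))// ltrDl.
by exists x => //=; rewrite in_itv/=.
Qed.

Lemma integrable_itv0S (R : realType) (x : R) (f : R -> R) : x <= 1 ->
  (leb R).-integrable `[0, 1] (EFin \o f) ->
  (leb R).-integrable `[0, x] (EFin \o f).
Proof.
move=> x1; apply: integrableS => //.
by apply: subset_itvl; rewrite bnd_simp.
Qed.

(** * Solutions for integrable coefficients as limits of waves *)

Section WaveLimit.
Context (R : realType) (I : finType) (A : I -> I -> R -> R) (A_ : nat -> I -> I -> R -> R).
Context (e : I -> R) (V_ : nat -> I -> R * R -> R) (c d : I -> R) (nu K : R).
Local Notation mu := (leb R).
Hypotheses (iA : forall i j, mu.-integrable `[0, 1] (EFin \o A i j))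
  (cA_ : forall n i j, continuous (A_ n i j)) (e1 : forall j, `|e j| <= 1)
  (solV : forall n, goursat_sol R I (A_ n) e (V_ n)).
Hypothesis speeds : forall n i j, (c j = d i /\ d j = c i) \/ (forall s, A_ n i j s = 0).
Hypothesis AK : forall n i j,
  \int[mu]_(s in `[0, 1]) `|A_ n i j s - A i j s| <= K * 2^-1 ^+ n.

Let W n i x := wave R I e (V_ n) c d nu i x.
Let cW n i : continuous (W n i).
Proof. by apply: (continuous_wave R I (A_ n)). Qed.

(** For fixed [nu] the exponentials are bounded by [E] for 0 <= xi <= x <= 1, so the L^1 estimate of
    the slices becomes a uniform estimate of the waves. *)
Let wave_cauchy : exists2 M : R, 0 <= M & forall n i x, 0 <= x <= 1 ->
  `|W n.+1 i x - W n i x| <= M * 2^-1 ^+ n.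
Proof.
have [L L0 HL] := goursat_cauchy R I A A_ e V_ K iA cA_ e1 solV AK.
pose E := \sum_i expR (`|nu| * (`|d i| + `|c i|)).
exists (E * L); first by apply: mulr_ge0 => //; apply: sumr_ge0 => i _; exact: expR_ge0.
move=> n i x xI; have /andP[x0 x1] := xI.
pose q xi := expR (nu * (d i * xi + c i * (x - xi))).
have cq : continuous q.
  apply: (continuous_comp_fun _ _ _ (fun xi : R => nu * (d i * xi + c i * (x - xi))));
    last exact: continuous_expR.
  apply: continuous_mul_fun; first exact: cst_continuous.
  apply: continuous_add_fun; apply: continuous_mul_fun; [exact: cst_continuous|by move=> y; exact: cvg_id|exact: cst_continuous|].
  by apply: continuous_sub_fun; [exact: cst_continuous|move=> y; exact: cvg_id].
have cV m j : continuous (fun xi => V_ m j (x, xi)).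
  exact: (continuous_prodr _ _ x ((solV m).1 j)).
have cqV m : continuous (fun xi => q xi * V_ m i (x, xi)) by exact: continuous_mul_fun.
have cD : continuous (fun xi => \sum_j `|V_ n.+1 j (x, xi) - V_ n j (x, xi)|).
  apply: continuous_sum_fun => j; apply: continuous_norm_fun; exact: continuous_sub_fun.
have iD := continuous_integrable R 0 x _ cD.
have -> : W n.+1 i x - W n i x = \int[mu]_(xi in `[0, x])
    (q xi * V_ n.+1 i (x, xi) - q xi * V_ n i (x, xi)).
  rewrite RintegralB//; [|exact: (continuous_integrable _ _ _ _ (cqV _))..].
  by rewrite /W /wave opprD addrACA subrr add0r.
have cB := continuous_sub_fun _ _ _ _ (cqV n.+1) (cqV n).
apply: (@le_trans _ _ (\int[mu]_(xi in `[0, x])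
    (E * \sum_j `|V_ n.+1 j (x, xi) - V_ n j (x, xi)|))).
  apply: (le_trans (le_normr_Rintegral _ (continuous_integrable _ _ _ _ cB))) => //.
  apply: le_Rintegral_continuous; first exact: continuous_norm_fun.
    by apply: continuous_mul_fun => //; exact: cst_continuous.
  move=> xi /andP[xi0 xix]; rewrite -mulrBr normrM (ger0_norm (expR_ge0 _)).
  apply: ler_pM; rewrite ?expR_ge0//; last first.
    by rewrite [leRHS](bigD1 i)//= lerDl; exact: sumr_ge0.
  apply: (@le_trans _ _ (expR (`|nu| * (`|d i| + `|c i|)))); last first.
    by rewrite /E (bigD1 i)//= lerDl; apply: sumr_ge0 => j _; exact: expR_ge0.
  rewrite ler_expR; apply: (le_trans (ler_norm _)); rewrite normrM ler_wpM2l//.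
  apply: (le_trans (ler_normD _ _)); rewrite !normrM.
  have xi1 : `|xi| <= 1 by rewrite ger0_norm// (le_trans xix).
  have xxi1 : `|x - xi| <= 1 by rewrite ger0_norm ?subr_ge0//; lra.
  by apply: lerD; exact: ler_piMr.
rewrite RintegralZl// -mulrA; apply: ler_wpM2l; last exact: HL.
by apply: sumr_ge0 => j _; exact: expR_ge0.
Qed.

(** Uniform convergence of the waves together with L^1 convergence of the coefficients passes to the
    limit in [wave_equation]. The limit is the solution for the integrable potential on which the
    given kernel will be tested. *)
Lemma wave_limit : exists Y : I -> R -> R, [/\ forall i, continuous (Y i),
  forall i x, 0 <= x <= 1 -> (fun n => wave R I e (V_ n) c d nu i x) @ \oo --> Y i x &
  forall i x, 0 <= x <= 1 -> Y i x * expR (- (nu * c i * x)) = e i +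
    \int[mu]_(s in `[0, x]) (expR (- (nu * c i * s)) * \sum_j A i j s * Y j s)].
Proof.
have [M M0 HM] := wave_cauchy.
have lim i x : exists y : R, (fun n => W n i (clamp01 R x)) @ \oo --> y /\
    forall n, `|W n i (clamp01 R x) - y| <= 2 * M * 2^-1 ^+ n.
  have [y y1 y2] := geometric_cvg R _ M (fun n => HM n i (clamp01 R x) (clamp01_itv R x)).
  by exists y.
have [Y HY] := choice (fun ix : I * R => lim ix.1 ix.2).
pose y i x := Y (i, x).
have cy i : continuous (y i).
  apply: (uniform_limit_continuous_fun R R (fun n x => W n i (clamp01 R x)) _ (2 * M)).
    by move=> n; exact: (continuous_comp_fun _ _ _ _ _ (continuous_clamp01 R) (cW n i)).
  by move=> n x; exact: (HY (i, x)).2.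
have Wy n i x : 0 <= x <= 1 -> `|W n i x - y i x| <= 2 * M * 2^-1 ^+ n.
  by move=> xI; have := (HY (i, x)).2 n; rewrite clamp01_id.
exists y; split=> //.
  by move=> i x xI; have := (HY (i, x)).1; rewrite clamp01_id.
move=> i x xI; have /andP[x0 x1] := xI.
have [B B0 HB] : exists2 B : R, 0 <= B & forall j s, 0 <= s <= 1 -> `|y j s| <= B.
  have [B HB] := choice (fun j => let: ex_intro2 B B0 HB := continuous_bounded01 R _ (cy j) in
    ex_intro (fun B => 0 <= B /\ forall s, 0 <= s <= 1 -> `|y j s| <= B) B (conj B0 HB)).
  exists (\sum_j B j); first by apply: sumr_ge0 => j _; exact: (HB j).1.
  move=> j s sI; apply: (le_trans ((HB j).2 s sI)).
  by rewrite (bigD1 j)//= lerDl; apply: sumr_ge0 => k _; exact: (HB k).1.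
pose q s := expR (- (nu * c i * s)).
have cq : continuous q.
  apply: (continuous_comp_fun _ _ _ (fun s : R => - (nu * c i * s))); last exact: continuous_expR.
  move=> s; apply: cvgN; apply: cvgM; [exact: cvg_cst|exact: cvg_id].
have [E E0 HE] := continuous_bounded01 R _ cq.
have iA01 j : mu.-integrable `[0, 1] (EFin \o (fun s => A i j s * y j s)).
  exact: integrable_mul_continuous.
have iAy : mu.-integrable `[0, x] (EFin \o (fun s => q s * \sum_j A i j s * y j s)).
  have i0 : mu.-integrable `[0, x] (EFin \o (fun s => (\sum_j A i j s * y j s) * q s)).
    apply: integrable_mul_continuous => //; apply: integrable_sum_fun => // j.
    exact: integrable_itv0S.
  by apply: eq_integrable i0 => // s _ /=; rewrite mulrC.
have cAW n : continuous (fun s => \sum_j A_ n i j s * W n j s).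
  by apply: continuous_sum_fun => j; exact: continuous_mul_fun.
have iAW n : mu.-integrable `[0, x] (EFin \o (fun s => q s * \sum_j A_ n i j s * W n j s)).
  exact: (continuous_integrable _ _ _ _ (continuous_mul_fun _ _ _ _ cq (cAW n))).
pose IA := \sum_j \int[mu]_(s in `[0, 1]) `|A i j s|.
(* The first term bounds the change of the left-hand side; B + 2 M bounds the approximate waves and
   goes with the error of the coefficients; the last term is the error of the waves against A. *)
pose C := E * (2 * M) + E * (\sum_(j : I) (K * (B + 2 * M)) + IA * (2 * M)).
apply/eqP; rewrite -subr_eq0; apply/eqP; apply: (geometric_eq0 R _ C) => n.
have half1 : (2^-1 : R) ^+ n <= 1 by rewrite exprn_ile1// invf_le1// ler1n.
have half0 := exprn_half_ge0 R n.
have WE := wave_equation R I (A_ n) e (V_ n) c d nu (cA_ n) (solV n) (speeds n) i x xI.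
have -> : y i x * expR (- (nu * c i * x)) - (e i + \int[mu]_(s in `[0, x]) (expR (- (nu * c i * s)) * \sum_j A i j s * y j s)) =
  (y i x - W n i x) * q x +
  \int[mu]_(s in `[0, x]) (q s * (\sum_j A_ n i j s * W n j s) - q s * \sum_j A i j s * y j s).
  rewrite RintegralB// mulrBl /W WE -/(W n i) /q.
  move: (\int[mu]_(s in _) _) => u; move: (\int[mu]_(s in _) _) => w; ring.
rewrite [C * _]mulrDl; apply: (le_trans (ler_normD _ _)); apply: lerD.
  rewrite normrM mulrC -mulrA; apply: ler_pM => //; first exact: HE.
  by rewrite distrC; exact: Wy.
pose F s := E * (\sum_j (`|A_ n i j s - A i j s| * (B + 2 * M) + `|A i j s| * (2 * M * 2^-1 ^+ n))).
have iF1 j : mu.-integrable `[0, 1] (EFin \o (fun s => `|A_ n i j s - A i j s| * (B + 2 * M))).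
  apply: integrable_mul_continuous; last exact: cst_continuous.
  by apply: integrable_norm_fun; apply: integrable_sub_fun => //; exact: continuous_integrable.
have iF2 j : mu.-integrable `[0, 1] (EFin \o (fun s => `|A i j s| * (2 * M * 2^-1 ^+ n))).
  apply: integrable_mul_continuous; last exact: cst_continuous.
  exact: integrable_norm_fun.
have iF0 : mu.-integrable `[0, 1] (EFin \o (fun s => \sum_j (`|A_ n i j s - A i j s| * (B + 2 * M) + `|A i j s| * (2 * M * 2^-1 ^+ n)))).
  by apply: integrable_sum_fun => // j; exact: integrable_add_fun.
have iF : mu.-integrable `[0, 1] (EFin \o F) by exact: integrable_scale_fun.
have iFx := integrable_itv0S R x F x1 iF.
have iD := integrable_sub_fun _ _ _ _ (measurable_itv _) (iAW n) iAy.
apply: (@le_trans _ _ (\int[mu]_(s in `[0, x]) F s)).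
  apply: (le_trans (le_normr_Rintegral _ iD)) => //.
  apply: le_Rintegral => //; first exact: integrable_norm_fun.
  move=> s; rewrite /= in_itv/= => /andP[s0 sx].
  have sI : 0 <= s <= 1 by rewrite s0 (le_trans sx).
  rewrite -mulrBr normrM; apply: ler_pM => //; first exact: HE.
  rewrite -sumrB; apply: (le_trans (ler_norm_sum _ _ _)); apply: ler_sum => j _.
  have -> : A_ n i j s * W n j s - A i j s * y j s =
    (A_ n i j s - A i j s) * W n j s + A i j s * (W n j s - y j s) by ring.
  apply: (le_trans (ler_normD _ _)); rewrite !normrM; apply: lerD; apply: ler_wpM2l => //.
    rewrite -(subrK (y j s) (W n j s)) addrC; apply: (le_trans (ler_normD _ _)).
    apply: lerD; first exact: HB.
    apply: (le_trans (Wy n j s sI)); rewrite -[leRHS]mulr1; apply: ler_wpM2l => //.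
    by rewrite mulr_ge0.
  exact: Wy.
apply: (@le_trans _ _ (\int[mu]_(s in `[0, 1]) F s)).
  rewrite /Rintegral; apply: fine_le.
  - exact: integrable_fin_num iFx.
  - exact: integrable_fin_num iF.
  - apply: ge0_subset_integral => //; first by have /integrableP[] := iF.
      2: by apply: subset_itvl; rewrite bnd_simp.
    move=> s _; rewrite lee_fin; apply: mulr_ge0 => //; apply: sumr_ge0 => j _.
    by rewrite addr_ge0// !mulr_ge0// addr_ge0// mulr_ge0.
rewrite /F RintegralZl// -[leRHS]mulrA; apply: ler_wpM2l => //.
rewrite Rintegral_sum_fun//; last by move=> j; exact: integrable_add_fun.
rewrite [leRHS]mulrDl /IA !mulr_suml -big_split/=.
apply: ler_sum => j _.
rewrite RintegralD// !RintegralZr//; last 2 first.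
- exact: integrable_norm_fun.
- by apply: integrable_norm_fun; apply: integrable_sub_fun => //; exact: continuous_integrable.
rewrite mulrA lerD2r mulrAC; apply: ler_wpM2r; last exact: AK.
by rewrite addr_ge0// mulr_ge0.
Qed.

End WaveLimit.
(** * Absolutely continuous solutions *)

(** Absolute continuity of the integral of [h], applied to the union of the disjoint intervals ]u_i,
    v_i[ after extending [h] by zero to the line. Degenerate intervals are empty and contribute
    nothing. *)
Lemma abs_continuous_dominated (R : realType) (F : R -> R[i]) (h : R -> R) :
  (leb R).-integrable `[0, 1] (EFin \o h) -> (forall s, 0 <= h s) ->
  (forall u v, 0 <= u -> u <= v -> v <= 1 ->
    Normc.normc (F v - F u) <= \int[leb R]_(s in `[u, v]) h s) ->
  abs_continuous 0 1 F.
Proof.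
move=> ih h0 Fh eps eps0.
pose g := h \_ `[0, 1].
have ig : (leb R).-integrable setT (EFin \o g).
  by rewrite -restrict_EFin; apply/integrable_restrict => //; rewrite setTI.
have g0 s : 0 <= g s by rewrite /g patchE; case: ifP.
have [d [d0 Hd]] := integral_normr_continuous ig eps0.
exists d => // n u v uv tr uvd.
pose U i : set R := [set` `]u i, v i[].
have mU i : measurable (U i) by exact: measurable_itv.
pose D := \big[setU/set0]_(i < n) U i.
have mD : measurable D by apply: bigsetU_measurable.
have muD : (leb R D < d%:E)%E.
  rewrite /D measure_bigsetU_ord//.
  rewrite (_ : (\sum_(i < n) _)%E = (\sum_(i < n) (v i - u i))%:E) ?lte_fin//.
  rewrite -sumEFin; apply: eq_bigr => i _.
  transitivity (leb R [set` `]u i, v i[]) => //.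
  rewrite lebesgue_measure_itv/= lte_fin; case: ltP => //= vu.
  have [_ [uvi _]] := uv i.
  by have -> : v i = u i; [apply/eqP; rewrite eq_le vu uvi|rewrite subrr].
apply: le_lt_trans (Hd D mD muD).
apply: (@le_trans _ _ (\sum_(i < n) \int[leb R]_(s in U i) g s)).
  apply: ler_sum => i _; have [u0 [uvi v1]] := uv i.
  apply: (le_trans (Fh _ _ u0 uvi v1)).
  have iU (J : interval R) : (leb R).-integrable [set` J] (EFin \o g).
    exact: integrableS ig.
  rewrite le_eqVlt; apply/orP; left; apply/eqP.
  rewrite /U Rintegral_itv_bndo_bndc//.
  rewrite Rintegral_itv_obnd_cbnd//.
  apply: eq_Rintegral => s; rewrite inE/= in_itv/= => /andP[us sv].
  rewrite /g patchE mem_set//= in_itv/=; lra.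
have iX (X : set R) : measurable X -> (leb R).-integrable X (EFin \o g).
  by move=> mX; exact: (@integrableS _ _ _ (leb R) setT X _ measurableT mX (@subsetT _ X) ig).
have iUg i := iX _ (mU i).
have iDg := iX _ mD.
rewrite le_eqVlt; apply/orP; left; apply/eqP.
apply: EFin_inj; rewrite -sumEFin.
have fE (X : set R) : measurable X -> (leb R).-integrable X (EFin \o g) ->
    (\int[leb R]_(s in X) g s)%:E = (\int[leb R]_(s in X) (g s)%:E)%E.
  by move=> mX iXg; rewrite fineK//; apply: integrable_fin_num iXg.
under eq_bigr do rewrite fE//.
under [X in _ = X%:E]eq_Rintegral do rewrite ger0_norm//.
rewrite fE// /D ge0_integral_bigsetU//.
- exact: index_enum_uniq.
- by apply: sub_trivIset tr.
- by have /integrableP[] := iDg.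
- by move=> s _; rewrite lee_fin.
Qed.

Lemma expR_sub_le (R : realType) (m a b : R) : a <= m -> b <= m ->
  `|expR a - expR b| <= expR m * `|a - b|.
Proof.
wlog ba : a b / b <= a.
  move=> H am bm; have [/H|/ltW/H] := leP b a; first exact.
  by rewrite (distrC (expR b)) (distrC b); exact.
move=> am bm; rewrite !ger0_norm ?subr_ge0 ?ler_expR//.
apply: (@le_trans _ _ (expR a * (a - b))); last first.
  by rewrite ler_wpM2r ?subr_ge0// ler_expR.
have -> : expR b = expR a * expR (b - a) by rewrite -expRD addrC subrK.
rewrite -{1}(mulr1 (expR a)) -mulrBr ler_wpM2l ?expR_ge0//.
by have := expR_ge1Dx (b - a); lra.
Qed.

Section LinearIntegralEquation.
Context (R : realType) (k z0 : R) (G y : R -> R).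
Local Notation mu := (leb R).
Hypothesis iG : mu.-integrable `[0, 1] (EFin \o G).
Hypothesis yE : forall x : R, 0 <= x <= 1 -> y x * expR (- (k * x)) = z0 + \int[mu]_(s in `[0, x]) G s.

Let yE' (x : R) : 0 <= x <= 1 -> y x = expR (k * x) * (z0 + \int[mu]_(s in `[0, x]) G s).
Proof. by move=> xI; rewrite -yE// mulrCA -expRD subrr expR0 mulr1. Qed.

Lemma increments_of_integral_equation : exists h : R -> R,
  [/\ mu.-integrable `[0, 1] (EFin \o h), forall s, 0 <= h s &
   forall u v, 0 <= u -> u <= v -> v <= 1 -> `|y v - y u| <= \int[mu]_(s in `[u, v]) h s].
Proof.
(* [y] is the product of exp(k x) and a primitive. [Z] bounds the latter on [0, 1], and [h] adds the
   increments of both factors, with exp(|k|) as the bound of the exponential. *)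
pose Z := `|z0| + \int[mu]_(s in `[0, 1]) `|G s|.
have iN := integrable_norm_fun _ _ _ iG.
have Z0 : 0 <= Z by rewrite addr_ge0//; exact: Rintegral_ge0.
pose h s := expR `|k| * (`|G s| + `|k| * Z).
have cc : continuous (fun s : R => `|k| * Z) by exact: cst_continuous.
have ih : mu.-integrable `[0, 1] (EFin \o h).
  apply: integrable_scale_fun => //; apply: integrable_add_fun => //.
  exact: (continuous_integrable _ _ _ _ cc).
have h0 s : 0 <= h s by rewrite mulr_ge0 ?expR_ge0// addr_ge0// mulr_ge0.
exists h; split=> // u v u0 uv v1.
have v0 : 0 <= v by exact: le_trans uv.
have u1 : u <= 1 by exact: le_trans v1.
have iv := integrable_itv0S _ v G v1 iG.
have sub : `[u, v]%classic `<=` (`[0, 1]%classic : set R).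
  by apply: subset_itv; rewrite bnd_simp.
have iuv : mu.-integrable `[u, v] (EFin \o G) by apply: integrableS iG.
have iNuv := integrable_norm_fun _ _ _ iuv.
have E1 : \int[mu]_(s in `[0, v]) G s - \int[mu]_(s in `[0, u]) G s = \int[mu]_(s in `[u, v]) G s.
  have := @Rintegral_itvB R G (BLeft 0) (BRight v) u iv.
  rewrite !bnd_simp => ->//; rewrite Rintegral_itv_obnd_cbnd//.
  by apply: integrableS iuv => //; apply: subset_itvr; rewrite bnd_simp.
have Zu : `|z0 + \int[mu]_(s in `[0, u]) G s| <= Z.
  have iu := integrable_itv0S _ u G u1 iG.
  apply: (le_trans (ler_normD _ _)); rewrite lerD2l.
  apply: (le_trans (le_normr_Rintegral _ iu)) => //.
  rewrite /Rintegral; apply: fine_le.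
  - exact: integrable_fin_num (integrable_norm_fun _ _ _ iu).
  - exact: integrable_fin_num iN.
  - apply: ge0_subset_integral => //; first by have /integrableP[] := iN.
    by apply: subset_itvl; rewrite bnd_simp.
rewrite yE' ?v0// yE' ?u0//.
set zv := z0 + _; set zu := z0 + _.
have -> : expR (k * v) * zv - expR (k * u) * zu =
   expR (k * v) * (zv - zu) + (expR (k * v) - expR (k * u)) * zu by ring.
have kI (s : R) : 0 <= s -> s <= 1 -> k * s <= `|k|.
  move=> s0 s1; apply: (le_trans (ler_norm _)); rewrite normrM.
  by apply: ler_piMr => //; rewrite ger0_norm.
have -> : \int[mu]_(s in `[u, v]) h s =
    expR `|k| * \int[mu]_(s in `[u, v]) `|G s| + expR `|k| * (`|k| * Z * (v - u)).
  rewrite /h RintegralZl//; last first.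
    by apply: integrable_add_fun => //; exact: (continuous_integrable _ _ _ _ cc).
  rewrite RintegralD//; last exact: (continuous_integrable _ _ _ _ cc).
  rewrite Rintegral_cst//= lebesgue_measure_itv/= lte_fin mulrDr; congr (_ + _ * (_ * _)).
  by case: ltP => //= vu; apply/esym/eqP; rewrite subr_eq0 eq_le uv vu.
apply: (le_trans (ler_normD _ _)); rewrite !normrM; apply: lerD.
  rewrite (ger0_norm (expR_ge0 _)); apply: ler_pM; rewrite ?expR_ge0//.
    by rewrite ler_expR; exact: kI.
  by rewrite /zv /zu opprD addrACA subrr add0r E1; exact: le_normr_Rintegral.
have := expR_sub_le R `|k| _ _ (kI v v0 v1) (kI u u0 u1).
rewrite -mulrBr normrM (ger0_norm (_ : 0 <= v - u)) ?subr_ge0// => eB.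
have -> : expR `|k| * (`|k| * Z * (v - u)) = expR `|k| * (`|k| * (v - u)) * Z by ring.
exact: ler_pM.
Qed.

(** The product rule at the points where Lebesgue's differentiation theorem applies to the primitive
    of [G]; the endpoints, around which the integral equation is available on one side only, form a
    null set. *)
Lemma ae_derive_of_integral_equation : {ae mu, forall x : R, x \in `[0, 1] ->
  is_derive x (1 : R) y (k * y x + expR (k * x) * G x)}.
Proof.
have ends := ae_and R _ _ (ae_neq R 0) (ae_neq R 1).
have H := ae_and _ _ _ ends (ae_derive_primitive _ 1 G iG).
refine (ae_imp _ _ _ _ H) => x [[x0 x1] dx].
rewrite in_itv/= => /andP[x0' x1'].
have {}x0 : 0 < x by rewrite lt_neqAle eq_sym x0.
have {}x1 : x < 1 by rewrite lt_neqAle x1.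
have {}dx := dx x0.
have GE : (G \_ `[0, 1]) x = G x by rewrite patchE mem_set//= in_itv/= x0' x1'.
rewrite GE in dx.
have dk : is_derive x (1 : R) (fun z : R => k * z) k.
  have := is_deriveZ k (is_derive_id x (1 : R)); rewrite /GRing.scale/= mulr1; exact.
have dE : is_derive x (1 : R) (expR \o (fun z : R => k * z)) (expR (k * x) * k).
  exact: is_derive1_comp.
pose P (z : R) := \int[mu]_(t in `[0, z]) (G \_ `[0, 1]) t.
have dz : is_derive x (1 : R) (fun z : R => z0 + P z) (G x).
  have := is_deriveD (is_derive_cst z0 x (1 : R)) dx; rewrite add0r; exact.
have := is_deriveM dE dz.
have Px z : 0 <= z -> z <= 1 -> P z = \int[mu]_(s in `[0, z]) G s.
  move=> z0' z1; apply: eq_Rintegral => s; rewrite inE/= in_itv/= => /andP[s0 sz].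
  by rewrite patchE mem_set//= in_itv/= s0 (le_trans sz).
have -> : (expR \o (fun z : R => k * z)) x *: G x + (z0 + P x) *: (expR (k * x) * k) =
    k * y x + expR (k * x) * G x.
  rewrite yE' ?x0' ?x1'// -Px//= /GRing.scale/=; ring.
apply: near_eq_is_derive; near=> z.
have zI0 : 0 < z by near: z; exact: (cvgr_gt x cvg_id 0 x0).
have zI1 : z < 1 by near: z; exact: (cvgr_lt x cvg_id 1 x1).
rewrite yE'; last by rewrite !ltW.
by rewrite -Px ?ltW.
Unshelve. all: by end_near. Qed.

End LinearIntegralEquation.
(** * Kernels along characteristics *)

Definition gspeed (R : realType) (b1 b2 : R) (k : bool) : R := if k then b2 else b1.

(** The phase b_(~j) xi + b_j (x - xi) of a wave of component [j] vanishes at gratio j times x, and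
    the rest of [0, x] has length gratio (~j) times x: the two ratios add up to 1. *)
Definition gratio (R : realType) (b1 b2 : R) (k : bool) : R := `|gspeed R b1 b2 k| / (b2 - b1).

(** The value of xi at which the phase of a wave of component [j] equals b_l t. For l = j it
    decreases from the zero of the phase to 0 as t runs through [0, x]; for l <> j it increases from
    that zero to x. *)
Definition gphase (R : realType) (b1 b2 : R) (j l : bool) (z : R * R) : R :=
  if l == j then gratio R b1 b2 j * (z.1 - z.2)
  else gratio R b1 b2 j * z.1 + gratio R b1 b2 l * z.2.

(* Up to sign, the real ([i.2 = false]) or imaginary part of the entry [(i.1, l)] of the
   transformation kernel; indices 1, 2 are encoded as [false], [true]. *)
Definition gker (R : realType) (b1 b2 : R) (V : bool * bool -> R * R -> R)
    (i : bool * bool) (l : bool) (z : R * R) : R :=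
  gratio R b1 b2 l * V i (z.1, gphase R b1 b2 i.1 l z).

Lemma neq_negb (l j : bool) : l != j -> l = ~~ j.
Proof. by case: l j => [] []. Qed.

Section CharacteristicKernel.
Context (R : realType) (b1 b2 : R).
Hypotheses (b10 : b1 < 0) (b20 : 0 < b2).
Local Notation mu := (leb R).
Local Notation b := (gspeed R b1 b2).
Local Notation kap := (gratio R b1 b2).
Local Notation phase := (gphase R b1 b2).

Let J0 : 0 < b2 - b1. Proof. by rewrite subr_gt0 (lt_trans b10). Qed.

Lemma gratio_gt0 l : 0 < kap l.
Proof.
by rewrite divr_gt0// normr_gt0 /gspeed; case: l; [rewrite gt_eqF|rewrite lt_eqF].
Qed.

Lemma gratioD j : kap j + kap (~~ j) = 1.
Proof.
have -> : kap j + kap (~~ j) = kap true + kap false by case: j => //; rewrite addrC.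
rewrite /gratio /gspeed (gtr0_norm b20) (ltr0_norm b10) -mulrDl mulfV// gt_eqF//.
Qed.

Lemma gratio_le1 l : kap l <= 1.
Proof. by rewrite -(gratioD l) lerDl ltW// gratio_gt0. Qed.

Lemma gratio_gspeed j : kap j * (b (~~ j) - b j) = - b j.
Proof.
have Jn0 : b2 - b1 != 0 by rewrite gt_eqF.
by rewrite /gratio /gspeed; case: j; rewrite /= ?(gtr0_norm b20) ?(ltr0_norm b10); field.
Qed.

Lemma gphase_itv j l x t : 0 <= t -> t <= x -> 0 <= phase j l (x, t) <= x.
Proof.
move=> t0 tx; have x0 := le_trans t0 tx.
have k0 := ltW (gratio_gt0 j); have k1 := gratio_le1 j.
rewrite /gphase; case: eqVneq => [_|lj] /=.
  rewrite mulr_ge0 ?subr_ge0//= (le_trans _ (_ : x - t <= x)) ?gerBl//.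
  by rewrite ler_piMl// subr_ge0.
have -> := neq_negb _ _ lj.
have k0' := ltW (gratio_gt0 (~~ j)).
rewrite (addr_ge0 (mulr_ge0 k0 x0) (mulr_ge0 k0' t0))/=.
apply: (@le_trans _ _ (kap j * x + kap (~~ j) * x)); last by rewrite -mulrDl gratioD mul1r.
by rewrite lerD2l ler_wpM2l.
Qed.

Lemma continuous_gphase j l : continuous (phase j l).
Proof.
have cz1 : continuous (fun z : R * R => z.1) by exact: continuous_fst_fun.
have cz2 : continuous (fun z : R * R => z.2) by exact: continuous_snd_fun.
rewrite /gphase; case: (l == j).
  by apply: continuous_mul_fun; [exact: cst_continuous|exact: continuous_sub_fun].
by apply: continuous_add_fun; (apply: continuous_mul_fun; first exact: cst_continuous).
Qed.

Lemma continuous_gker V i l : (forall i, continuous (V i)) -> continuous (gker R b1 b2 V i l).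
Proof.
move=> cV; apply: continuous_mul_fun; first exact: cst_continuous.
have cl : continuous (fun z : R * R => (z.1, phase i.1 l z)).
  by apply: continuous_pair_fun; [exact: continuous_fst_fun|exact: continuous_gphase].
exact: (continuous_comp_fun _ _ _ _ _ cl (cV i)).
Qed.

(* Splitting at the zero of the phase [d xi + c (x - xi)] and rescaling each half turns the
   integral over characteristics into a sum of two Laplace-type integrals. *)
Lemma Rintegral_split_phase j x (f : R -> R) : 0 <= x -> continuous f ->
  \int[mu]_(xi in `[0, x]) f xi =
  \int[mu]_(t in `[0, x]) (kap j * f (phase j j (x, t)) + kap (~~ j) * f (phase j (~~ j) (x, t))).
Proof.
move=> x0 cf.
have k0 := gratio_gt0 j; have k0' := gratio_gt0 (~~ j).
have cph l : continuous (fun t => f (phase j l (x, t))).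
  exact: (continuous_comp_fun _ _ _ _ _ (continuous_prodr _ _ x (continuous_gphase j l)) cf).
have ckph l : continuous (fun t => kap l * f (phase j l (x, t))).
  by apply: continuous_mul_fun; [exact: cst_continuous|exact: cph].
rewrite RintegralD//; [|exact: (continuous_integrable _ _ _ _ (ckph _))..].
rewrite !RintegralZl//; [|exact: (continuous_integrable _ _ _ _ (cph _))..].
have kx : 0 <= kap j * x <= x.
  by rewrite mulr_ge0 ?(ltW k0)//= ler_piMl// gratio_le1.
have [kx0 kx1] := andP kx.
rewrite (Rintegral_chasles R 0 (kap j * x) x f cf kx0 kx1).
congr (_ + _).
  have := Rintegral_affine R (kap j) 0 0 x f k0 x0 cf; rewrite mulr0 !addr0 => ->.
  congr (_ * _).
  have cfk : continuous (fun y => f (kap j * y + 0)) by exact: continuous_comp_affine.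
  rewrite -(Rintegral_reflect R x _ x0 cfk).
  by apply: eq_Rintegral => t _; rewrite /gphase eqxx addr0.
have := Rintegral_affine R (kap (~~ j)) (kap j * x) 0 x f k0' x0 cf.
rewrite mulr0 add0r -mulrDl (addrC (kap (~~ j))) gratioD mul1r => ->.
congr (_ * _); apply: eq_Rintegral => t _; rewrite /gphase/= addrC.
by have -> : (~~ j == j) = false by case: (j).
Qed.

(** By the choice of [gphase], after the split the exponent becomes nu b_l t on the part belonging
    to [l], so the wave is a sum of two Laplace-type integrals with the kernel entries as
    densities. *)
Lemma wave_kernel V (e : bool * bool -> R) nu i x : (forall i, continuous (V i)) -> 0 <= x ->
  wave R (bool * bool)%type e V (fun i => b i.1) (fun i => b (~~ i.1)) nu i x =
  e i * expR (nu * b i.1 * x) + \int[mu]_(t in `[0, x])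
    (gker R b1 b2 V i false (x, t) * expR (nu * b1 * t) +
     gker R b1 b2 V i true (x, t) * expR (nu * b2 * t)).
Proof.
move=> cV x0; rewrite /wave; congr (_ + _).
have cf : continuous (fun xi => expR (nu * (b (~~ i.1) * xi + b i.1 * (x - xi))) * V i (x, xi)).
  apply: continuous_mul_fun; last exact: (continuous_prodr _ _ x (cV i)).
  apply: (continuous_comp_fun _ _ _ (fun xi : R => nu * (b (~~ i.1) * xi + b i.1 * (x - xi))));
    last exact: continuous_expR.
  apply: continuous_mul_fun; first exact: cst_continuous.
  apply: continuous_add_fun; apply: continuous_mul_fun;
    [exact: cst_continuous|by move=> y; exact: cvg_id|exact: cst_continuous|].
  by apply: continuous_sub_fun; [exact: cst_continuous|move=> y; exact: cvg_id].
rewrite (Rintegral_split_phase i.1 x _ x0 cf); apply: eq_Rintegral => t _.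
have E1 : b (~~ i.1) * phase i.1 i.1 (x, t) + b i.1 * (x - phase i.1 i.1 (x, t)) = b i.1 * t.
  rewrite /gphase eqxx/=; have := gratio_gspeed i.1; move: (kap i.1) (b (~~ i.1)) (b i.1) => k u v kE.
  have -> : u * (k * (x - t)) + v * (x - k * (x - t)) = k * (u - v) * (x - t) + v * x by ring.
  by rewrite kE; ring.
have E2 : b (~~ i.1) * phase i.1 (~~ i.1) (x, t) + b i.1 * (x - phase i.1 (~~ i.1) (x, t)) =
    b (~~ i.1) * t.
  have -> : phase i.1 (~~ i.1) (x, t) = kap i.1 * x + kap (~~ i.1) * t.
    by rewrite /gphase; case: (i.1).
  have := gratio_gspeed i.1; have := gratio_gspeed (~~ i.1); rewrite negbK.
  move: (kap (~~ i.1)) (kap i.1) (b (~~ i.1)) (b i.1) => k' k u v k'E kE.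
  have -> : u * (k * x + k' * t) + v * (x - (k * x + k' * t)) =
    k * (u - v) * x + v * x - k' * (v - u) * t by ring.
  by rewrite kE k'E; ring.
rewrite E1 E2 !mulrA /gker; case: i {cf E1 E2} => -[] c /=; rewrite /gspeed/=; ring.
Qed.

(** For fixed x the map t -> [gphase] parametrizes one of the two parts of the slice of V, at rate
    gratio l; for fixed t the map x -> [gphase] follows a line of slope gratio i.1. Either rescaling
    costs at most the inverse of a ratio, hence the sum of the two inverses. *)
Lemma gker_lipschitz (A A' : bool * bool -> bool * bool -> R -> R) (e : bool * bool -> R)
    (V V' : bool * bool -> R * R -> R) (p rho d : R) :
  (forall i j, continuous (A i j)) -> (forall i j, continuous (A' i j)) ->
  (forall j, `|e j| <= 1) -> 1 <= p -> 1 <= rho -> 0 < d ->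
  goursat_sol R _ A e V -> goursat_sol R _ A' e V' ->
  \int[mu]_(s in `[0, 1]) (mx_abs R _ A s `^ p) <= rho ->
  \int[mu]_(s in `[0, 1]) (mx_abs R _ A' s `^ p) <= rho ->
  \int[mu]_(s in `[0, 1]) (mx_abs R _ (fun i j s => A i j s - A' i j s) s `^ p) <= d ->
  (forall i l x, 0 <= x <= 1 -> \int[mu]_(t in `[0, x])
     (`|gker R b1 b2 V i l (x, t) - gker R b1 b2 V' i l (x, t)| `^ p) <=
     ((kap false)^-1 + (kap true)^-1) * (goursat_cst R p rho * d)) /\
  (forall i l t, 0 <= t <= 1 -> \int[mu]_(x in `[t, 1])
     (`|gker R b1 b2 V i l (x, t) - gker R b1 b2 V' i l (x, t)| `^ p) <=
     ((kap false)^-1 + (kap true)^-1) * (goursat_cst R p rho * d)).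
Proof.
move=> cA cA' e1 p1 rho1 d0 sV sV' Ar A'r dA.
have cV := sV.1; have cV' := sV'.1.
have p0 : 0 < p by exact: lt_le_trans p1.
have [H1 H2] := goursat_lipschitz R _ A A' e V V' p rho d cA cA' e1 p1 rho1 d0 sV sV' Ar A'r dA.
pose D (z : R * R) := \sum_i `|V i z - V' i z|.
have D0 z : 0 <= D z by exact: sumr_ge0.
have cD : continuous D.
  by apply: continuous_sum_fun => i; apply: continuous_norm_fun; exact: continuous_sub_fun.
have cDp : continuous (fun z => D z `^ p) by exact: continuous_powR_fun.
have ckp : forall i l, continuous (fun z =>
    `|gker R b1 b2 V i l z - gker R b1 b2 V' i l z| `^ p).
  move=> i l; apply: continuous_powR_fun => //; apply: continuous_norm_fun.
  by apply: continuous_sub_fun; exact: continuous_gker.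
have Dk i l (z : R * R) : `|gker R b1 b2 V i l z - gker R b1 b2 V' i l z| <=
    D (z.1, phase i.1 l z).
  rewrite /gker -mulrBr normrM ger0_norm ?(ltW (gratio_gt0 _))//.
  apply: (@le_trans _ _ `|V i (z.1, phase i.1 l z) - V' i (z.1, phase i.1 l z)|).
    by rewrite ler_piMl// gratio_le1.
  by rewrite /D (bigD1 i)//= lerDl; exact: sumr_ge0.
have Dkp i l (z : R * R) : `|gker R b1 b2 V i l z - gker R b1 b2 V' i l z| `^ p <=
    D (z.1, phase i.1 l z) `^ p.
  by apply: ge0_ler_powR; rewrite ?nnegrE ?(ltW p0).
set G := goursat_cst R p rho * d in H1 H2 *.
have G0 : 0 <= G.
  by apply: mulr_ge0; [apply: goursat_cst_ge0; exact: le_trans rho1|exact: ltW].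
have kc j : (kap j)^-1 * G <= ((kap false)^-1 + (kap true)^-1) * G.
  apply: ler_wpM2r => //; have := gratio_gt0 false; have := gratio_gt0 true.
  rewrite -(invr_gt0 (kap true)) -(invr_gt0 (kap false)) => /ltW k1 /ltW k2.
  by case: j; rewrite ?lerDl ?lerDr.
split=> i l.
  move=> x xI; have /andP[x0 x1] := xI.
  apply: le_trans (kc l).
  have cs l' : continuous (fun t => D (x, phase i.1 l' (x, t)) `^ p).
    have cl : continuous (fun t : R => (x, phase i.1 l' (x, t))).
      apply: continuous_pair_fun; first exact: cst_continuous.
      exact: (continuous_prodr _ _ x (continuous_gphase i.1 l')).
    exact: (continuous_comp_fun _ _ _ _ _ cl cDp).
  apply: (@le_trans _ _ (\int[mu]_(t in `[0, x]) (D (x, phase i.1 l (x, t)) `^ p))).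
    apply: le_Rintegral_continuous => //; first exact: (continuous_prodr _ _ x (ckp i l)).
  rewrite -(ler_pM2l (gratio_gt0 l)) mulrA mulfV ?mul1r ?gt_eqF ?gratio_gt0//.
  apply: le_trans (H1 x xI).
  have cDx : continuous (fun xi => D (x, xi) `^ p) by exact: (continuous_prodr _ _ x cDp).
  have ck l' : continuous (fun t => kap l' * D (x, phase i.1 l' (x, t)) `^ p).
    by apply: continuous_mul_fun; [exact: cst_continuous|exact: cs].
  rewrite (Rintegral_split_phase i.1 x (fun xi => D (x, xi) `^ p) x0 cDx).
  rewrite -RintegralZl//; last exact: (continuous_integrable _ _ _ _ (cs l)).
  apply: le_Rintegral_continuous => //; first exact: continuous_add_fun.
  move=> t _; case: (eqVneq l i.1) => [->|li].
    by rewrite lerDl mulr_ge0 ?powR_ge0// ltW// gratio_gt0.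
  have -> := neq_negb _ _ li.
  by rewrite lerDr mulr_ge0 ?powR_ge0// ltW// gratio_gt0.
move=> t tI; have /andP[t0 t1] := tI.
pose al := if l == i.1 then kap l else kap i.1.
pose be := if l == i.1 then - kap l * t else kap l * t.
have phE x : phase i.1 l (x, t) = al * x + be.
  rewrite /gphase /al /be; case: eqP => [<-|//]/=; ring.
have al0 : 0 < al by rewrite /al; case: ifP => _; exact: gratio_gt0.
apply: (@le_trans _ _ (al^-1 * G)); last first.
  by rewrite /al; case: ifP => _; exact: kc.
apply: (le_trans _ (H2 al be t al0 tI _)).
  apply: le_Rintegral_continuous.
  - exact: (continuous_prodl _ _ t (ckp i l)).
  - have cl : continuous (fun x : R => (x, al * x + be)).
      by apply: continuous_pair_fun; [move=> x; exact: cvg_id|exact: continuous_affine].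
    exact: (continuous_comp_fun _ _ _ _ _ cl cDp).
  - by move=> x _; rewrite -phE; exact: Dkp.
by move=> x /andP[tx x1]; rewrite -phE; exact: gphase_itv.
Qed.

End CharacteristicKernel.
(** * The first-order system *)

(** Multiplication by a complex coefficient, written for real and imaginary parts: the exclusive or
    of the two flags selects the part of the coefficient, and only the product of two imaginary
    parts takes a minus sign. No component is coupled with itself, as the potential is
    off-diagonal. *)
Definition gpot (R : realType) (q : bool -> bool -> R -> R) (i j : bool * bool) (s : R) : R :=
  if j.1 == ~~ i.1 then (-1) ^+ (~~ i.2 && j.2) * q i.1 (i.2 (+) j.2) s else 0.

Definition pot_abs (R : realType) (q : bool -> bool -> R -> R) (s : R) : R :=
  \sum_(k : bool) \sum_(c : bool) `|q k c s|.

Definition ginit (R : realType) (s : bool) (i : bool * bool) : R :=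
  if i.2 then 0 else if i.1 then (-1) ^+ s else 1.

Definition ord2 (k : bool) : 'I_2 := if k then 1 else 0.

(* Real and imaginary parts of the coefficient [- i b_k Q_{k,l}], [l <> k], of the system
   solved for [y']. *)
Definition pot_part (R : realType) (b1 b2 : R) (Q : R -> 'M[R[i]]_2) (k c : bool) (s : R) : R :=
  if c then - (gspeed R b1 b2 k * complex.Re (Q s (ord2 k) (ord2 (~~ k))))
  else gspeed R b1 b2 k * complex.Im (Q s (ord2 k) (ord2 (~~ k))).

Lemma sum_bool2 (V : nmodType) (F : bool * bool -> V) :
  \sum_j F j = F (true, true) + F (true, false) + (F (false, true) + F (false, false)).
Proof.
rewrite (eq_bigr (fun j => F (j.1, j.2))); last by case.
by rewrite -(pair_bigA _ (fun a b => F (a, b)))/= !big_bool.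
Qed.

Lemma continuous_gpot (R : realType) (q : bool -> bool -> R -> R) i j :
  (forall k c, continuous (q k c)) -> continuous (gpot R q i j).
Proof.
move=> cq; rewrite /gpot; case: (_ == _); last exact: cst_continuous.
by apply: continuous_mul_fun; [exact: cst_continuous|exact: cq].
Qed.

Lemma integrable_gpot (R : realType) (q : bool -> bool -> R -> R) (D : set R) i j :
  measurable D -> (forall k c, (leb R).-integrable D (EFin \o q k c)) ->
  (leb R).-integrable D (EFin \o gpot R q i j).
Proof.
move=> mD iq; rewrite /gpot; case: (_ == _); first exact: integrable_scale_fun.
exact: integrable0.
Qed.

Lemma gpotB (R : realType) (q q' : bool -> bool -> R -> R) i j s :
  gpot R q i j s - gpot R q' i j s = gpot R (fun k c s => q k c s - q' k c s) i j s.
Proof. by rewrite /gpot; case: (_ == _); rewrite ?subrr// -mulrBr. Qed.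

Lemma gpot_le (R : realType) (q : bool -> bool -> R -> R) i j s :
  `|gpot R q i j s| <= `|q i.1 (i.2 (+) j.2) s|.
Proof.
rewrite /gpot; case: (_ == _); last by rewrite normr0.
by rewrite normrM normrX normrN1 expr1n mul1r.
Qed.

Lemma pot_abs_ge (R : realType) (q : bool -> bool -> R -> R) k c s :
  `|q k c s| <= pot_abs R q s.
Proof.
rewrite /pot_abs (bigD1 k)//= (bigD1 c)//= -addrA lerDl.
by apply: addr_ge0; apply: sumr_ge0 => // l _; apply: sumr_ge0.
Qed.

Lemma pot_abs_ge0 (R : realType) (q : bool -> bool -> R -> R) s : 0 <= pot_abs R q s.
Proof. by apply: sumr_ge0 => k _; apply: sumr_ge0. Qed.

Lemma mx_abs_gpot_le (R : realType) (q : bool -> bool -> R -> R) s :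
  mx_abs R _ (gpot R q) s <= 16 * pot_abs R q s.
Proof.
apply: (@le_trans _ _ (\sum_(i : bool * bool) \sum_(j : bool * bool) pot_abs R q s)).
  apply: ler_sum => i _; apply: ler_sum => j _.
  by apply: (le_trans (gpot_le _ _ _ _ _)); exact: pot_abs_ge.
by rewrite !sum_bool2; lra.
Qed.

Lemma gpot_speeds (R : realType) (b1 b2 : R) (q : bool -> bool -> R -> R) (i j : bool * bool) :
  (gspeed R b1 b2 j.1 = gspeed R b1 b2 (~~ i.1) /\ gspeed R b1 b2 (~~ j.1) = gspeed R b1 b2 i.1) \/
  (forall s, gpot R q i j s = 0).
Proof.
rewrite /gpot; case: eqP => [->|_]; last by right.
by left; rewrite negbK.
Qed.

Lemma ginit_le1 (R : realType) s i : `|ginit R s i| <= 1.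
Proof.
rewrite /ginit; case: i.2; rewrite ?normr0//; case: i.1; rewrite ?normr1//.
by rewrite normrX normrN1 expr1n.
Qed.

Lemma normc_le_ReIm (R : realType) (z : R[i]) :
  Normc.normc z <= `|complex.Re z| + `|complex.Im z|.
Proof.
case: z => a c /=.
rewrite -(ger0_norm (_ : 0 <= `|a| + `|c|)) ?addr_ge0// -sqrtr_sqr ler_sqrt ?sqr_ge0//.
rewrite sqrrD !real_normK ?num_real//.
by rewrite lerD2r lerDl mulrn_wge0// mulr_ge0.
Qed.

Lemma cexp_real (R : realType) (b nu x : R) :
  cexp ('i * b%:C * (0 +i* - nu) * x%:C)%C = ((expR (nu * b * x))%:C)%C.
Proof.
rewrite /cexp.
have -> : ('i * b%:C * (0 +i* - nu) * x%:C)%C = ((nu * b * x)%:C)%C.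
  by apply/eqP; rewrite eq_complex /=; apply/andP; split; apply/eqP; ring.
by rewrite /= cos0 sin0; apply/eqP; rewrite eq_complex /=; apply/andP; split; apply/eqP; ring.
Qed.

Section WaveSolution.
Context (R : realType) (b1 b2 : R) (Q : R -> 'M[R[i]]_2) (s : bool) (nu : R).
Context (Y : bool * bool -> R -> R).
Hypotheses (b10 : b1 < 0) (b20 : 0 < b2) (potQ : potential_matrix Q).
Local Notation mu := (leb R).
Local Notation b := (gspeed R b1 b2).
Local Notation A := (gpot R (pot_part R b1 b2 Q)).
Hypothesis cY : forall i, continuous (Y i).
Hypothesis YE : forall i (x : R), 0 <= x <= 1 ->
  Y i x * expR (- (nu * b i.1 * x)) = ginit R s i +
    \int[mu]_(t in `[0, x]) (expR (- (nu * b i.1 * t)) * \sum_j A i j t * Y j t).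

Lemma integrable_pot_part k c :
  mu.-integrable `[0, 1] (EFin \o pot_part R b1 b2 Q k c).
Proof.
have [h1 h2] := potQ.2 (ord2 k) (ord2 (~~ k)).
case: c; last exact: integrable_scale_fun.
have := integrable_scale_fun R _ (- b k) _ (measurable_itv _) h1.
by apply: eq_integrable => // t _ /=; rewrite /pot_part mulNr.
Qed.

Let iG i : mu.-integrable `[0, 1]
  (EFin \o (fun t => expR (- (nu * b i.1 * t)) * \sum_j A i j t * Y j t)).
Proof.
have h : mu.-integrable `[0, 1]
    (EFin \o (fun t => (\sum_j A i j t * Y j t) * expR (- (nu * b i.1 * t)))).
  apply: integrable_mul_continuous.
    apply: integrable_sum_fun => // j; apply: integrable_mul_continuous => //.
    by apply: integrable_gpot => //; exact: integrable_pot_part.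
  apply: (continuous_comp_fun _ _ _ (fun t : R => - (nu * b i.1 * t))); last exact: continuous_expR.
  by move=> t; apply: cvgN; apply: cvgM; [exact: cvg_cst|exact: cvg_id].
by apply: eq_integrable h => // t _ /=; rewrite mulrC.
Qed.

Let tob (j : 'I_2) : bool := j != 0.
Let tob0 : tob 0 = false. Proof. by []. Qed.
Let tob1 : tob 1 = true. Proof. by []. Qed.
Let ordE (j : 'I_2) : j = 0 \/ j = 1.
Proof. by case: j => -[|[|//]] lj; [left|right]; apply/val_inj. Qed.

Definition wave_col (x : R) : 'cV[R[i]]_2 :=
  \col_j (Y (tob j, false) x +i* Y (tob j, true) x)%C.

Lemma wave_col0 : wave_col 0 = col2 1 ((-1) ^+ s).
Proof.
have Y0 i : Y i 0 = ginit R s i.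
  have := YE i 0; rewrite lexx ler01 => /(_ isT).
  rewrite mulr0 oppr0 expR0 mulr1 => ->.
  by rewrite set_itv1 Rintegral_set1 addr0.
apply/matrixP => j k; rewrite (ord1 k) !mxE.
have [->|->] := ordE j; rewrite ?tob0 ?tob1 !Y0 /ginit/=; first by [].
suff H (u : bool) : ((-1) ^+ u +i* 0)%C = (-1) ^+ u :> R[i] by exact: H.
by case: u; rewrite /= ?expr1 ?expr0//; apply/eqP; rewrite eq_complex/= oppr0 !eqxx.
Qed.

(** [is_kernel] speaks only of solutions in the sense of [is_e], so the integral equation has to be
    converted: absolute continuity comes from dominated increments, and the derivative almost
    everywhere from the four real components. *)
Lemma is_e_wave : is_e b1 b2 Q s (0 +i* - nu)%C wave_col.
Proof.
split; last exact: wave_col0.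
  move=> j.
  have [h1 [ih1 h10 H1]] := increments_of_integral_equation R _ _ _ _ (iG (tob j, false))
    (YE (tob j, false)).
  have [h2 [ih2 h20 H2]] := increments_of_integral_equation R _ _ _ _ (iG (tob j, true))
    (YE (tob j, true)).
  apply: (abs_continuous_dominated R _ (fun t => h1 t + h2 t)).
  - exact: integrable_add_fun.
  - by move=> t; rewrite addr_ge0.
  move=> u v u0 uv v1.
  have sub : `[u, v]%classic `<=` (`[0, 1]%classic : set R).
    by apply: subset_itv; rewrite bnd_simp.
  have i1 : mu.-integrable `[u, v] (EFin \o h1) by apply: integrableS ih1.
  have i2 : mu.-integrable `[u, v] (EFin \o h2) by apply: integrableS ih2.
  rewrite RintegralD// !mxE; apply: (le_trans (normc_le_ReIm _ _)).
  by apply: lerD; [exact: H1|exact: H2].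
have D i := ae_derive_of_integral_equation R _ _ _ _ (iG i) (YE i).
have H := ae_and _ _ _ (ae_and _ _ _ (D (false, false)) (D (false, true)))
  (ae_and _ _ _ (D (true, false)) (D (true, true))).
refine (ae_imp _ _ _ _ H) => x [[d00 d01] [d10 d11]] xI.
have {}d00 := d00 xI; have {}d01 := d01 xI; have {}d10 := d10 xI; have {}d11 := d11 xI.
pose dY i : R := nu * b i.1 * Y i x +
  expR (nu * b i.1 * x) * (expR (- (nu * b i.1 * x)) * \sum_j A i j x * Y j x).
have dYE i : dY i = nu * b i.1 * Y i x + \sum_j A i j x * Y j x.
  by rewrite /dY mulrA -expRD subrr expR0 mul1r.
have dYi i : is_derive x (1 : R) (Y i) (dY i) by case: i => -[] [].
have bj0 j : b (tob j) != 0.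
  by rewrite /gspeed; case: (tob j); [rewrite gt_eqF|rewrite lt_eqF].
pose dy : 'cV[R[i]]_2 := \col_j (dY (tob j, false) +i* dY (tob j, true))%C.
exists dy.
  move=> j; rewrite mxE; split => /=.
    rewrite (_ : (fun u => _) = Y (tob j, false)) ?mxE//.
    by apply/funext => u; rewrite mxE.
  rewrite (_ : (fun u => _) = Y (tob j, true)) ?mxE//.
  by apply/funext => u; rewrite mxE.
(* [X] is the inverse of B applied to [dy], written out; with [dy] replaced by B X the factor
   [invmx] cancels without being computed. *)
pose X : 'cV[R[i]]_2 :=
  \col_j ((b (tob j))^-1 * dY (tob j, false) +i* ((b (tob j))^-1 * dY (tob j, true)))%C.
have BX : Bmx b1 b2 *m X = dy.
  apply/matrixP => j k; rewrite (ord1 k) /Bmx mul_diag_mx !mxE.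
  have -> : [:: (b1%:C)%C; (b2%:C)%C]`_j = ((b (tob j))%:C)%C by case: j => -[|[|//]] lj.
  apply/eqP; rewrite eq_complex/=; apply/andP; split; apply/eqP;
  by rewrite mul0r ?subr0 ?addr0 mulrA mulfV// mul1r.
have uB : Bmx b1 b2 \in unitmx.
  rewrite unitmxE /Bmx det_diag big_ord_recl big_ord1 !mxE/= unitfE mulf_neq0//.
    by rewrite eq_complex/= negb_and lt_eqF.
  by rewrite eq_complex/= negb_and gt_eqF.
rewrite -BX mulKmx//.
have [Q00 Q11] := potQ.1 x xI.
apply/matrixP => j k; rewrite (ord1 k) !mxE big_ord_recl big_ord1 !mxE.
have -> : lift ord0 ord0 = 1 :> 'I_2 by apply/val_inj.
have E0 : ord0 = 0 :> 'I_2 by apply/val_inj.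
rewrite !E0 !dYE !sum_bool2 /gpot /pot_part /=.
have [->|->] := ordE j; rewrite ?tob0 ?tob1 /ord2/= ?Q00 ?Q11.
  have := bj0 0; rewrite tob0 => bn.
  case: (Q x 0 1) => qr qi /=.
  by apply/eqP; rewrite eq_complex/=; apply/andP; split; apply/eqP; field.
have := bj0 1; rewrite tob1 => bn.
case: (Q x 1 0) => qr qi /=.
by apply/eqP; rewrite eq_complex/=; apply/andP; split; apply/eqP; field.
Qed.

End WaveSolution.
Lemma EFin_Rintegral (R : realType) (D : set R) (f : R -> R) : measurable D ->
  (leb R).-integrable D (EFin \o f) ->
  (\int[leb R]_(s in D) f s)%:E = (\int[leb R]_(s in D) (f s)%:E)%E.
Proof. by move=> mD iD; rewrite fineK//; apply: integrable_fin_num iD. Qed.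

(* [K_{jl} = (-1) ^+ (s && l) * kernel_part], so the initial sign of [e0] is absorbed. *)
Definition kernel_part (R : realType) (s : bool) (K : R * R -> 'M[R[i]]_2)
    (i : bool * bool) (l : bool) (z : R * R) : R :=
  (-1) ^+ (s && l) * (if i.2 then complex.Im (K z (ord2 i.1) (ord2 l))
                      else complex.Re (K z (ord2 i.1) (ord2 l))).

(** * Identification of the limit of the approximate kernels *)

Section KernelLimit.
Context (R : realType) (b1 b2 : R) (Q : R -> 'M[R[i]]_2) (s : bool).
Context (K : R * R -> 'M[R[i]]_2).
Hypotheses (b10 : b1 < 0) (b20 : 0 < b2) (potQ : potential_matrix Q).
Hypothesis kerK : is_kernel b1 b2 Q s K.
Local Notation mu := (leb R).
Local Notation b := (gspeed R b1 b2).
Local Notation A := (gpot R (pot_part R b1 b2 Q)).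
Local Notation ker := (kernel_part R s K).

(** For lambda = - i nu the exponentials in [e0] are real, so real and imaginary parts of the
    representation separate and take the same form as in [wave_kernel]. *)
Lemma kernel_wave (Y : bool * bool -> R -> R) nu i (x : R) :
  (forall i, continuous (Y i)) ->
  (forall i (x : R), 0 <= x <= 1 ->
    Y i x * expR (- (nu * b i.1 * x)) = ginit R s i +
    \int[mu]_(t in `[0, x]) (expR (- (nu * b i.1 * t)) * \sum_j A i j t * Y j t)) ->
  0 <= x <= 1 ->
  Y i x = ginit R s i * expR (nu * b i.1 * x) + \int[mu]_(t in `[0, x])
    (ker i false (x, t) * expR (nu * b1 * t) + ker i true (x, t) * expR (nu * b2 * t)).
Proof.
move=> cY YE xI; have [_ _ H] := kerK.
have xI' : x \in `[0, 1] by rewrite in_itv.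
have {H} := H _ _ (is_e_wave R b1 b2 Q s nu Y b10 b20 potQ cY YE) x xI'.
move=> /(congr1 (fun M : 'cV[R[i]]_2 => M (ord2 i.1) 0)).
have e0E (t : R) k : e0 b1 b2 s (0 +i* - nu)%C t (ord2 k) 0 =
    (((-1) ^+ (s && k) * expR (nu * b k * t))%:C)%C.
  rewrite /e0 /col2 mxE !cexp_real; case: k => /=; rewrite ?andbT ?andbF ?expr0 ?mul1r//.
  case: (s); rewrite ?expr1 ?expr0 ?mulN1r ?mul1r//.
  by apply/eqP; rewrite eq_complex/= oppr0 !eqxx.
have KE (t : R) k : (K (x, t) *m e0 b1 b2 s (0 +i* - nu)%C t) (ord2 k) 0 =
    (K (x, t) (ord2 k) (ord2 false) * ((expR (nu * b1 * t))%:C)%C +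
     K (x, t) (ord2 k) (ord2 true) * (((-1) ^+ s * expR (nu * b2 * t))%:C)%C).
  rewrite mxE big_ord_recl big_ord1.
  have -> : lift ord0 ord0 = ord2 true by apply/val_inj.
  have -> : ord0 = ord2 false by apply/val_inj.
  by rewrite !e0E andbF andbT expr0 mul1r.
have tE k : (ord2 k != 0) = k by case: k.
have ReE (z : R[i]) (r : R) : complex.Re (z * (r%:C)%C) = complex.Re z * r.
  by case: z => u v /=; rewrite mulr0 subr0.
have ImE (z : R[i]) (r : R) : complex.Im (z * (r%:C)%C) = complex.Im z * r.
  by case: z => u v /=; rewrite mulr0 add0r.
have ReD (z w : R[i]) : complex.Re (z + w) = complex.Re z + complex.Re w by case: z; case: w.
have ImD (z w : R[i]) : complex.Im (z + w) = complex.Im z + complex.Im w by case: z; case: w.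
rewrite mxE [RHS]mxE e0E [X in _ + X]mxE /cintegral tE.
case: i => k c /= E.
have {E} [ERe EIm] := (congr1 (@complex.Re R) E, congr1 (@complex.Im R) E).
case: c; rewrite /kernel_part /ginit/=.
  move: EIm => /= ->; rewrite add0r mul0r add0r; apply: eq_Rintegral => t _.
  by rewrite KE ImD !ImE andbF andbT expr0 mul1r /ord2/=; ring.
move: ERe => /= ->; congr (_ + _).
  by case: (k); rewrite ?andbT ?andbF ?expr0.
apply: eq_Rintegral => t _.
by rewrite KE ReD !ReE andbF andbT expr0 mul1r /ord2/=; ring.
Qed.

Lemma integrable_kernel_part i l (x : R) : 0 <= x <= 1 ->
  mu.-integrable `[0, x] (EFin \o (fun t => ker i l (x, t))).
Proof.
move=> xI; have [_ H _] := kerK.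
have [h1 h2] := H x (ord2 i.1) (ord2 l) xI.
by case: i h1 h2 => k [] h1 h2; exact: integrable_scale_fun.
Qed.

(** The left-hand side is one of the two nonnegative pieces in [Rintegral_split_phase]. *)
Lemma gker_slice j l (x : R) (f : R -> R) : 0 <= x -> continuous f -> (forall u, 0 <= f u) ->
  \int[mu]_(t in `[0, x]) (gratio R b1 b2 l * f (gphase R b1 b2 j l (x, t))) <=
  \int[mu]_(xi in `[0, x]) f xi.
Proof.
move=> x0 cf f0; rewrite (Rintegral_split_phase R b1 b2 b10 b20 j x f x0 cf).
have cfp l' : continuous (fun t => gratio R b1 b2 l' * f (gphase R b1 b2 j l' (x, t))).
  apply: continuous_mul_fun; first exact: cst_continuous.
  exact: (continuous_comp_fun _ _ _ _ _ (continuous_prodr _ _ x (continuous_gphase R b1 b2 j l')) cf).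
apply: le_Rintegral_continuous => //; first exact: continuous_add_fun.
have k0 l' := ltW (gratio_gt0 R b1 b2 b10 b20 l').
move=> t _; case: (eqVneq l j) => [->|lj]; first by rewrite lerDl mulr_ge0.
by rewrite (neq_negb _ _ lj) lerDr mulr_ge0.
Qed.

Context (q_ : nat -> bool -> bool -> R -> R) (V_ : nat -> bool * bool -> R * R -> R) (M : R).
Hypothesis cq_ : forall n k c, continuous (q_ n k c).
Hypothesis solV : forall n, goursat_sol R _ (gpot R (q_ n)) (ginit R s) (V_ n).
Hypothesis qM : forall n k c,
  \int[mu]_(t in `[0, 1]) `|q_ n k c t - pot_part R b1 b2 Q k c t| <= M * 2^-1 ^+ n.

(** The horizontal slices of the approximate kernels converge, almost everywhere and against
    exponentials, to densities [F0] and [F1]. These and the slices of the given kernel both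
    represent the limit wave for every [nu], so [laplace_unique] identifies them. *)
Lemma gker_cvg_kernel i l (x : R) : 0 <= x <= 1 ->
  {ae mu, forall t, t \in `[0, x] ->
    (fun n => gker R b1 b2 (V_ n) i l (x, t)) @ \oo --> ker i l (x, t)}.
Proof.
move=> xI; have /andP[x0 x1] := xI.
have iq k c : mu.-integrable `[0, 1] (EFin \o pot_part R b1 b2 Q k c).
  exact: integrable_pot_part.
have iA i' j : mu.-integrable `[0, 1] (EFin \o A i' j) by exact: integrable_gpot.
have cA n i' j : continuous (gpot R (q_ n) i' j) by exact: continuous_gpot.
have AM n i' j : \int[mu]_(t in `[0, 1]) `|gpot R (q_ n) i' j t - A i' j t| <= M * 2^-1 ^+ n.
  apply: le_trans (qM n i'.1 (i'.2 (+) j.2)).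
  have i1 := integrable_norm_fun _ _ _ (integrable_sub_fun _ _ _ _ (measurable_itv `[0, 1])
    (continuous_integrable R 0 1 _ (cA n i' j)) (iA i' j)).
  have i2 := integrable_norm_fun _ _ _ (integrable_sub_fun _ _ _ _ (measurable_itv `[0, 1])
    (continuous_integrable R 0 1 _ (cq_ n i'.1 (i'.2 (+) j.2))) (iq i'.1 (i'.2 (+) j.2))).
  apply: le_Rintegral => // t _; rewrite gpotB; exact: gpot_le.
have [L L0 HL] := goursat_cauchy R _ A (fun n => gpot R (q_ n)) (ginit R s) V_ M iA cA
  (ginit_le1 R s) solV AM.
have cV n := (solV n).1.
pose g l' n (t : R) := gker R b1 b2 (V_ n) i l' (x, t).
have cg l' n : continuous (g l' n).
  exact: (continuous_prodr _ _ x (continuous_gker R b1 b2 (V_ n) i l' (cV n))).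
have ig l' n := continuous_integrable R 0 x _ (cg l' n).
have gL l' n : (\int[mu]_(t in `[0%R, x]) (`|g l' n.+1 t - g l' n t|)%:E <= (L * 2^-1 ^+ n)%:E)%E.
  have cd := continuous_norm_fun _ _ _ (continuous_sub_fun _ _ _ _ (cg l' n.+1) (cg l' n)).
  rewrite -EFin_Rintegral//; last exact: (continuous_integrable _ _ _ _ cd).
  rewrite lee_fin; apply: le_trans (HL n x xI).
  pose f (xi : R) := \sum_j `|V_ n.+1 j (x, xi) - V_ n j (x, xi)|.
  have cf : continuous f.
    apply: continuous_sum_fun => j; apply: continuous_norm_fun; apply: continuous_sub_fun.
      exact: (continuous_prodr _ _ x (cV n.+1 j)).
    exact: (continuous_prodr _ _ x (cV n j)).
  apply: le_trans (gker_slice i.1 l' x f x0 cf (fun u => sumr_ge0 _ (fun j _ => normr_ge0 _))).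
  apply: le_Rintegral_continuous => //.
    apply: continuous_mul_fun; first exact: cst_continuous.
    exact: (continuous_comp_fun _ _ _ _ _ (continuous_prodr _ _ x (continuous_gphase R b1 b2 i.1 l')) cf).
  move=> t _; rewrite /g /gker -mulrBr normrM ger0_norm; last first.
    by rewrite ltW// gratio_gt0.
  apply: ler_wpM2l; first by rewrite ltW// gratio_gt0.
  by rewrite /f (bigD1 i)//= lerDl; exact: sumr_ge0.
have HF l' := L1_geometric_limit R _ (g l') L (measurable_itv `[0, x]) (ig l') (gL l').
have [F0 [iF0 aeF0 wF0]] := HF false.
have [F1 [iF1 aeF1 wF1]] := HF true.
have ik l' := integrable_kernel_part i l' x xI.
have cexp (c : R) : continuous (fun t : R => expR (c * t)).
  apply: (continuous_comp_fun _ _ _ (fun t : R => c * t)); last exact: continuous_expR.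
  by apply: continuous_mul_fun; [exact: cst_continuous|move=> t; exact: cvg_id].
have wE (c : R) : measurable_fun (`[0, x]%classic : set R) (fun t : R => expR (c * t)) /\
    exists C : R, forall t, `[0, x]%classic t -> `|expR (c * t)| <= C.
  split; first by apply: measurable_funTS; exact: continuous_measurable_fun.
  have [C C0 HC] := continuous_bounded01 R _ (cexp c).
  exists C => t; rewrite /= in_itv/= => /andP[t0 tx].
  by apply: HC; rewrite t0 (le_trans tx).
have FE nu : \int[mu]_(t in `[0, x]) (F0 t * expR (nu * b1 * t) + F1 t * expR (nu * b2 * t)) =
    \int[mu]_(t in `[0, x])
      (ker i false (x, t) * expR (nu * b1 * t) + ker i true (x, t) * expR (nu * b2 * t)).
  have sp n := gpot_speeds R b1 b2 (q_ n).
  have [Y [cY WY YE]] := wave_limit R _ A (fun n => gpot R (q_ n)) (ginit R s) V_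
    (fun i => b i.1) (fun i => b (~~ i.1)) nu M iA cA (ginit_le1 R s) solV sp AM.
  (* With the free wave added, both sides are the value at x of the limit solution: the right one by
     [kernel_wave], the left one as a limit of [wave_kernel]. *)
  apply: (@addrI _ (ginit R s i * expR (nu * b i.1 * x))).
  rewrite -(kernel_wave Y nu i x cY YE xI).
  apply: (cvg_unique _ _ (WY i x xI)) => //.
  rewrite (_ : (fun n => _) = (fun n => ginit R s i * expR (nu * b i.1 * x) +
     (\int[mu]_(t in `[0, x]) (g false n t * expR (nu * b1 * t)) +
      \int[mu]_(t in `[0, x]) (g true n t * expR (nu * b2 * t))))); last first.
    apply/funext => n; rewrite wave_kernel//; congr (_ + _).
    rewrite -RintegralD//; exact: integrable_mul_continuous.
  rewrite RintegralD//; [|exact: integrable_mul_continuous..].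
  apply: cvgD; first exact: cvg_cst.
  by apply: cvgD; [apply: wF0|apply: wF1]; have [] := wE (nu * b1); have [] := wE (nu * b2).
have i0 := integrable_sub_fun _ _ _ _ (measurable_itv `[0, x]) iF0 (ik false).
have i1 := integrable_sub_fun _ _ _ _ (measurable_itv `[0, x]) iF1 (ik true).
have orth nu : \int[mu]_(t in `[0, x]) ((F0 t - ker i false (x, t)) * expR (nu * b1 * t) +
    (F1 t - ker i true (x, t)) * expR (nu * b2 * t)) = 0.
  rewrite -[RHS](subrr (\int[mu]_(t in `[0, x])
    (ker i false (x, t) * expR (nu * b1 * t) + ker i true (x, t) * expR (nu * b2 * t)))).
  rewrite -{1}FE -RintegralB//.
  - by apply: eq_Rintegral => t _ /=; ring.
  - by apply: integrable_add_fun => //; exact: integrable_mul_continuous.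
  - by apply: integrable_add_fun => //; exact: integrable_mul_continuous.
have [U0 U1] := laplace_unique R x b1 b2 _ _ b10 b20 i0 i1 orth.
have aeE l' : {ae mu, forall t, t \in `[0, x] ->
    (if l' then F1 t else F0 t) = ker i l' (x, t)}.
  case: l'; [refine (ae_imp _ _ _ _ U1)|refine (ae_imp _ _ _ _ U0)];
  by move=> t H /H /eqP; rewrite subr_eq0 => /eqP.
have aeC : {ae mu, forall t, `[0, x]%classic t ->
    (fun n => g l n t) @ \oo --> (if l then F1 t else F0 t)} by case: (l).
refine (ae_imp _ _ _ _ (ae_and _ _ _ (aeE l) aeC)) => t [H1 H2] tI.
by rewrite -(H1 tI); exact: H2.
Qed.

End KernelLimit.
(** * Slices and passage to the limit *)

Lemma powR_sum_le (R : realType) (I : finType) (p : R) (x : I -> R) : 1 <= p ->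
  (forall i, 0 <= x i) ->
  (\sum_i x i) `^ p <= #|I|%:R `^ p * \sum_i (x i) `^ p.
Proof.
move=> p1 x0; have p0 : 0 < p by exact: lt_le_trans p1.
case: (pickP I) => [i0 _|I0]; last first.
  rewrite !big_pred0 ?mulr0// powR0// gt_eqF//.
have [m _ Hm] := @Order.TotalTheory.arg_maxP _ _ I i0 xpredT x isT.
apply: (@le_trans _ _ ((#|I|%:R * x m) `^ p)).
  apply: ge0_ler_powR; rewrite ?nnegrE ?(ltW p0)//.
  - exact: sumr_ge0.
  - by rewrite mulr_ge0.
  - apply: (@le_trans _ _ (\sum_(i : I) x m)); first by apply: ler_sum => i _; exact: Hm.
    by rewrite sumr_const mulr_natl.
rewrite powRM//; apply: ler_wpM2l; first exact: powR_ge0.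
rewrite (bigD1 m)//= lerDl; apply: sumr_ge0 => i _; exact: powR_ge0.
Qed.

Lemma measurable_Omega (R : realType) : measurable (@Omega R).
Proof.
have m1 (f : R * R -> R) : continuous f -> measurable [set z | 0 <= f z].
  move=> cf; have mf := continuous_measurable2 R f cf.
  rewrite (_ : mkset _ = setT `&` f @^-1` `[0, +oo[%classic).
    exact: (mf measurableT _ (measurable_itv _)).
  by rewrite setTI; apply/seteqP; split => z /=; rewrite in_itv/= andbT.
rewrite (_ : @Omega R = [set z : R * R | 0 <= z.2] `&` [set z : R * R | 0 <= z.1 - z.2] `&`
    [set z : R * R | 0 <= 1 - z.1]).
  have c1 : continuous (fun z : R * R => z.1) by exact: continuous_fst_fun.
  have c2 : continuous (fun z : R * R => z.2) by exact: continuous_snd_fun.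
  apply: measurableI; first apply: measurableI.
  - exact: m1.
  - by apply: m1; exact: continuous_sub_fun.
  - by apply: m1; apply: continuous_sub_fun => //; exact: cst_continuous.
apply/seteqP; split => z; rewrite /Omega/= !subr_ge0.
  by move=> [? [? ?]].
by move=> [[? ?] ?].
Qed.

Lemma measurable_slice_fst (R : realType) (f : R * R -> R) (x : R) : 0 <= x <= 1 ->
  measurable_fun (@Omega R) f -> measurable_fun (`[0, x]%classic : set R) (fun t => f (x, t)).
Proof.
move=> /andP[x0 x1] mf.
apply: (measurable_comp (measurable_Omega R) _ mf); last exact: measurableT_comp.
by move=> _ [t /= tI <-]; move: tI; rewrite in_itv/= => /andP[].
Qed.

Lemma measurable_slice_snd (R : realType) (f : R * R -> R) (t : R) : 0 <= t <= 1 ->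
  measurable_fun (@Omega R) f -> measurable_fun (`[t, 1]%classic : set R) (fun x => f (x, t)).
Proof.
move=> /andP[t0 t1] mf.
apply: (measurable_comp (measurable_Omega R) _ mf).
  by move=> _ [x /= xI <-]; move: xI; rewrite in_itv/= => /andP[].
by apply: measurable_funTS; exact: measurable_pair2.
Qed.

(* A.e. convergence on horizontal slices passes to vertical slices: the measurable function
   [limsup |f_n - k|] vanishes a.e. on [Omega] by Tonelli. *)
Lemma ae_slice_swap (R : realType) (f : nat -> R * R -> R) (k : R * R -> R) :
  (forall n, measurable_fun (@Omega R) (f n)) -> measurable_fun (@Omega R) k ->
  (forall x : R, 0 <= x <= 1 -> {ae leb R, forall t, t \in `[0, x] ->
    (fun n => f n (x, t)) @ \oo --> k (x, t)}) ->
  {ae leb R, forall t, t \in `[0, 1] ->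
    {ae leb R, forall x, x \in `[t, 1] ->
      (fun n => f n (x, t)) @ \oo --> k (x, t)}}.
Proof.
move=> mf mk H.
pose phi0 (z : R * R) := limn_esup (fun n => (`|f n z - k z|)%:E).
pose phi := phi0 \_ (@Omega R).
have mphi : measurable_fun setT phi.
  apply/(measurable_restrictT _ (measurable_Omega R)).
  apply: measurable_fun_limn_esup => n; apply/measurable_EFinP.
  by apply: measurableT_comp => //; exact: measurable_funB.
have phi00 z : (0 <= phi0 z)%E.
  rewrite /phi0 limn_esup_lim; apply: lime_ge; first exact: is_cvg_esups.
  apply: nearW => n; apply: le_trans (_ : ((`|f n z - k z|)%:E <= _)%E); first by rewrite lee_fin.
  by apply: ereal_sup_ubound; exists n => /=.
have phi_ge0 z : (0 <= phi z)%E by rewrite /phi patchE; case: ifP.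
have phi_cvg z : Omega z -> phi z = 0%E -> (fun n => f n z) @ \oo --> k z.
  move=> Oz; rewrite /phi patchE mem_set// => E.
  have h : (phi0 z <= 0)%E by rewrite E.
  have := limn_esup_le_cvg h (fun n => (normr_ge0 (f n z - k z) : (0 <= (`|f n z - k z|)%:E)%E)).
  move=> /fine_cvgP[_ c0].
  apply/subr_cvg0; apply/norm_cvg0P; exact: c0.
have cvg_phi z : (Omega z -> (fun n => f n z) @ \oo --> k z) -> phi z = 0%E.
  rewrite /phi patchE; case: ifPn => // /set_mem Oz /(_ Oz) c.
  have : (fun n => (`|f n z - k z|)%:E) @ \oo --> 0%:E.
    apply/fine_cvgP; split; first exact: nearW.
    by apply/norm_cvg0P; apply/subr_cvg0; exact: c.
  by move=> /cvg_limn_einf_sup[].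
have sec x : (\int[leb R]_t phi (x, t) = 0)%E.
  have mx : measurable_fun setT (fun t => phi (x, t)) by exact: measurableT_comp.
  transitivity (\int[leb R]_(t in setT) (cst 0%E t))%E; last exact: integral0.
  apply: ae_eq_integral => //.
  have [xI|xI] := boolP (0 <= x <= 1); last first.
    apply: aeW => t _; apply: cvg_phi => -[/= t0 [tx x1]].
    by rewrite (le_trans t0 tx) x1 in xI.
  refine (ae_imp _ _ _ _ (H x xI)) => t Ht _; apply: cvg_phi => -[/= t0 [tx x1]].
  by apply: Ht; rewrite in_itv/= t0.
have FT := @fubini_tonelli _ _ _ _ R (leb R) (leb R) phi mphi phi_ge0.
have FT0 : (\int[leb R]_t \int[leb R]_x phi (x, t) = 0)%E.
  by rewrite -FT; under eq_integral do rewrite sec; rewrite integral0.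
pose F t := (\int[leb R]_x phi (x, t))%E.
have F0 t : (0 <= F t)%E by exact: integral_ge0.
have mF : measurable_fun setT F.
  exact: (@measurable_fun_fubini_tonelli_G _ _ _ _ R (leb R) phi mphi phi_ge0).
have IF : (\int[leb R]_t `|F t| = 0)%E.
  by rewrite -[RHS]FT0; apply: eq_integral => t _; exact: (gee0_abs (F0 t)).
have aeF := (@ae_eq_integral_abs _ _ R (leb R) setT measurableT F mF).1 IF.
refine (ae_imp _ _ _ _ aeF) => t Ft; rewrite in_itv/= => /andP[t0 _].
have {}Ft : F t = 0%E by exact: Ft.
have mt : measurable_fun setT (fun x => phi (x, t)).
  by apply: measurableT_comp => //; exact: measurable_pair2.
have It : (\int[leb R]_x `|phi (x, t)| = 0)%E.
  by rewrite -[RHS]Ft; apply: eq_integral => x _; exact: (gee0_abs (phi_ge0 (x, t))).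
have aephi := (@ae_eq_integral_abs _ _ R (leb R) setT measurableT
  (fun x => phi (x, t)) mt).1 It.
refine (ae_imp _ _ _ _ aephi) => x px.
rewrite in_itv/= => /andP[tx x1].
by apply: phi_cvg; [split; [exact: t0|split; [exact: tx|exact: x1]]|exact: px].
Qed.
Lemma integral_powR_mono (R : realType) (D : set R) (p k a : R) (f g : R -> R) : 1 <= p ->
  measurable D -> measurable_fun D f -> 0 <= k ->
  (forall s, D s -> 0 <= g s) -> (forall s, D s -> 0 <= f s) -> (forall s, D s -> g s <= k * f s) ->
  (\int[leb R]_(s in D) (f s `^ p)%:E <= a%:E)%E ->
  (\int[leb R]_(s in D) (g s `^ p)%:E <= (k `^ p * a)%:E)%E.
Proof.
move=> p1 mD mf k0 g0 f0 gf fa; have p0 : 0 < p by exact: lt_le_trans p1.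
apply: (@le_trans _ _ (\int[leb R]_(s in D) ((k `^ p)%:E * (f s `^ p)%:E))%E).
  apply: ge0_le_integral_all => s Ds; first by rewrite lee_fin powR_ge0.
  rewrite [leRHS](_ : _ = (k `^ p * f s `^ p)%:E)// lee_fin -powRM ?f0//.
  by apply: ge0_ler_powR; rewrite ?nnegrE ?(ltW p0) ?mulr_ge0 ?f0 ?g0 ?gf.
rewrite ge0_integralZl_EFin//; last 3 first.
- by move=> s _; rewrite lee_fin powR_ge0.
- by apply/measurable_EFinP; exact: (measurableT_comp (measurable_powR p) mf).
- exact: powR_ge0.
by rewrite [leRHS](_ : _ = (k `^ p)%:E * a%:E)%E// lee_wpmul2l// lee_fin powR_ge0.
Qed.

Lemma integral_powRD_le (R : realType) (D : set R) (p a b : R) (f g h : R -> R) : 1 <= p ->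
  measurable D -> measurable_fun D f -> measurable_fun D g ->
  (forall s, D s -> 0 <= f s) -> (forall s, D s -> 0 <= g s) ->
  (forall s, D s -> 0 <= h s) -> (forall s, D s -> h s <= f s + g s) ->
  (\int[leb R]_(s in D) (f s `^ p)%:E <= a%:E)%E ->
  (\int[leb R]_(s in D) (g s `^ p)%:E <= b%:E)%E ->
  (\int[leb R]_(s in D) (h s `^ p)%:E <= (2 `^ p * (a + b))%:E)%E.
Proof.
move=> p1 mD mf mg f0 g0 h0 hfg fa gb; have p0 : 0 < p by exact: lt_le_trans p1.
have mp (u : R -> R) : measurable_fun D u -> measurable_fun D (fun s => (u s `^ p)%:E).
  by move=> mu; apply/measurable_EFinP; exact: (measurableT_comp (measurable_powR p) mu).
have p0' (u : R -> R) s : (0 <= (u s `^ p)%:E)%E by rewrite lee_fin powR_ge0.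
apply: (@le_trans _ _ (\int[leb R]_(s in D)
   ((2 `^ p)%:E * ((f s `^ p)%:E + (g s `^ p)%:E)))%E).
  apply: ge0_le_integral_all => s Ds; first exact: p0'.
  rewrite [leRHS](_ : _ = (2 `^ p * (f s `^ p + g s `^ p))%:E)// lee_fin.
  apply: le_trans (powR_add_le R p _ _ p1 (f0 s Ds) (g0 s Ds)).
  by apply: ge0_ler_powR; rewrite ?nnegrE ?(ltW p0) ?addr_ge0 ?f0 ?g0 ?h0 ?hfg.
rewrite ge0_integralZl_EFin ?powR_ge0//; last 2 first.
- by move=> s _; exact: adde_ge0.
- by apply: emeasurable_funD; exact: mp.
rewrite ge0_integralD//; [|exact: mp..].
rewrite [leRHS](_ : _ = (2 `^ p)%:E * (a%:E + b%:E))%E//; apply: lee_wpmul2l.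
  by rewrite lee_fin powR_ge0.
exact: leeD.
Qed.

Lemma integral_powR_sum_le (R : realType) (D : set R) (I : finType) (p a : R) (f : I -> R -> R) :
  1 <= p -> measurable D -> (forall i, measurable_fun D (f i)) ->
  (forall i s, D s -> 0 <= f i s) ->
  (forall i, (\int[leb R]_(s in D) (f i s `^ p)%:E <= a%:E)%E) ->
  (\int[leb R]_(s in D) ((\sum_i f i s) `^ p)%:E <=
    (#|I|%:R `^ p * (#|I|%:R * a))%:E)%E.
Proof.
move=> p1 mD mf f0 fa; have p0 : 0 < p by exact: lt_le_trans p1.
have mp i : measurable_fun D (fun s => (f i s `^ p)%:E).
  by apply/measurable_EFinP; exact: (measurableT_comp (measurable_powR p) (mf i)).
apply: (@le_trans _ _ (\int[leb R]_(s in D)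
   ((#|I|%:R `^ p)%:E * (\sum_i (f i s `^ p)%:E)))%E).
  apply: ge0_le_integral_all => s Ds; first by rewrite lee_fin powR_ge0.
  rewrite sumEFin [leRHS](_ : _ = (#|I|%:R `^ p * (\sum_i f i s `^ p))%:E)// lee_fin.
  by apply: powR_sum_le => // i; exact: f0.
rewrite ge0_integralZl_EFin ?powR_ge0//; last 2 first.
- by move=> s _; apply: sume_ge0 => i _; rewrite lee_fin powR_ge0.
- exact: emeasurable_sum.
rewrite [leRHS](_ : _ = (#|I|%:R `^ p)%:E * (#|I|%:R * a)%:E)%E//; apply: lee_wpmul2l.
  by rewrite lee_fin powR_ge0.
rewrite ge0_integral_sum//; last by move=> i s _; rewrite lee_fin powR_ge0.
apply: (@le_trans _ _ (\sum_(i : I) a%:E)%E); first by apply: lee_sum => i _; exact: fa.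
by rewrite sumEFin sumr_const mulr_natl.
Qed.

Lemma pot_absE (R : realType) (q : bool -> bool -> R -> R) s :
  pot_abs R q s = \sum_(j : bool * bool) `|q j.1 j.2 s|.
Proof. by rewrite sum_bool2 /pot_abs !big_bool. Qed.

Lemma measurable_pot_abs (R : realType) (D : set R) (q : bool -> bool -> R -> R) :
  (forall k c, measurable_fun D (q k c)) -> measurable_fun D (pot_abs R q).
Proof.
move=> mq; rewrite (_ : pot_abs R q = fun s => \sum_(j : bool * bool) `|q j.1 j.2 s|).
  by apply: measurable_sum => j; exact: measurableT_comp.
by apply/funext => s; exact: pot_absE.
Qed.

Lemma integral_pot_abs_le (R : realType) (p a : R) (q : bool -> bool -> R -> R) : 1 <= p ->
  (forall k c, measurable_fun (`[0, 1]%classic : set R) (q k c)) ->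
  (forall k c, (\int[leb R]_(s in `[0%R, 1%R]) (`|q k c s| `^ p)%:E <= a%:E)%E) ->
  (\int[leb R]_(s in `[0%R, 1%R]) (pot_abs R q s `^ p)%:E <=
    (4 `^ p * (4 * a))%:E)%E.
Proof.
move=> p1 mq qa; under eq_integral do rewrite pot_absE.
have := integral_powR_sum_le R `[0, 1] (bool * bool)%type p a (fun j s => `|q j.1 j.2 s|).
rewrite card_prod card_bool; apply => //.
by move=> j; exact: measurableT_comp.
Qed.

Lemma cvg_abs_sub_powR (R : realType) (p : R) (u v : nat -> R) (a b : R) : 1 <= p ->
  u @ \oo --> a -> v @ \oo --> b -> (fun n => `|u n - v n| `^ p) @ \oo --> `|a - b| `^ p.
Proof.
move=> p1 ua vb; have h : (fun n => u n - v n) @ \oo --> a - b by exact: cvgB.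
exact: (cvg_comp _ _ h (continuous_abs_powR R p p1 (a - b))).
Qed.

(** All that the limit argument uses of a potential and its kernel. Besides true kernels it admits
    continuous potentials with constant sequences ([approximated_cst]), among them zero, so that one
    estimate between two records serves every purpose. *)
Record approximated (R : realType) (b1 b2 p : R) (s : bool) (q : bool -> bool -> R -> R)
    (k : bool * bool -> bool -> R * R -> R) (q_ : nat -> bool -> bool -> R -> R)
    (V_ : nat -> bool * bool -> R * R -> R) : Prop := Approximated {
  apx_mq : forall l c, measurable_fun (`[0, 1]%classic : set R) (q l c);
  apx_mk : forall i l, measurable_fun (@Omega R) (k i l);
  apx_cq : forall n l c, continuous (q_ n l c);
  apx_le : forall n l c, (\int[leb R]_(t in `[0%R, 1%R])
    (`|q l c t - q_ n l c t| `^ p)%:E <= (2^-1 ^+ n)%:E)%E;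
  apx_sol : forall n, goursat_sol R _ (gpot R (q_ n)) (ginit R s) (V_ n);
  apx_cvg : forall i l x, 0 <= x <= 1 -> {ae leb R, forall t, t \in `[0, x] ->
    (fun n => gker R b1 b2 (V_ n) i l (x, t)) @ \oo --> k i l (x, t)} }.

Arguments apx_mq {R b1 b2 p s q k q_ V_}.
Arguments apx_mk {R b1 b2 p s q k q_ V_}.
Arguments apx_cq {R b1 b2 p s q k q_ V_}.
Arguments apx_le {R b1 b2 p s q k q_ V_}.
Arguments apx_sol {R b1 b2 p s q k q_ V_}.
Arguments apx_cvg {R b1 b2 p s q k q_ V_}.

(** Bounds the p-th power integrals of [mx_abs] for all approximations: 4^p 4 is the largest error
    of [pot_abs], 2^p comes from adding it to the potential, 16^p from the 16 pairs of real indices,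
    and 1 secures [1 <= rho]. *)
Definition kernel_rho (R : realType) (p r : R) : R := 1 + 16 `^ p * (2 `^ p * (r + 4 `^ p * 4)).

(** The product of 16^p and 2^p is the factor of [D] in the limit of the bounds [d n] below. *)
Definition kernel_cst (R : realType) (b1 b2 p r : R) : R :=
  ((gratio R b1 b2 false)^-1 + (gratio R b1 b2 true)^-1) *
  (goursat_cst R p (kernel_rho R p r) * (16 `^ p * 2 `^ p)).

(** * Lipschitz estimates for slices of the limit kernels *)

Section ApproximatedLipschitz.
Context (R : realType) (b1 b2 p r D : R) (s : bool).
Context (q q' : bool -> bool -> R -> R) (k k' : bool * bool -> bool -> R * R -> R).
Context (q_ q'_ : nat -> bool -> bool -> R -> R) (V_ V'_ : nat -> bool * bool -> R * R -> R).
Hypotheses (b10 : b1 < 0) (b20 : 0 < b2) (p1 : 1 <= p) (r0 : 0 <= r) (D0 : 0 <= D).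
Hypotheses (ap : approximated R b1 b2 p s q k q_ V_) (ap' : approximated R b1 b2 p s q' k' q'_ V'_).
Local Notation mu := (leb R).
Hypothesis qr : (\int[mu]_(t in `[0%R, 1%R]) (pot_abs R q t `^ p)%:E <= r%:E)%E.
Hypothesis q'r : (\int[mu]_(t in `[0%R, 1%R]) (pot_abs R q' t `^ p)%:E <= r%:E)%E.
Hypothesis qD : (\int[mu]_(t in `[0%R, 1%R])
  (pot_abs R (fun l c t => q l c t - q' l c t) t `^ p)%:E <= D%:E)%E.

Let rho := kernel_rho R p r.

Let rho1 : 1 <= rho.
Proof.
rewrite /rho /kernel_rho lerDl mulr_ge0 ?powR_ge0// mulr_ge0 ?powR_ge0// addr_ge0//.
Qed.

Let half1 n : (2^-1 : R) ^+ n <= 1.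
Proof. by rewrite exprn_ile1// invf_le1// ler1n. Qed.

Let err_le q0 k0 q0_ V0_ n : approximated R b1 b2 p s q0 k0 q0_ V0_ ->
  measurable_fun (`[0, 1]%classic : set R) (pot_abs R (fun l c t => q0 l c t - q0_ n l c t)) /\
  (\int[mu]_(t in `[0%R, 1%R]) (pot_abs R (fun l c t => q0 l c t - q0_ n l c t) t `^ p)%:E <=
    (4 `^ p * (4 * 2^-1 ^+ n))%:E)%E.
Proof.
move=> a; have m l c : measurable_fun (`[0, 1]%classic : set R) (fun t => q0 l c t - q0_ n l c t).
  apply: measurable_funB; first exact: (apx_mq a).
  by apply: measurable_funTS; apply: continuous_measurable_fun; exact: (apx_cq a).
split; first exact: measurable_pot_abs.
apply: integral_pot_abs_le => // l c; exact: (apx_le a).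
Qed.

Let Rint_mx (g : bool -> bool -> R -> R) (a : R) : (forall l c, continuous (g l c)) ->
  (\int[mu]_(t in `[0%R, 1%R]) (pot_abs R g t `^ p)%:E <= a%:E)%E ->
  \int[mu]_(t in `[0, 1]) (mx_abs R _ (gpot R g) t `^ p) <= 16 `^ p * a.
Proof.
move=> cg ga.
have cm : continuous (mx_abs R _ (gpot R g)).
  by apply: continuous_mx_abs => i j; exact: continuous_gpot.
have cmp : continuous (fun t => mx_abs R _ (gpot R g) t `^ p).
  by apply: continuous_powR_fun => // t; exact: mx_abs_ge0.
rewrite -lee_fin EFin_Rintegral//; last exact: (continuous_integrable _ _ _ _ cmp).
apply: (integral_powR_mono R _ p 16 a (pot_abs R g)) => //.
- apply: measurable_pot_abs => l c.
  by apply: measurable_funTS; exact: continuous_measurable_fun.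
- by move=> t _; exact: mx_abs_ge0.
- by move=> t _; exact: pot_abs_ge0.
- by move=> t _; exact: mx_abs_gpot_le.
Qed.

Let rho_le q0 k0 q0_ V0_ n : approximated R b1 b2 p s q0 k0 q0_ V0_ ->
  (\int[mu]_(t in `[0%R, 1%R]) (pot_abs R q0 t `^ p)%:E <= r%:E)%E ->
  \int[mu]_(t in `[0, 1]) (mx_abs R _ (gpot R (q0_ n)) t `^ p) <= rho.
Proof.
move=> a ar; have [me ie] := err_le _ _ _ _ n a.
have H : (\int[mu]_(t in `[0%R, 1%R]) (pot_abs R (q0_ n) t `^ p)%:E <=
    (2 `^ p * (r + 4 `^ p * (4 * 2^-1 ^+ n)))%:E)%E.
  apply: (integral_powRD_le _ _ _ _ _ _ _ _ p1 (measurable_itv _) _ me _ _ _ _ ar ie) => //.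
  - apply: measurable_pot_abs; exact: (apx_mq a).
  - by move=> t _; exact: pot_abs_ge0.
  - by move=> t _; exact: pot_abs_ge0.
  - by move=> t _; exact: pot_abs_ge0.
  move=> t _; rewrite !pot_absE -big_split/=; apply: ler_sum => j _.
  rewrite -[X in `|X| <= _](subKr (q0 j.1 j.2 t)); exact: ler_normB.
apply: (le_trans (Rint_mx _ _ (apx_cq a n) H)).
rewrite /rho /kernel_rho -[leLHS]add0r lerD//; apply: ler_wpM2l; first exact: powR_ge0.
apply: ler_wpM2l; first exact: powR_ge0.
rewrite lerD2l; apply: ler_wpM2l; first exact: powR_ge0.
by rewrite ler_piMr.
Qed.

Let c4 : R := 2 `^ p * (4 `^ p * 4 + 4 `^ p * 4).
Let c40 : 0 < c4.
Proof. by rewrite mulr_gt0 ?powR_gt0// addr_gt0// mulr_gt0 ?powR_gt0. Qed.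

(** [c4] collects the errors of the two approximations. Its term keeps [d n] positive even for D = 0
    and disappears in the limit, which leaves a bound proportional to D. *)
Let d n : R := 16 `^ p * (2 `^ p * (D + c4 * 2^-1 ^+ n)).

Let d_gt0 n : 0 < d n.
Proof.
rewrite mulr_gt0 ?powR_gt0// mulr_gt0 ?powR_gt0// ltr_wpDl// mulr_gt0// exprn_gt0//.
Qed.

Let d_cvg : d @ \oo --> 16 `^ p * (2 `^ p * D).
Proof.
rewrite -[X in _ * (_ * X)]addr0 -[X in D + X](mulr0 c4).
apply: cvgM; first exact: cvg_cst.
apply: cvgM; first exact: cvg_cst.
apply: cvgD; first exact: cvg_cst.
apply: cvgM; first exact: cvg_cst.
by apply: cvg_expr; rewrite gtr0_norm ?invr_gt0// invf_lt1// ltr1n.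
Qed.

Let d_le n : \int[mu]_(t in `[0, 1])
  (mx_abs R _ (fun i j t => gpot R (q_ n) i j t - gpot R (q'_ n) i j t) t `^ p) <= d n.
Proof.
have [m1 i1] := err_le _ _ _ _ n ap; have [m2 i2] := err_le _ _ _ _ n ap'.
have H12 : (\int[mu]_(t in `[0%R, 1%R]) ((pot_abs R (fun l c t => q l c t - q_ n l c t) t +
     pot_abs R (fun l c t => q' l c t - q'_ n l c t) t) `^ p)%:E <= (c4 * 2^-1 ^+ n)%:E)%E.
  have -> : c4 * 2^-1 ^+ n = 2 `^ p * (4 `^ p * (4 * 2^-1 ^+ n) + 4 `^ p * (4 * 2^-1 ^+ n)).
    by rewrite /c4; ring.
  apply: (integral_powRD_le _ _ _ _ _ _ _ _ p1 (measurable_itv _) m1 m2 _ _ _ _ i1 i2) => //.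
  - by move=> t _; exact: pot_abs_ge0.
  - by move=> t _; exact: pot_abs_ge0.
  - by move=> t _; rewrite addr_ge0// pot_abs_ge0.
have H : (\int[mu]_(t in `[0%R, 1%R])
    (pot_abs R (fun l c t => q_ n l c t - q'_ n l c t) t `^ p)%:E <=
    (2 `^ p * (D + c4 * 2^-1 ^+ n))%:E)%E.
  apply: (integral_powRD_le _ _ _ _ _ _ _ _ p1 (measurable_itv _) _ _ _ _ _ _ qD H12) => //.
  - apply: measurable_pot_abs => l c; apply: measurable_funB.
      exact: (apx_mq ap).
    exact: (apx_mq ap').
  - exact: measurable_funD.
  - by move=> t _; exact: pot_abs_ge0.
  - by move=> t _; rewrite addr_ge0// pot_abs_ge0.
  - by move=> t _; exact: pot_abs_ge0.
  move=> t _; rewrite !pot_absE -!big_split/=; apply: ler_sum => j _.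
  set a := q _ _ _; set a' := q' _ _ _; set u := q_ _ _ _ _; set u' := q'_ _ _ _ _.
  have -> : u - u' = (a - a') + (- (a - u) + (a' - u')) by ring.
  apply: (le_trans (ler_normD _ _)); rewrite lerD2l.
  by apply: (le_trans (ler_normD _ _)); rewrite normrN.
rewrite (_ : (fun t => _) = (fun t => mx_abs R _ (gpot R (fun l c t => q_ n l c t - q'_ n l c t)) t `^ p)).
  apply: Rint_mx => // l c; apply: continuous_sub_fun.
    exact: (apx_cq ap).
  exact: (apx_cq ap').
apply/funext => t; congr (_ `^ p); apply: eq_bigr => i _; apply: eq_bigr => j _.
by rewrite gpotB.
Qed.

Let K := ((gratio R b1 b2 false)^-1 + (gratio R b1 b2 true)^-1).

Let lip n := gker_lipschitz R b1 b2 b10 b20 _ _ (ginit R s) (V_ n) (V'_ n) p rho (d n)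
  (fun i j => continuous_gpot R _ i j (apx_cq ap n))
  (fun i j => continuous_gpot R _ i j (apx_cq ap' n))
  (ginit_le1 R s) p1 rho1 (d_gt0 n) (apx_sol ap n)
  (apx_sol ap' n) (rho_le _ _ _ _ n ap qr) (rho_le _ _ _ _ n ap' q'r) (d_le n).

Let lim_cst : (fun n => K * (goursat_cst R p rho * d n)) @ \oo --> kernel_cst R b1 b2 p r * D.
Proof.
have -> : kernel_cst R b1 b2 p r * D = K * (goursat_cst R p rho * (16 `^ p * (2 `^ p * D))).
  by rewrite /kernel_cst -/K -/rho; ring.
apply: cvgM; first exact: cvg_cst.
by apply: cvgM; [exact: cvg_cst|exact: d_cvg].
Qed.

Let ck n i l : continuous (gker R b1 b2 (V_ n) i l).
Proof. by apply: continuous_gker; have [] := apx_sol ap n. Qed.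
Let ck' n i l : continuous (gker R b1 b2 (V'_ n) i l).
Proof. by apply: continuous_gker; have [] := apx_sol ap' n. Qed.

Let f i l n z : R := `|gker R b1 b2 (V_ n) i l z - gker R b1 b2 (V'_ n) i l z| `^ p.
Let g i l z : R := `|k i l z - k' i l z| `^ p.

Let cf i l n : continuous (f i l n).
Proof.
apply: continuous_powR_fun => //; apply: continuous_norm_fun; exact: continuous_sub_fun.
Qed.

Let mg i l : measurable_fun (@Omega R) (g i l).
Proof.
apply: (measurableT_comp (measurable_powR p)); apply: measurableT_comp => //.
by apply: measurable_funB; [exact: (apx_mk ap)|exact: (apx_mk ap')].
Qed.

Lemma approximated_lipschitz_fst i l (x : R) : 0 <= x <= 1 ->
  (\int[mu]_(t in `[0%R, x]) (`|k i l (x, t) - k' i l (x, t)| `^ p)%:E <=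
    (kernel_cst R b1 b2 p r * D)%:E)%E.
Proof.
move=> xI.
have h := apx_cvg ap i l x xI.
have h' := apx_cvg ap' i l x xI.
have cfx n := continuous_prodr _ _ x (cf i l n).
apply: (integral_fatou_le R `[0, x] (fun n t => f i l n (x, t)) (fun t => g i l (x, t))
  (fun n => K * (goursat_cst R p rho * d n))) => //.
- by move=> n; apply: measurable_funTS; apply: continuous_measurable_fun; exact: cfx.
- exact: measurable_slice_fst.
- by move=> n t _; exact: powR_ge0.
- by move=> t _; exact: powR_ge0.
- refine (ae_imp _ _ _ _ (ae_and _ _ _ h h')) => t [h1 h2] tI.
  by apply: cvg_abs_sub_powR => //; [exact: h1|exact: h2].
- move=> n; rewrite -EFin_Rintegral//; last exact: (continuous_integrable _ _ _ _ (cfx n)).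
  by rewrite lee_fin; apply: (lip n).1.
Qed.

(** In contrast to horizontal slices only almost every t is reached, since convergence on vertical
    slices comes from [ae_slice_swap]; this is enough for an essential supremum. *)
Lemma approximated_lipschitz_snd i l : {ae mu, forall t, t \in `[0, 1] ->
  (\int[mu]_(x in `[t, 1%R]) (`|k i l (x, t) - k' i l (x, t)| `^ p)%:E <=
    (kernel_cst R b1 b2 p r * D)%:E)%E}.
Proof.
have mf (V : bool * bool -> R * R -> R) : continuous (gker R b1 b2 V i l) ->
    measurable_fun (@Omega R) (gker R b1 b2 V i l).
  by move=> c; apply: measurable_funTS; exact: continuous_measurable2.
have h := ae_slice_swap R (fun n => gker R b1 b2 (V_ n) i l) (k i l) (fun n => mf _ (ck n i l))
  (apx_mk ap i l) (apx_cvg ap i l).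
have h' := ae_slice_swap R (fun n => gker R b1 b2 (V'_ n) i l) (k' i l) (fun n => mf _ (ck' n i l))
  (apx_mk ap' i l) (apx_cvg ap' i l).
refine (ae_imp _ _ _ _ (ae_and _ _ _ h h')) => t [h1 h2] tI.
have tI' : 0 <= t <= 1 by move: tI; rewrite in_itv.
have {}h1 := h1 tI; have {}h2 := h2 tI.
have cft n := continuous_prodl _ _ t (cf i l n).
apply: (integral_fatou_le R `[t, 1] (fun n x => f i l n (x, t)) (fun x => g i l (x, t))
  (fun n => K * (goursat_cst R p rho * d n))) => //.
- by move=> n; apply: measurable_funTS; apply: continuous_measurable_fun; exact: cft.
- exact: measurable_slice_snd.
- by move=> n x _; exact: powR_ge0.
- by move=> x _; exact: powR_ge0.
- refine (ae_imp _ _ _ _ (ae_and _ _ _ h1 h2)) => x [H1 H2] xI.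
  by apply: cvg_abs_sub_powR => //; [exact: H1|exact: H2].
- move=> n; rewrite -EFin_Rintegral//; last exact: (continuous_integrable _ _ _ _ (cft n)).
  by rewrite lee_fin; apply: (lip n).2.
Qed.

End ApproximatedLipschitz.
(** * Equivalence of norms and the final estimates *)

(* Each face [v_i = 1] of the unit cube is compact and avoids the origin, so the norm is
   bounded below on it. *)
Lemma norm_coord_bound (R : realType) (n : nat) (F : 'rV[R]_n -> R) :
  (forall v, F v = 0 -> v = 0) -> (forall u v, F (u + v) <= F u + F v) ->
  (forall a v, F (a *: v) = `|a| * F v) ->
  exists2 C : R, 0 < C & forall (v : 'rV[R]_n) i, `|v 0 i| <= C * F v.
Proof.
move=> F0 FD FZ.
have F00 : F 0 = 0 by rewrite -(scale0r 0) FZ normr0 mul0r.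
have FN v : F (- v) = F v by rewrite -scaleN1r FZ normrN1 mul1r.
have Fge0 v : 0 <= F v.
  by have := FD v (- v); rewrite subrr F00 FN; lra.
pose c1 := \sum_(i < n) F (delta_mx 0 i).
have Fle v : F v <= \sum_(i < n) `|v 0 i| * F (delta_mx 0 i).
  rewrite {1}(row_sum_delta v).
  elim/big_ind2 : _ => [|x1 x2 y1 y2 h1 h2|i _]; first by rewrite F00.
    by apply: (le_trans (FD _ _)); exact: lerD.
  by rewrite FZ.
have Fsub u v : `|F u - F v| <= F (u - v).
  have h1 := FD (u - v) v; have h2 := FD (v - u) u; rewrite !subrK in h1 h2.
  rewrite -opprB FN in h2.
  by rewrite ler_norml; apply/andP; split; lra.
have cF : continuous F.
  move=> v; pose G (u : 'rV[R]_n) := \sum_(i < n) `|(v - u) 0 i| * F (delta_mx 0 i).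
  have cG : G u @[u --> v] --> 0.
    rewrite [X in _ --> X](_ : 0 = G v); last first.
      by rewrite /G subrr big1// => i _; rewrite mxE normr0 mul0r.
    have : continuous G.
      apply: continuous_sum_fun => i; apply: continuous_mul_fun; last exact: cst_continuous.
      apply: continuous_norm_fun.
      rewrite (_ : (fun u : 'rV[R]_n => (v - u) 0 i) = (fun u => v 0 i - u 0 i)); last first.
        by apply/funext => u; rewrite !mxE.
      by apply: continuous_sub_fun; [exact: cst_continuous|exact: coord_continuous].
    exact.
  apply: (proj2 (@cvgrPdist_le _ _ _ (nbhs v) (nbhs_filter v) F (F v))) => eps eps0.
  refine (@filterS _ (nbhs v) (nbhs_filter v) _ _ _ (cvgr_lt 0 cG eps eps0)) => u /ltW h.
  exact: le_trans (Fsub v u) (le_trans (Fle _) h).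
have face i : exists2 c : R, 0 < c & forall v : 'rV[R]_n, v 0 i = 1 -> (forall j, `|v 0 j| <= 1) ->
    c <= F v.
  pose S (j : 'I_n) : set R := if j == i then [set 1] else `[-1, 1]%classic.
  have cS : compact [set v : 'rV[R]_n | forall j, S j (v ord0 j)].
    apply: rV_compact => j; rewrite /S; case: eqP => _; first exact: compact_set1.
    exact: segment_compact.
  have nS : [set v : 'rV[R]_n | forall j, S j (v ord0 j)] !=set0.
    exists (const_mx 1) => j; rewrite mxE /S; case: eqP => //= _.
    by rewrite in_itv/= lexx andbT (le_trans _ ler01)// lerN10.
  have [v0 v0S Hv0] := compact_EVT_min nS cS (continuous_subspaceT cF).
  exists (F v0).
    rewrite lt_neqAle Fge0 andbT eq_sym; apply/eqP => /F0 v00.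
    move: v0S; rewrite inE/= v00 => /(_ i); rewrite /S eqxx mxE/= => /eqP.
    by rewrite eq_sym oner_eq0.
  move=> v vi vj; apply: Hv0; rewrite inE/= => j; rewrite /S; case: eqP => [->//|_] /=.
  by rewrite in_itv/= -ler_norml.
have [c Hc] := choice (fun i => let: ex_intro2 c c0 H := face i in
  ex_intro (fun c => 0 < c /\ forall v : 'rV[R]_n, v 0 i = 1 -> (forall j, `|v 0 j| <= 1) ->
    c <= F v) c (conj c0 H)).
exists (1 + \sum_i (c i)^-1).
  by rewrite ltr_pwDl// sumr_ge0// => i _; rewrite invr_ge0 ltW// (Hc i).1.
move=> v i.
have [m _ Hm] := @Order.TotalTheory.arg_maxP _ _ 'I_n i xpredT (fun j => `|v 0 j|) isT.
have [vm0|vm0] := eqVneq (v 0 m) 0.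
  have := Hm i isT; rewrite vm0 normr0 => /le_trans; apply.
  by rewrite mulr_ge0// addr_ge0// sumr_ge0// => j _; rewrite invr_ge0 ltW// (Hc j).1.
have [cm0 Hcm] := Hc m.
have : c m <= F ((v 0 m)^-1 *: v).
  apply: Hcm; first by rewrite mxE mulVf.
  move=> j; rewrite mxE normrM normfV mulrC ler_pdivrMr ?normr_gt0// mul1r; exact: Hm.
rewrite FZ normfV mulrC ler_pdivlMr ?normr_gt0// => H.
apply: (le_trans (Hm i isT)).
apply: (@le_trans _ _ ((c m)^-1 * F v)).
  by rewrite -ler_pdivrMl ?invr_gt0// invrK.
apply: ler_wpM2r => //; rewrite (bigD1 m)//= addrCA lerDl addr_ge0// sumr_ge0// => j _.
by rewrite invr_ge0 ltW// (Hc j).1.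
Qed.

Definition cpart (R : realType) (c : bool) (z : R[i]) : R :=
  if c then complex.Im z else complex.Re z.

Lemma cpartB (R : realType) c (z w : R[i]) : cpart R c (z - w) = cpart R c z - cpart R c w.
Proof. by case: z; case: w; case: c. Qed.

(** [emb] reads real vectors indexed by the eight real coordinates as complex matrices; there [N]
    becomes a real norm, and [norm_coord_bound] applies. The other inequality is the triangle
    inequality on matrix units. *)
Lemma mxnorm_equiv (R : realType) (N : 'M[R[i]]_2 -> R) : is_mxnorm N ->
  exists c1 c2 : R, [/\ 0 <= c1, 0 < c2,
    forall A : 'M[R[i]]_2, N A <= c1 * \sum_(m : bool * bool * bool) `|cpart R m.1.2 (A (ord2 m.1.1) (ord2 m.2))|
  & forall (A : 'M[R[i]]_2) (m : bool * bool * bool), `|cpart R m.1.2 (A (ord2 m.1.1) (ord2 m.2))| <= c2 * N A].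
Proof.
move=> [N0 ND NZ].
have N00 : N 0 = 0 by rewrite -(scale0r 0) NZ Normc.normc0 mul0r.
have NN A : N (- A) = N A by rewrite -scaleN1r NZ /= oppr0 sqrrN expr1n expr0n addr0 sqrtr1 mul1r.
have Nge0 A : 0 <= N A by have := ND A (- A); rewrite subrr N00 NN; lra.
pose c1 := \sum_j \sum_k N (delta_mx j k).
have c1ge j k : N (delta_mx j k) <= c1.
  rewrite /c1 (bigD1 j)//= (bigD1 k)//= -addrA lerDl addr_ge0// sumr_ge0// => l _.
  exact: sumr_ge0.
have sum2 (V : nmodType) (G : 'I_2 -> V) : \sum_j G j = G (ord2 false) + G (ord2 true).
  rewrite big_ord_recl big_ord1; congr (G _ + G _); exact/val_inj.
pose I3 := (bool * bool * bool)%type.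
pose tob (j : 'I_2) : bool := j != 0.
have tobK k : tob (ord2 k) = k by case: k.
pose emb (v : 'rV[R]_#|{: I3}|) : 'M[R[i]]_2 := \matrix_(j, k)
  (v 0 (enum_rank ((tob j, false, tob k) : I3)) +i* v 0 (enum_rank ((tob j, true, tob k) : I3)))%C.
have embp v m : cpart R m.1.2 (emb v (ord2 m.1.1) (ord2 m.2)) = v 0 (enum_rank m).
  by rewrite mxE !tobK; case: m => -[j []] k.
have [C C0 HC] : exists2 C : R, 0 < C & forall (v : 'rV[R]_#|{: I3}|) i, `|v 0 i| <= C * N (emb v).
  apply: norm_coord_bound.
  - move=> v /N0 e0; apply/rowP => i; rewrite mxE -(enum_valK i) -embp e0 mxE.
    by rewrite /cpart; case: ifP.
  - move=> u v; rewrite (_ : emb (u + v) = emb u + emb v)//.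
    by apply/matrixP => j k; rewrite !mxE.
  move=> a v; rewrite (_ : emb (a *: v) = (a%:C)%C *: emb v).
    by rewrite NZ /= expr0n/= addr0 sqrtr_sqr.
  apply/matrixP => j k; rewrite !mxE; apply/eqP; rewrite eq_complex/= !mul0r subr0 addr0.
  by rewrite !eqxx.
exists c1, C; split=> //.
- by rewrite sumr_ge0// => j _; exact: sumr_ge0.
- move=> A.
  have S3 (G : I3 -> R) : \sum_m G m = \sum_j \sum_k (G (tob j, false, tob k) + G (tob j, true, tob k)).
    rewrite !sum2 !tobK (eq_bigr (fun m : I3 => G (m.1, m.2))); last by case.
    rewrite -(pair_bigA _ (fun a b => G (a, b)))/= sum_bool2 !big_bool/=; ring.
  rewrite S3 mulr_sumr {1}(matrix_sum_delta A).
  elim/big_ind2 : _ => [|x1 x2 y1 y2 h1 h2|j _]; first by rewrite N00.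
    by apply: (le_trans (ND _ _)); exact: lerD.
  rewrite mulr_sumr.
  elim/big_ind2 : _ => [|x1 x2 y1 y2 h1 h2|k _]; first by rewrite N00.
    by apply: (le_trans (ND _ _)); exact: lerD.
  have oK (l : 'I_2) : ord2 (tob l) = l by case: l => -[|[|//]] ?; exact/val_inj.
  rewrite NZ mulrC !oK; apply: ler_pM => //; first by case: (A j k) => u v; exact: sqrtr_ge0.
  exact: normc_le_ReIm.
move=> A m.
pose v : 'rV[R]_#|{: I3}| := \row_i (let m := enum_val i in
  cpart R m.1.2 (A (ord2 m.1.1) (ord2 m.2))).
have -> : A = emb v.
  apply/matrixP => j k; rewrite !mxE !enum_rankK/=.
  have oK (l : 'I_2) : ord2 (tob l) = l by case: l => -[|[|//]] ?; exact/val_inj.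
  by rewrite !oK; case: (A j k).
rewrite embp; exact: HC.
Qed.
Lemma ess_sup01_poweR_le (R : realType) (p c : R) (g : R -> \bar R) : 1 <= p -> 0 <= c ->
  (forall t, (0 <= g t)%E) ->
  {ae leb R, forall t, t \in `[0, 1] -> (g t <= c%:E)%E} ->
  (ess_sup01 g `^ p^-1 <= (c `^ p^-1)%:E)%E.
Proof.
move=> p1 c0 g0 gc; have p0 : 0 < p by exact: lt_le_trans p1.
have up : (ess_sup01 g <= c%:E)%E.
  apply/ess_supP; have [N [mN N0 sN]] := gc.
  have m01 : measurable (`[0, 1]%classic : set R) by exact: measurable_itv.
  (* The measure restricted to [0, 1] does not see the complement, which can therefore join the
     exceptional set. *)
  exists (N `|` ~` `[0, 1]%classic); split.
  - by apply: measurableU => //; exact: measurableC.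
  - have h : leb R ((N `|` ~` `[0, 1]%classic) `&` `[0, 1]%classic) = 0%E.
      rewrite setIUl setICl setU0.
      by apply: (subset_measure0 _ mN (@subIsetl _ _ _) N0); exact: measurableI.
    exact: h.
  move=> t /= gt; have [tI|tI] := pselect (`[0, 1]%classic t); last by right.
  by left; apply: sN => /= H; apply: gt; exact: H.
(* The measure of [0, 1] being positive, the essential supremum of a nonnegative function is
   nonnegative; this places it where the root is monotone. *)
have low : (0 <= ess_sup01 g)%E.
  apply: ess_sup_gee; last exact: aeW.
  have h : (0 < leb R (setT `&` `[0%R, 1%R]%classic))%E.
    by rewrite setTI lebesgue_measure_itv/= lte01 oppr0 adde0 lte01.
  exact: h.
rewrite -poweR_EFin; apply: gt0_ler_poweR => //.
- by rewrite invr_ge0 ltW.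
- by rewrite in_itv/= low leey.
- by rewrite in_itv/= lee_fin c0 leey.
Qed.

Lemma le_poweR_inv (R : realType) (p c : R) (J : \bar R) : 1 <= p -> 0 <= c -> (0 <= J)%E ->
  (J `^ p^-1 <= c%:E)%E -> (J <= (c `^ p)%:E)%E.
Proof.
move=> p1 c0; have p0 : 0 < p by exact: lt_le_trans p1.
case: J => [J| |//]; last by rewrite poweRyr// invr_eq0 gt_eqF.
rewrite poweR_EFin !lee_fin => J0 Jc.
rewrite -[leLHS](powRr1 J0) -(mulVf (_ : p != 0)) ?gt_eqF// powRrM.
by apply: ge0_ler_powR; rewrite ?nnegrE ?powR_ge0 ?(ltW p0).
Qed.

(** Measurability is asked of the smaller function [g] and not of the dominating [f]: the factor is
    moved to [g] before integrating. This suits f = N (Q x). *)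
Lemma integral_powR_mono_r (R : realType) (D : set R) (p k a : R) (f g : R -> R) : 1 <= p ->
  measurable D -> measurable_fun D g -> 0 < k ->
  (forall s, D s -> 0 <= g s) -> (forall s, D s -> g s <= k * f s) ->
  (\int[leb R]_(s in D) (f s `^ p)%:E <= a%:E)%E ->
  (\int[leb R]_(s in D) (g s `^ p)%:E <= (k `^ p * a)%:E)%E.
Proof.
move=> p1 mD mg k0 g0 gf fa; have p0 : 0 < p by exact: lt_le_trans p1.
have mkg : measurable_fun D (fun s => k^-1 * g s).
  by apply: measurable_funM => //; exact: measurable_cst.
have kg0 s : D s -> 0 <= k^-1 * g s by move=> Ds; rewrite mulr_ge0 ?(g0 s Ds)// invr_ge0 ltW.
apply: (integral_powR_mono R D p k a (fun s => k^-1 * g s)) => //; first exact: ltW.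
  by move=> s Ds; rewrite mulrA mulfV ?gt_eqF// mul1r.
apply: le_trans fa; apply: ge0_le_integral_all => s Ds; first by rewrite lee_fin powR_ge0.
have kf : k^-1 * g s <= f s by rewrite mulrC ler_pdivrMr// mulrC gf.
rewrite lee_fin; apply: ge0_ler_powR; rewrite ?nnegrE ?(ltW p0) ?kg0 ?kf//.
exact: le_trans (kg0 s Ds) kf.
Qed.

Lemma approximated_cst (R : realType) (b1 b2 p : R) (s : bool) (q : bool -> bool -> R -> R)
    (V : bool * bool -> R * R -> R) : 1 <= p ->
  (forall l c, continuous (q l c)) -> goursat_sol R _ (gpot R q) (ginit R s) V ->
  approximated R b1 b2 p s q (gker R b1 b2 V) (fun=> q) (fun=> V).
Proof.
move=> p1 cq sV; split=> //.
- by move=> l c; apply: measurable_funTS; exact: continuous_measurable_fun.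
- move=> i l; apply: measurable_funTS; apply: continuous_measurable2; apply: continuous_gker.
  exact: sV.1.
- move=> n l c; under eq_integral do rewrite subrr normr0 powR0 ?gt_eqF ?(lt_le_trans ltr01 p1)//.
  by rewrite integral0 lee_fin exprn_ge0// invr_ge0.
by move=> i l x xI; apply: aeW => t _; exact: cvg_cst.
Qed.

Lemma goursat_sol0 (R : realType) (I : finType) (e : I -> R) :
  goursat_sol R I (fun _ _ _ => 0) e (fun _ _ => 0).
Proof.
split=> [i|i x xi _ _ _]; first exact: cst_continuous.
rewrite big1 ?add0r; last by move=> j _; rewrite mul0r.
rewrite (_ : (fun s => _) = cst 0); last first.
  by apply/funext => s; rewrite big1// => j _; rewrite mul0r.
by rewrite Rintegral_cst// mul0r.
Qed.

Lemma gpot0 (R : realType) : gpot R (fun _ _ _ => 0) = (fun _ _ _ => 0).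
Proof.
by apply/funext => i; apply/funext => j; apply/funext => t; rewrite /gpot mulr0 if_same.
Qed.

(** * Approximation data for a given potential and kernel *)

Section ApproximatedExists.
Context (R : realType) (b1 b2 p : R) (s : bool) (Q : R -> 'M[R[i]]_2) (K : R * R -> 'M[R[i]]_2).
Hypotheses (b10 : b1 < 0) (b20 : 0 < b2) (p1 : 1 <= p) (potQ : potential_matrix Q).
Hypothesis kerK : is_kernel b1 b2 Q s K.
Local Notation mu := (leb R).
Hypothesis Qp : forall l c,
  (\int[mu]_(t in `[0%R, 1%R]) (`|pot_part R b1 b2 Q l c t| `^ p)%:E < +oo)%E.

Lemma measurable_kernel_part i l : measurable_fun (@Omega R) (kernel_part R s K i l).
Proof.
have [h _ _] := kerK; have [[[[h1 h2] _] _] _] := h (ord2 i.1) (ord2 l).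
by apply: measurable_funM; [exact: measurable_cst|case: i.2].
Qed.

Lemma approximated_exists : exists q_ V_,
  approximated R b1 b2 p s (pot_part R b1 b2 Q) (kernel_part R s K) q_ V_.
Proof.
have iq l c := integrable_pot_part R b1 b2 Q potQ l c.
have mq l c : measurable_fun (`[0, 1]%classic : set R) (pot_part R b1 b2 Q l c).
  by apply/measurable_EFinP; exact: (measurable_int _ (iq l c)).
pose h n : R := 2^-1 ^+ n.
have h0 n : 0 < h n by rewrite exprn_gt0// invr_gt0.
have h1 n : h n <= 1 by rewrite exprn_ile1// invf_le1// ler1n.
(* The tolerance (2^-n)^p serves two ends: it is at most 2^-n, as [approximated] asks, and it makes
   the L^1 error at most 2^-n, as [gker_cvg_kernel] asks. *)
have ex (m : nat * bool * bool) : exists g : R -> R, continuous g /\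
    (\int[mu]_(t in `[0%R, 1%R]) (`|pot_part R b1 b2 Q m.1.2 m.2 t - g t| `^ p)%:E <=
      (h m.1.1 `^ p)%:E)%E.
  have [g cg gp] := Lp_continuous_approx R p (h m.1.1 `^ p) _ p1 (powR_gt0 _ (h0 _))
    (mq m.1.2 m.2) (Qp m.1.2 m.2).
  by exists g.
have [g Hg] := choice ex.
pose q_ n l c := g (n, l, c).
have cq n l c : continuous (q_ n l c) by exact: (Hg (n, l, c)).1.
have qp n l c := (Hg (n, l, c)).2.
have exV n : exists V, goursat_sol R _ (gpot R (q_ n)) (ginit R s) V.
  have [V [cV VE]] := goursat_exists R _ (gpot R (q_ n))
    (fun i xi => \sum_j gpot R (q_ n) i j xi * ginit R s j)
    (fun i j => continuous_gpot R (q_ n) i j (cq n))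
    (fun i => continuous_sum_fun _ _ _ _ (fun j => continuous_mul_fun _ _ _ _
      (continuous_gpot R (q_ n) i j (cq n)) (@cst_continuous _ _ _))).
  by exists V.
have [V_ HV] := choice exV.
exists q_, V_; split=> //.
- exact: measurable_kernel_part.
- move=> n l c; apply: (le_trans (qp n l c)); rewrite lee_fin.
  by apply: ge1r_powR => //; rewrite h0 h1.
move=> i l x xI.
apply: (gker_cvg_kernel R b1 b2 Q s K b10 b20 potQ kerK q_ V_ 1 cq HV) => // n l' c.
rewrite mul1r.
have iqd := integrable_norm_fun _ _ _ (integrable_sub_fun _ _ _ _ (measurable_itv `[0, 1])
  (iq l' c) (continuous_integrable R 0 1 _ (cq n l' c))).
under eq_Rintegral do rewrite distrC.
rewrite -lee_fin EFin_Rintegral//.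
apply: (integral_le_of_powR R `[0, 1] p (h n)) => //.
- by rewrite /= lebesgue_measure_itv/= lte01 oppr0 adde0.
- by apply/measurable_EFinP; exact: (measurable_int _ iqd).
- exact: qp.
Qed.

End ApproximatedExists.

(** * From estimates of slices to norms of matrix kernels *)

Section NormBounds.
Context (R : realType) (b1 b2 p r D : R) (s : bool).
Context (q q' : bool -> bool -> R -> R) (k k' : bool * bool -> bool -> R * R -> R).
Context (q_ q'_ : nat -> bool -> bool -> R -> R) (V_ V'_ : nat -> bool * bool -> R * R -> R).
Hypotheses (b10 : b1 < 0) (b20 : 0 < b2) (p1 : 1 <= p) (r0 : 0 <= r) (D0 : 0 <= D).
Hypotheses (ap : approximated R b1 b2 p s q k q_ V_) (ap' : approximated R b1 b2 p s q' k' q'_ V'_).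
Local Notation mu := (leb R).
Hypothesis qr : (\int[mu]_(t in `[0%R, 1%R]) (pot_abs R q t `^ p)%:E <= r%:E)%E.
Hypothesis q'r : (\int[mu]_(t in `[0%R, 1%R]) (pot_abs R q' t `^ p)%:E <= r%:E)%E.
Hypothesis qD : (\int[mu]_(t in `[0%R, 1%R])
  (pot_abs R (fun l c t => q l c t - q' l c t) t `^ p)%:E <= D%:E)%E.

Definition kernel_dist (z : R * R) : R :=
  \sum_(m : bool * bool * bool) `|k m.1 m.2 z - k' m.1 m.2 z|.

(** 8^p and 8 come from the eight real parts summed in [kernel_dist], and [c] compares a pointwise
    size with that sum. *)
Definition norm_cst (c : R) : R := c `^ p * (8 `^ p * (8 * kernel_cst R b1 b2 p r)).

Lemma norm_cst_ge0 c : 0 <= norm_cst c.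
Proof.
rewrite /norm_cst mulr_ge0 ?powR_ge0// mulr_ge0 ?powR_ge0// mulr_ge0//.
have k0 l := ltW (gratio_gt0 R b1 b2 b10 b20 l).
rewrite /kernel_cst mulr_ge0 ?addr_ge0 ?invr_ge0// mulr_ge0//.
apply: goursat_cst_ge0; rewrite /kernel_rho addr_ge0// mulr_ge0 ?powR_ge0//.
by rewrite mulr_ge0 ?powR_ge0// addr_ge0// mulr_ge0 ?powR_ge0.
Qed.

Let mk m : measurable_fun (@Omega R) (fun z => `|k m.1 m.2 z - k' m.1 m.2 z|).
Proof.
move: m => m; apply: measurableT_comp => //; apply: measurable_funB.
  exact: (apx_mk ap).
exact: (apx_mk ap').
Qed.

(** Stated for an arbitrary parametrization [w] of a slice, so that horizontal and vertical slices
    are treated together. *)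
Let slice_bound (S : set R) (w : R -> R * R) (a : R * R -> R) (c : R) : measurable S -> 0 <= c ->
  (forall z, 0 <= a z <= c * kernel_dist z) ->
  (forall m : bool * bool * bool, measurable_fun S (fun u => `|k m.1 m.2 (w u) - k' m.1 m.2 (w u)|)) ->
  (forall m : bool * bool * bool, (\int[mu]_(u in S) (`|k m.1 m.2 (w u) - k' m.1 m.2 (w u)| `^ p)%:E <=
    (kernel_cst R b1 b2 p r * D)%:E)%E) ->
  (\int[mu]_(u in S) (a (w u) `^ p)%:E <= (norm_cst c * D)%:E)%E.
Proof.
move=> mS c0 ac mw wb.
have H := integral_powR_sum_le R S (bool * bool * bool)%type p _ _ p1 mS mw
  (fun m u _ => normr_ge0 _) wb.
rewrite !card_prod card_bool in H.
have -> : norm_cst c * D = c `^ p * (8 `^ p * (8 * (kernel_cst R b1 b2 p r * D))).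
  by rewrite /norm_cst; ring.
apply: (integral_powR_mono R S p c _ (fun u => kernel_dist (w u))) => //.
- exact: measurable_sum.
- by move=> u _; have /andP[] := ac (w u).
- by move=> u _; exact: sumr_ge0.
- by move=> u _; have /andP[] := ac (w u).
Qed.

Lemma Xinfnorm_le (a : R * R -> R) (c : R) : 0 <= c ->
  (forall z, 0 <= a z <= c * kernel_dist z) ->
  (Xinfnorm p a <= ((norm_cst c * D) `^ p^-1)%:E)%E.
Proof.
move=> c0 ac; apply: ess_sup01_poweR_le => //.
- by rewrite mulr_ge0// norm_cst_ge0.
- by move=> x; apply: integral_ge0 => t _; rewrite lee_fin powR_ge0.
apply: aeW => x; rewrite in_itv/= => xI.
apply: (slice_bound `[0, x] (fun t => (x, t))) => //.
  by move=> m; apply: (measurable_slice_fst R _ x xI (mk m)).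
move=> m; exact: (approximated_lipschitz_fst R b1 b2 p r D s q q' k k' q_ q'_ V_ V'_).
Qed.

Lemma X1norm_le (a : R * R -> R) (c : R) : 0 <= c ->
  (forall z, 0 <= a z <= c * kernel_dist z) ->
  (X1norm p a <= ((norm_cst c * D) `^ p^-1)%:E)%E.
Proof.
move=> c0 ac; apply: ess_sup01_poweR_le => //.
- by rewrite mulr_ge0// norm_cst_ge0.
- by move=> x; apply: integral_ge0 => t _; rewrite lee_fin powR_ge0.
have L i l := approximated_lipschitz_snd R b1 b2 p r D s q q' k k' q_ q'_ V_ V'_
  b10 b20 p1 r0 D0 ap ap' qr q'r qD i l.
have Lall i := ae_and _ _ _ (L i false) (L i true).
have Lall2 := ae_and _ _ _ (ae_and _ _ _ (Lall (false, false)) (Lall (false, true)))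
  (ae_and _ _ _ (Lall (true, false)) (Lall (true, true))).
refine (ae_imp _ _ _ _ Lall2) => t H tI.
have tI' : 0 <= t <= 1 by move: tI; rewrite in_itv.
apply: (slice_bound `[t, 1] (fun x => (x, t))) => //.
  by move=> m; apply: (measurable_slice_snd R _ t tI' (mk m)).
case: H => [[[h1 h2] [h3 h4]] [[h5 h6] [h7 h8]]].
by case=> -[[] []] []; [exact: h8|exact: h7|exact: h6|exact: h5|exact: h4|exact: h3|exact: h2|exact: h1].
Qed.

End NormBounds.
Lemma normr_sign_mul (R : realType) (c : bool) (x : R) : `|(-1) ^+ c * x| = `|x|.
Proof. by rewrite normrM normrX normrN1 expr1n mul1r. Qed.

Lemma kernel_part_dist (R : realType) (s : bool) (K K' : R * R -> 'M[R[i]]_2) i l z :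
  `|kernel_part R s K i l z - kernel_part R s K' i l z| =
  `|cpart R i.2 ((K z - K' z) (ord2 i.1) (ord2 l))|.
Proof.
rewrite /kernel_part -mulrBr normr_sign_mul !mxE cpartB /cpart.
by case: i.2.
Qed.

Lemma normc_le_kernel_dist (R : realType) (k k' : bool * bool -> bool -> R * R -> R) j l z
    (w : R[i]) :
  (forall c, `|cpart R c w| = `|k (j, c) l z - k' (j, c) l z|) ->
  Normc.normc w <= kernel_dist R k k' z.
Proof.
move=> h; apply: (le_trans (normc_le_ReIm _ _)).
rewrite -[complex.Re w]/(cpart R false w) -[complex.Im w]/(cpart R true w) !h /kernel_dist.
rewrite (bigD1 (j, false, l))//= (bigD1 (j, true, l))/=; last by case: (j); case: (l).
by rewrite addrA lerDl; exact: sumr_ge0.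
Qed.

Lemma ord2K (j : 'I_2) : ord2 (j != 0) = j.
Proof. by case: j => -[|[|//]] lj; apply/val_inj. Qed.

Lemma pot_abs_le_norm (R : realType) (b1 b2 c2 : R) (N : 'M[R[i]]_2 -> R) (Q : R -> 'M[R[i]]_2) t :
  (forall (A : 'M[R[i]]_2) (m : bool * bool * bool),
    `|cpart R m.1.2 (A (ord2 m.1.1) (ord2 m.2))| <= c2 * N A) ->
  pot_abs R (pot_part R b1 b2 Q) t <= 4 * (`|b1| + `|b2|) * c2 * N (Q t).
Proof.
move=> Nc; rewrite pot_absE.
have b12 k : `|gspeed R b1 b2 k| <= `|b1| + `|b2|.
  by rewrite /gspeed; case: k; rewrite ?lerDl ?lerDr.
apply: (@le_trans _ _ (\sum_(j : bool * bool) (`|b1| + `|b2|) * (c2 * N (Q t)))).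
  apply: ler_sum => -[l c] _ /=.
  apply: (@le_trans _ _ (`|gspeed R b1 b2 l| * `|cpart R (~~ c) (Q t (ord2 l) (ord2 (~~ l)))|)).
    by rewrite /pot_part /cpart; case: c; rewrite /= ?normrN normrM.
  by apply: ler_pM => //; exact: (Nc (Q t) (l, ~~ c, ~~ l)).
rewrite sumr_const card_prod card_bool -[leLHS]mulr_natl.
by rewrite [leLHS](_ : _ = 4 * (`|b1| + `|b2|) * c2 * N (Q t))// !mulrA.
Qed.

Lemma pot_partB (R : realType) (b1 b2 : R) (Q Q' : R -> 'M[R[i]]_2) l c t :
  pot_part R b1 b2 Q l c t - pot_part R b1 b2 Q' l c t =
  pot_part R b1 b2 (fun x => Q x - Q' x) l c t.
Proof.
rewrite /pot_part !mxE; case: (Q t _ _) => u v; case: (Q' t _ _) => u' v'.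
by case: c => /=; ring.
Qed.

Lemma measurable_pot_part (R : realType) (b1 b2 : R) (Q : R -> 'M[R[i]]_2) l c :
  potential_matrix Q -> measurable_fun (`[0, 1]%classic : set R) (pot_part R b1 b2 Q l c).
Proof.
by move=> pQ; apply/measurable_EFinP; exact: (measurable_int _ (integrable_pot_part _ _ _ _ pQ l c)).
Qed.

Section KernelRegularity.
Context (R : realType) (b1 b2 p r : R) (s : bool) (Q : R -> 'M[R[i]]_2) (K : R * R -> 'M[R[i]]_2).
Hypotheses (b10 : b1 < 0) (b20 : 0 < b2) (p1 : 1 <= p) (r0 : 0 <= r) (potQ : potential_matrix Q).
Hypothesis kerK : is_kernel b1 b2 Q s K.
Local Notation mu := (leb R).
Local Notation q := (pot_part R b1 b2 Q).
Hypothesis Qr : (\int[mu]_(t in `[0%R, 1%R]) (pot_abs R q t `^ p)%:E <= r%:E)%E.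

Lemma pot_part_Lp l c : (\int[mu]_(t in `[0%R, 1%R]) (`|q l c t| `^ p)%:E < +oo)%E.
Proof.
apply: (@le_lt_trans _ _ r%:E); last exact: ltry.
apply: le_trans Qr; apply: ge0_le_integral_all => t _; first by rewrite lee_fin powR_ge0.
rewrite lee_fin; apply: ge0_ler_powR; rewrite ?nnegrE ?pot_abs_ge0 ?pot_abs_ge//.
by rewrite (le_trans ler01 p1).
Qed.

(** One bound valid at once for the potential, for zero and for all approximations, since the
    estimate between two records takes a common bound for both potentials. *)
Let r1 : R := 2 `^ p * (r + 4 `^ p * 4).
Let rr1 : r <= r1.
Proof.
have two1 : 1 <= 2 `^ p :> R by rewrite -[leLHS](powRr0 2) ler_powR// ?ler1n// (le_trans ler01 p1).
apply: (@le_trans _ _ (1 * (r + 4 `^ p * 4))).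
  by rewrite mul1r lerDl mulr_ge0// powR_ge0.
by apply: ler_wpM2r => //; rewrite addr_ge0// mulr_ge0// powR_ge0.
Qed.
Let r10 : 0 <= r1. Proof. exact: le_trans rr1. Qed.

(** Two comparisons. Against the zero potential, whose amplitudes and kernels vanish, the estimate
    bounds [K] itself and gives finite norms. Against the approximating potentials, whose kernels
    are continuous, it gives distances tending to 0, that is, membership in the closures. *)
Lemma kernel_mxX0 : mxX0 p K.
Proof.
have p0 : 0 < p by exact: lt_le_trans p1.
have [q_ [V_ ap]] := approximated_exists R b1 b2 p s Q K b10 b20 p1 potQ kerK pot_part_Lp.
have mq l c := measurable_pot_part R b1 b2 Q l c potQ.
have sol0 : goursat_sol R _ (gpot R (fun _ _ _ => 0)) (ginit R s) (fun _ _ => 0).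
  by rewrite gpot0; exact: goursat_sol0.
have ap0 := approximated_cst R b1 b2 p s (fun _ _ _ => 0) _ p1
  (fun _ _ => @cst_continuous _ _ _) sol0.
have Qr1 : (\int[mu]_(t in `[0%R, 1%R]) (pot_abs R q t `^ p)%:E <= r1%:E)%E.
  by apply: (le_trans Qr); rewrite lee_fin.
have zr1 : (\int[mu]_(t in `[0%R, 1%R]) (pot_abs R (fun _ _ _ => 0) t `^ p)%:E <= r1%:E)%E.
  rewrite (_ : (fun t => _) = cst 0%E) ?integral0//.
  apply/funext => t; rewrite pot_absE big1 ?powR0 ?gt_eqF// => j _; exact: normr0.
have qz : (\int[mu]_(t in `[0%R, 1%R]) (pot_abs R (fun l c t => q l c t - 0) t `^ p)%:E <= r1%:E)%E.
  rewrite (_ : (fun l c t => _) = q)//.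
  by do 3!(apply/funext => ?); rewrite subr0.
have err n : (\int[mu]_(t in `[0%R, 1%R])
    (pot_abs R (fun l c t => q l c t - q_ n l c t) t `^ p)%:E <= (4 `^ p * (4 * 2^-1 ^+ n))%:E)%E.
  apply: integral_pot_abs_le => // l c; last exact: (apx_le ap).
  apply: measurable_funB => //.
  apply: measurable_funTS; apply: continuous_measurable_fun.
  exact: (apx_cq ap).
have q_r1 n : (\int[mu]_(t in `[0%R, 1%R]) (pot_abs R (q_ n) t `^ p)%:E <= r1%:E)%E.
  have mc l c : measurable_fun (`[0, 1]%classic : set R) (q_ n l c).
    apply: measurable_funTS; apply: continuous_measurable_fun.
    exact: (apx_cq ap).
  have e1 : (\int[mu]_(t in `[0%R, 1%R])
    (pot_abs R (fun l c t => q l c t - q_ n l c t) t `^ p)%:E <= (4 `^ p * 4)%:E)%E.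
    apply: (le_trans (err n)); rewrite lee_fin; apply: ler_wpM2l; first exact: powR_ge0.
    by rewrite ler_piMr// exprn_ile1// invf_le1// ler1n.
  apply: (integral_powRD_le _ _ _ _ _ _ _ _ p1 (measurable_itv _) _ _ _ _ _ _ Qr e1) => //.
  - exact: measurable_pot_abs.
  - by apply: measurable_pot_abs => l c; exact: measurable_funB.
  - by move=> t _; exact: pot_abs_ge0.
  - by move=> t _; exact: pot_abs_ge0.
  - by move=> t _; exact: pot_abs_ge0.
  move=> t _; rewrite !pot_absE -big_split/=; apply: ler_sum => j _.
  rewrite -[X in `|X| <= _](subKr (q j.1 j.2 t)); exact: ler_normB.
move=> j' l'; rewrite -(ord2K j') -(ord2K l').
move: (j' != 0) (l' != 0) => {j' l'} j l.
have [mX0 _ _] := kerK.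
have nc0 (w : R[i]) : 0 <= Normc.normc w by case: w => u v; exact: sqrtr_ge0.
have mf : cmeasurable_fun (@Omega R) (fun z => K z (ord2 j) (ord2 l)).
  by have [[[? _] _] _] := mX0 (ord2 j) (ord2 l).
pose c0 : R := 1.
have c00 : 0 <= c0 by exact: ler01.
pose kp := kernel_part R s K.
have bnd0 z : 0 <= cabs (fun z => K z (ord2 j) (ord2 l)) z <=
    c0 * kernel_dist R kp (gker R b1 b2 (fun _ _ => 0)) z.
  rewrite mul1r; apply/andP; split; first exact: nc0.
  apply: (normc_le_kernel_dist R _ _ j l) => c.
  by rewrite /gker mulr0 subr0 /kp /kernel_part normr_sign_mul /cpart; case: c.
(* [sg] undoes the sign that [kernel_part] puts into the second column; being its own inverse, it
   disappears from absolute values. *)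
pose sg : R := (-1) ^+ (s && l).
pose F n (z : R * R) : R[i] :=
  (sg * gker R b1 b2 (V_ n) (j, false) l z +i* (sg * gker R b1 b2 (V_ n) (j, true) l z))%C.
have cF n : ccontinuous_on (@Omega R) (F n).
  have cV := (apx_sol ap n).1.
  split; apply: continuous_subspaceT; apply: continuous_mul_fun;
    [exact: cst_continuous|exact: continuous_gker|exact: cst_continuous|exact: continuous_gker].
have bndF n z : 0 <= cabs (fun z => K z (ord2 j) (ord2 l) - F n z) z <=
    c0 * kernel_dist R kp (gker R b1 b2 (V_ n)) z.
  rewrite mul1r; apply/andP; split; first exact: nc0.
  apply: (normc_le_kernel_dist R _ _ j l) => c.
  rewrite -(normr_sign_mul R (s && l)) cpartB mulrBr /kp /kernel_part /F /cpart /sg.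
  by case: c; rewrite /= mulrA -expr2 sqrr_sign mul1r.
have apn n := approximated_cst R b1 b2 p s (q_ n) (V_ n) p1
  (apx_cq ap n) (apx_sol ap n).
pose D n : R := 4 `^ p * (4 * 2^-1 ^+ n).
have D0 n : 0 <= D n.
  by rewrite mulr_ge0 ?powR_ge0// mulr_ge0// exprn_ge0// invr_ge0.
have Dlim (eps : R) : 0 < eps -> exists n, (norm_cst R b1 b2 p r1 c0 * D n) `^ p^-1 < eps.
  move=> eps0.
  have : (fun n => norm_cst R b1 b2 p r1 c0 * D n) @ \oo --> 0.
    rewrite -(mulr0 (norm_cst R b1 b2 p r1 c0)); apply: cvgM; first exact: cvg_cst.
    rewrite -(mulr0 (4 `^ p)); apply: cvgM; first exact: cvg_cst.
    rewrite -(mulr0 4); apply: cvgM; first exact: cvg_cst.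
    by apply: cvg_expr; rewrite gtr0_norm ?invr_gt0// invf_lt1// ltr1n.
  move=> /cvgr_lt/(_ _ (powR_gt0 p eps0))[n _ /(_ n (leqnn n)) /= Hn].
  exists n; have -> : eps = (eps `^ p) `^ p^-1 by rewrite -powRrM mulfV ?gt_eqF// powRr1// ltW.
  apply: gt0_ltr_powR; rewrite ?nnegrE ?invr_gt0 ?powR_ge0//.
  by rewrite mulr_ge0// norm_cst_ge0.
split; split.
- split=> //; apply: le_lt_trans (ltry _).
  exact: (X1norm_le R b1 b2 p r1 r1 s q _ kp _ _ _ _ _ b10 b20 p1 r10 r10 ap ap0 Qr1 zr1 qz _ _ c00 bnd0).
- move=> eps /Dlim[n Hn]; exists (F n) => //.
  apply: le_lt_trans (_ : ((norm_cst R b1 b2 p r1 c0 * D n) `^ p^-1)%:E < eps%:E)%E.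
    exact: (X1norm_le R b1 b2 p r1 (D n) s q (q_ n) kp _ _ _ _ _ b10 b20 p1 r10 (D0 n) ap (apn n)
      Qr1 (q_r1 n) (err n) _ _ c00 (bndF n)).
  by rewrite lte_fin.
- split=> //; apply: le_lt_trans (ltry _).
  exact: (Xinfnorm_le R b1 b2 p r1 r1 s q _ kp _ _ _ _ _ b10 b20 p1 r10 r10 ap ap0 Qr1 zr1 qz _ _ c00 bnd0).
- move=> eps /Dlim[n Hn]; exists (F n) => //.
  apply: le_lt_trans (_ : ((norm_cst R b1 b2 p r1 c0 * D n) `^ p^-1)%:E < eps%:E)%E.
    exact: (Xinfnorm_le R b1 b2 p r1 (D n) s q (q_ n) kp _ _ _ _ _ b10 b20 p1 r10 (D0 n) ap (apn n)
      Qr1 (q_r1 n) (err n) _ _ c00 (bndF n)).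
  by rewrite lte_fin.
Qed.

End KernelRegularity.

Local Open Scope complex_scope.

Theorem theorem3p3 (R : realType) (b1 b2 : R) (hb1 : b1 < 0) (hb2 : 0 < b2)
    (N : 'M[R[i]]_2 -> R) (hN : is_mxnorm N)
    (p r : R) (hp : 1 <= p) (hr : 0 < r) :
  (forall (Q : R -> 'M[R[i]]_2) (s : bool) (K : R * R -> 'M[R[i]]_2),
     Upr N p r Q -> is_kernel b1 b2 Q s K -> mxX0 p K) /\
  (exists C : R,
     forall (Q Qt : R -> 'M[R[i]]_2) (s : bool) (K Kt : R * R -> 'M[R[i]]_2),
       Upr N p r Q -> Upr N p r Qt ->
       is_kernel b1 b2 Q s K -> is_kernel b1 b2 Qt s Kt ->
       (Xinfnorm p (fun z => N (K z - Kt z)%R) +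
        X1norm p (fun z => N (K z - Kt z)%R)
          <= C%:E * Lpnorm N p (fun x => Q x - Qt x)%R)%E).
Proof.
have [c1 [c2 [c10 c20 Nle Nge]]] := mxnorm_equiv R N hN.
have p0 : 0 < p by exact: lt_le_trans hp.
(* The factor of [pot_abs_le_norm], by which N (Q x) dominates the real coefficients of the
   system. *)
pose c3 : R := 4 * (`|b1| + `|b2|) * c2.
have c30 : 0 < c3.
  do 2!apply: mulr_gt0 => //.
  by rewrite addr_gt0// normr_gt0; [rewrite lt_eqF|rewrite gt_eqF].
pose r0 : R := c3 `^ p * r `^ p.
have r00 : 0 <= r0 by rewrite mulr_ge0 ?powR_ge0.
have N0 A : 0 <= N A.
  have := Nge A (false, false, false); rewrite -(pmulr_rge0 (N A) c20).
  exact: le_trans (normr_ge0 _).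
have pot_le Q (a : R) : potential_matrix Q ->
    (\int[leb R]_(t in `[0%R, 1%R]) (N (Q t) `^ p)%:E <= a%:E)%E ->
    (\int[leb R]_(t in `[0%R, 1%R])
      (pot_abs R (pot_part R b1 b2 Q) t `^ p)%:E <= (c3 `^ p * a)%:E)%E.
  move=> potQ Qa.
  apply: (integral_powR_mono_r R `[0, 1] p c3 a (fun t => N (Q t))) => //.
  - by apply: measurable_pot_abs => l c; exact: measurable_pot_part.
  - by move=> t _; exact: pot_abs_ge0.
  - by move=> t _; exact: pot_abs_le_norm.
have Jge0 (Q : R -> 'M[R[i]]_2) :
    (0 <= \int[leb R]_(t in `[0%R, 1%R]) (N (Q t) `^ p)%:E)%E.
  by apply: integral_ge0 => t _; rewrite lee_fin powR_ge0.
have Upr_le Q : Upr N p r Q -> (\int[leb R]_(t in `[0%R, 1%R])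
    (pot_abs R (pot_part R b1 b2 Q) t `^ p)%:E <= r0%:E)%E.
  move=> [potQ Qr]; apply: pot_le => //.
  by apply: le_poweR_inv => //; exact: ltW.
split.
  by move=> Q s K QU kK; apply: (kernel_mxX0 R b1 b2 p r0 s Q K) => //; [exact: QU.1|exact: Upr_le].
pose M : R := (norm_cst R b1 b2 p r0 c1 * c3 `^ p) `^ p^-1.
have M0 : 0 <= M by exact: powR_ge0.
(* Each of the two norms costs [M]; the summand 1 makes the constant positive, so that the
   right-hand side is infinite if the norm of the difference of the potentials is. *)
exists (2 * M + 1) => Q Qt s K Kt QU QtU kK kKt.
have potQ := QU.1; have potQt := QtU.1.
have C0 : 0 < 2 * M + 1 by rewrite ltr_wpDl// mulr_ge0.
have := Jge0 (fun x => Q x - Qt x).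
rewrite /Lpnorm; set J := (\int[_]_(t in _) _)%E => J0.
case EJ : J J0 => [J'| |//] J0; last first.
  by rewrite poweRyr ?invr_eq0 ?gt_eqF// gt0_muley ?lte_fin// leey.
rewrite poweR_EFin.
have J'0 : 0 <= J' by rewrite -lee_fin.
have [q_ [V_ ap]] := approximated_exists R b1 b2 p s Q K hb1 hb2 hp potQ kK
  (pot_part_Lp R b1 b2 p r0 Q hp (Upr_le Q QU)).
have [qt_ [Vt_ apt]] := approximated_exists R b1 b2 p s Qt Kt hb1 hb2 hp potQt kKt
  (pot_part_Lp R b1 b2 p r0 Qt hp (Upr_le Qt QtU)).
have D0 : 0 <= c3 `^ p * J' by rewrite mulr_ge0 ?powR_ge0.
have qD : (\int[leb R]_(t in `[0%R, 1%R])
    (pot_abs R (fun l c t => pot_part R b1 b2 Q l c t - pot_part R b1 b2 Qt l c t) t `^ p)%:E <=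
    (c3 `^ p * J')%:E)%E.
  apply: (integral_powR_mono_r R `[0, 1] p c3 J' (fun t => N (Q t - Qt t))) => //.
  - apply: measurable_pot_abs => l c; apply: measurable_funB; exact: measurable_pot_part.
  - by move=> t _; exact: pot_abs_ge0.
  - move=> t _; apply: le_trans (pot_abs_le_norm R b1 b2 c2 N (fun x => Q x - Qt x) t Nge).
    by rewrite !pot_absE; apply: ler_sum => j _; rewrite pot_partB.
  - by rewrite -/J EJ.
have bnd z : 0 <= N (K z - Kt z) <= c1 * kernel_dist R (kernel_part R s K) (kernel_part R s Kt) z.
  rewrite N0/=; apply: (le_trans (Nle _)); apply: ler_wpM2l => //.
  by apply: ler_sum => m _; rewrite kernel_part_dist.
(* Taking the root turns the bound linear in the p-th power J' into one linear in the norm of the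
   difference of the potentials. *)
have E : (norm_cst R b1 b2 p r0 c1 * (c3 `^ p * J')) `^ p^-1 = M * J' `^ p^-1.
  rewrite mulrA powRM// mulr_ge0 ?powR_ge0//; exact: norm_cst_ge0.
have XI := Xinfnorm_le R b1 b2 p r0 _ s _ _ _ _ _ _ _ _ hb1 hb2 hp r00 D0 ap apt
  (Upr_le Q QU) (Upr_le Qt QtU) qD (fun z => N (K z - Kt z)) c1 c10 bnd.
have X1 := X1norm_le R b1 b2 p r0 _ s _ _ _ _ _ _ _ _ hb1 hb2 hp r00 D0 ap apt
  (Upr_le Q QU) (Upr_le Qt QtU) qD (fun z => N (K z - Kt z)) c1 c10 bnd.
rewrite E in XI X1.
apply: (le_trans (leeD XI X1)).
rewrite -EFinD -EFinM lee_fin.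
have j0 : 0 <= J' `^ p^-1 by exact: powR_ge0.
rewrite mulrDl mul1r -mulrA mulr_natl mulr2n lerDl; exact: j0.
Qed.
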